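(* Let $m(x_0,x_1)=m(x_0,x_1;\alpha_0)$ with $\alpha_0\in\mathbb R^{d_\alpha}$ and suppose the following hold. (A1) $\mathbb M$ is bounded on $L^2$; there exist positive functions $\phi,\phi^*\in L^2$ and a scalar $\rho>0$ with $\mathbb M\phi=\rho\phi$ and $\mathbb M^*\phi^*=\rho\phi^*$; $\phi$ and $\phi^*$ are the unique (up to scale) positive solutions in $L^2$ of these two problems; $\rho$ is a simple and isolated eigenvalue of $\mathbb M$ and is the largest eigenvalue of $\mathbb M$; and, when $\phi,\phi^*$ are scaled so that $\mathbb E[\phi(X_t)\phi^*(X_t)]=1$, $\lim_{\tau\to\infty}\rho^{-\tau}\mathbb M_\tau\psi(x)=\mathbb E[\psi(X_t)\phi^*(X_t)]\,\phi(x)$ for all $\psi\in L^2$. (A2) $\|\Pi_k\mathbb M-\mathbb M\|=o(1)$. (A3) $\|\widehat{\mathbf G}^o-\mathbf I\|=o_p(1)$ and $\|\widehat{\mathbf M}^o-\mathbf M^o\|=o_p(1)$. (A4) (a) $\|\Pi_k\phi-\phi\|=o(n^{-1/2})$ and $\|\Pi_k\phi^*-\phi^*\|=o(n^{-1/2})$; (b) $\|\widehat{\mathbf G}^o-\mathbf I\|=o_p(n^{-1/4})$ and $\|\widehat{\mathbf M}^o-\mathbf M^o\|=o_p(n^{-1/4})$; (c) $\mathbb E[(\phi^*(X_t)m(X_t,X_{t+1})\phi(X_{t+1}))^2]<\infty$. Normalize $\phi,\phi^*$ so that $\|\phi\|=1$, $\langle\phi,\phi^*\rangle=1$, let $\psi_\rho(x_0,x_1)=\phi^*(x_0)m(x_0,x_1)\phi(x_1)-\rho\,\phi^*(x_0)\phi(x_0)$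 and $\psi_{\rho,t}=\psi_\rho(X_t,X_{t+1})$. (A5) (a) $\sqrt n(\hat\alpha-\alpha_0)=\frac1{\sqrt n}\sum_{t=0}^{n-1}\psi_{\alpha,t}+o_p(1)$ for some $\mathbb R^{d_\alpha}$-valued random process $\{\psi_{\alpha,t}\}$; (b) $\frac1{\sqrt n}\sum_{t=0}^{n-1}(\psi_{\rho,t},\psi_{\alpha,t}')'\to_dN(0,V_{[2a]})$ for some finite matrix $V_{[2a]}$; (c) $m(x_0,x_1;\alpha)$ is continuously differentiable in $\alpha$ on a neighborhood $N$ of $\alpha_0$ for all $(x_0,x_1)\in\mathcal X^2$, and there is $\bar m:\mathcal X^2\to\mathbb R$ with $\mathbb E[\bar m(X_t,X_{t+1})^s]<\infty$ for some $s\ge2$ such that $\sup_{\alpha\in N}\|\partial m(x_0,x_1;\alpha)/\partial\alpha\|\le\bar m(x_0,x_1)$ for all $(x_0,x_1)\in\mathcal X^2$; (d) $\mathbb E[(\phi(X_{t+1})\phi^*(X_t))^{s/(s-1)}]<\infty$. Let $h_{[2a]}=\big(1,\ \mathbb E[\phi^*(X_t)\phi(X_{t+1})\,\partial m(X_t,X_{t+1};\alpha_0)/\partial\alpha']\big)'$ and $V_\rho^{[2a]}=h_{[2a]}'V_{[2a]}h_{[2a]}$. Then $\sqrt n(\hat\rho-\rho)\to_dN(0,V_\rho^{[2a]})$.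
   Context: $X=\{X_t:t=0,1,2,\dots\}$ is a time-homogeneous, strictly stationary and ergodic first-order Markov process with values in $\mathcal X\subseteq\mathbb R^d$ and stationary distribution $Q$. $m(\cdot,\cdot;\alpha)$ is a family of functions on $\mathcal X^2$ of known functional form, positive at the true parameter $\alpha_0$. $L^2$ is the space of $\psi:\mathcal X\to\mathbb R$ with $\int\psi^2\,dQ<\infty$, with norm $\|\cdot\|$ and inner product $\langle\cdot,\cdot\rangle$; functions are identified $Q$-a.e., and ''positive'' means positive $Q$-a.e. The operator $\mathbb M\psi(x)=\mathbb E[m(X_t,X_{t+1})\psi(X_{t+1})\mid X_t=x]$ acts on $L^2$; $\mathbb M_\tau=\mathbb M^\tau$; $\mathbb M^*$ is the adjoint, $\mathbb M^*\psi(x)=\mathbb E[m(X_t,X_{t+1})\psi(X_t)\mid X_{t+1}=x]$. $\|\cdot\|$ also denotes the operator norm on $L^2$, the Euclidean norm of vectors and the operator norm (largest singular value) of matrices. An eigenvalue is simple if it has a unique eigenfunction up to scale, and isolated if some neighborhood of it contains no other point of the spectrum. Sieve: for each $k$, $b_{k1},\dots,b_{kk}\in L^2$ are linearly independent, $B_k$ is their linear span, $b^k(x)=(b_{k1}(x),\dots,b_{kk}(x))'$, and $\Pi_k:L^2\to B_k$ is the orthogonal projection. The dimension $k=k(n)\to\infty$ as $n\to\infty$. $\mathbf G=\mathbb E[b^k(X_t)b^k(X_t)']$ (nonsingular) and $\mathbf M=\mathbb E[b^k(X_t)m(X_t,X_{t+1})b^k(X_{t+1})']$. Estimators: $\hat\alpha$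 is a first-stage estimator of $\alpha_0$. From data $X_0,\dots,X_n$, $\widehat{\mathbf G}=\frac1n\sum_{t=0}^{n-1}b^k(X_t)b^k(X_t)'$ and $\widehat{\mathbf M}=\frac1n\sum_{t=0}^{n-1}b^k(X_t)m(X_t,X_{t+1};\hat\alpha)b^k(X_{t+1})'$. $\hat\rho$ is the largest real generalized eigenvalue of $(\widehat{\mathbf M},\widehat{\mathbf G})$ (well defined with probability approaching one). $\mathbf M^o=\mathbf G^{-1/2}\mathbf M\mathbf G^{-1/2}$, $\widehat{\mathbf G}^o=\mathbf G^{-1/2}\widehat{\mathbf G}\mathbf G^{-1/2}$, $\widehat{\mathbf M}^o=\mathbf G^{-1/2}\widehat{\mathbf M}\mathbf G^{-1/2}$; $\mathbf I$ is the $k\times k$ identity. *)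

(* Defs.v *)
From HB Require Import structures.
From mathcomp Require Import all_boot all_order all_algebra.
From mathcomp Require Import all_classical all_reals all_analysis.
From mathcomp Require Import complex.

Set Implicit Arguments.
Unset Strict Implicit.
Unset Printing Implicit Defensive.

Import Order.TTheory GRing.Theory Num.Theory.
Import numFieldNormedType.Exports.

Local Open Scope classical_set_scope.
Local Open Scope ring_scope.

(* R^d with its Borel sigma-algebra, generated by the coordinates *)
Notation Rvec R d := (d.-tuple (measurableTypeR R)).

Definition Ex (R : realType) dO (Omega : measurableType dO)
  (P : probability Omega R) (Z : Omega -> R) : R := \int[P]_w Z w.

Definition finite_mean (R : realType) dO (Omega : measurableType dO)
  (P : probability Omega R) (Z : Omega -> R) : Prop :=
  P.-integrable [set: Omega] (EFin \o Z).

Definition enorm (R : realType) (m n : nat) (A : 'M[R]_(m, n)) : R :=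
  Num.sqrt (\sum_i \sum_j A i j ^+ 2).

(* Operator norm for the Euclidean norms, i.e. the largest singular value *)
Definition mx_opnorm (R : realType) (m n : nat) (A : 'M[R]_(m, n)) : R :=
  sup [set enorm (A *m v) | v in [set v : 'cV[R]_n | enorm v <= 1]].

Definition posdefmx (R : realType) (n : nat) (A : 'M[R]_n) : Prop :=
  A^T = A /\ forall v : 'cV[R]_n, v != 0 -> 0 < (v^T *m A *m v) 0 0.

(* G^{-1/2}: the positive definite square root of G^{-1} *)
Definition inv_sqrtm (R : realType) (n : nat) (G : 'M[R]_n) : 'M[R]_n :=
  xget 0 [set S | posdefmx S /\ S *m S = invmx G].

Definition orthonormalized (R : realType) (n : nat) (G A : 'M[R]_n) : 'M[R]_n :=
  inv_sqrtm G *m A *m inv_sqrtm G.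

Definition gen_eigenvalue (R : realType) (n : nat) (M G : 'M[R]_n) (r : R) : Prop :=
  exists2 v : 'cV[R]_n, v != 0 & M *m v = r *: (G *m v).

Definition largest_gen_eigenvalue (R : realType) (n : nat) (M G : 'M[R]_n)
    (r : R) : Prop :=
  gen_eigenvalue M G r /\ forall r', gen_eigenvalue M G r' -> r' <= r.

Definition gradient (R : realType) (p : nat) (f : 'rV[R]_p -> R)
    (a : 'rV[R]_p) : 'rV[R]_p :=
  \row_j 'd (f : 'rV[R]_p -> R^o) a (delta_mx 0 j).

Definition continuously_differentiable_on (R : realType) (p : nat)
    (f : 'rV[R]_p -> R) (N : set 'rV[R]_p) : Prop :=
  forall a, N a -> differentiable (f : 'rV[R]_p -> R^o) a /\
    {for a, continuous (gradient f)}.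

(* g(x) is a version of E[Z | X = x] *)
Definition is_cond_exp (R : realType) dO (Omega : measurableType dO)
    (P : probability Omega R) dS (S : measurableType dS)
    (X : Omega -> S) (Z : Omega -> R) (g : S -> R) : Prop :=
  [/\ finite_mean P Z, measurable_fun [set: S] g, finite_mean P (g \o X) &
      forall B : set S, measurable B ->
        \int[P]_(w in X @^-1` B) Z w = \int[P]_(w in X @^-1` B) g (X w)].

(* x |-> E[Z | X = x]; a version is chosen, and the value is 0 when Z is not
   integrable *)
Definition cond_exp (R : realType) dO (Omega : measurableType dO)
    (P : probability Omega R) dS (S : measurableType dS)
    (X : Omega -> S) (Z : Omega -> R) : S -> R :=
  xget (fun=> 0) [set g | is_cond_exp P X Z g].

Definition pathsp_cylinder dS (S : measurableType dS) : set (set (nat -> S)) :=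
  [set C | exists i, exists2 B, measurable B & C = [set x : nat -> S | B (x i)]].

Definition path_event dS (S : measurableType dS) : set (set (nat -> S)) :=
  <<s @pathsp_cylinder dS S >>.

Definition strictly_stationary (R : realType) dO (Omega : measurableType dO)
    (P : probability Omega R) dS (S : measurableType dS)
    (X : nat -> Omega -> S) : Prop :=
  forall (s : nat) (A : set (nat -> S)), path_event A ->
    P [set w | A (fun t => X (s + t)%N w)] = P [set w | A (fun t => X t w)].

Definition ergodic (R : realType) dO (Omega : measurableType dO)
    (P : probability Omega R) dS (S : measurableType dS)
    (X : nat -> Omega -> S) : Prop :=
  forall A : set (nat -> S), path_event A ->
    [set x : nat -> S | A (fun t => x t.+1)] = A ->
    P [set w | A (fun t => X t w)] = 0%E \/ P [set w | A (fun t => X t w)] = 1%E.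

(* sigma(X_0, ..., X_t) *)
Definition past dO (Omega : measurableType dO) dS (S : measurableType dS)
    (X : nat -> Omega -> S) (t : nat) : set (set Omega) :=
  <<s [set C | exists2 i, (i <= t)%N &
        exists2 B, measurable B & C = X i @^-1` B] >>.

Definition markov_chain (R : realType) dO (Omega : measurableType dO)
    (P : probability Omega R) dS (S : measurableType dS)
    (X : nat -> Omega -> S) : Prop :=
  exists K : R.-pker S ~> S,
    forall (t : nat) (A : set Omega) (B : set S), past X t A -> measurable B ->
      P (A `&` X t.+1 @^-1` B) = (\int[P]_(w in A) K (X t w) B)%E.

(* Y_n = o_p(a_n), through outer probability: no measurability of Y_n needed *)
Definition little_op (R : realType) dO (Omega : measurableType dO)
    (P : probability Omega R) (Y : nat -> Omega -> R) (a : nat -> R) : Prop :=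
  forall e : R, 0 < e -> exists A : nat -> set Omega,
    [/\ forall n, measurable (A n),
        forall n, [set w | e * a n <= `|Y n w|] `<=` A n &
        P (A n) @[n --> \oo] --> 0%E].

(* The limit law is that of Z under mu. *)
Definition cvg_in_dist (R : realType) dO (Omega : measurableType dO)
    (P : probability Omega R) dL (L : measurableType dL) (mu : probability L R)
    (E : topologicalType) (Y : nat -> Omega -> E) (Z : L -> E) : Prop :=
  forall f : E -> R, continuous f -> (exists C, forall x, `|f x| <= C) ->
    (\int[P]_w f (Y n w)) @[n --> \oo] --> \int[mu]_z f (Z z).

(* N(0, v), with N(0, 0) the Dirac mass; normal_prob takes the standard
   deviation and does not treat 0 as the degenerate case *)
Definition normal_law (R : realType) (v : R) : probability (measurableTypeR R) R :=
  if v == 0 then (dirac (0 : measurableTypeR R) : probability _ _)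
  else (normal_prob 0 (Num.sqrt v) : probability _ _).

Definition row_of_tuple (R : realType) (p : nat) (z : Rvec R p) : 'rV[R]_p :=
  \row_j tnth z j.

(* mu is N(0, V) on R^p, possibly degenerate: a z' ~ N(0, a V a') for all a *)
Definition is_normal_vec (R : realType) (p : nat) (V : 'M[R]_p)
    (mu : probability (Rvec R p) R) : Prop :=
  V^T = V /\
  forall a : 'rV[R]_p, 0 <= (a *m V *m a^T) 0 0 /\
    forall B : set (measurableTypeR R), measurable B ->
      mu [set z | B ((a *m (row_of_tuple z)^T) 0 0)] =
      normal_law ((a *m V *m a^T) 0 0) B.

Definition cvg_normal (R : realType) dO (Omega : measurableType dO)
    (P : probability Omega R) (Y : nat -> Omega -> R) (v : R) : Prop :=
  cvg_in_dist P (normal_law v) Y id.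

Definition cvg_normal_vec (R : realType) dO (Omega : measurableType dO)
    (P : probability Omega R) (p : nat) (Y : nat -> Omega -> 'rV[R]_p)
    (V : 'M[R]_p) : Prop :=
  exists2 mu, is_normal_vec V mu & cvg_in_dist P mu Y (@row_of_tuple R p).

(* L^2(Q); functions are not quotiented, equality in L^2 is {ae Q, _} *)
Definition L2 (R : realType) dS (S : measurableType dS)
    (Q : probability S R) : set (S -> R) :=
  [set f | f \in Lfun Q 2%:E].

Definition L2norm (R : realType) dS (S : measurableType dS)
    (Q : probability S R) (f : S -> R) : \bar R :=
  'N[Q]_2%:E[EFin \o f]%E.

Definition inner (R : realType) dS (S : measurableType dS)
    (Q : probability S R) (f g : S -> R) : R := \int[Q]_x (f x * g x).

Definition op_norm (R : realType) dS (S : measurableType dS)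
    (Q : probability S R) (T : (S -> R) -> (S -> R)) : \bar R :=
  ereal_sup [set L2norm Q (T f) | f in [set f | L2 Q f /\ (L2norm Q f <= 1)%E]].

Definition bounded_op (R : realType) dS (S : measurableType dS)
    (Q : probability S R) (T : (S -> R) -> (S -> R)) : Prop :=
  exists C : R, forall f, L2 Q f ->
    L2 Q (T f) /\ (L2norm Q (T f) <= C%:E * L2norm Q f)%E.

Definition in_span (R : realType) (S : Type) (k : nat) (b : 'I_k -> S -> R)
    (g : S -> R) : Prop :=
  exists c : 'I_k -> R, g = fun x => \sum_i c i * b i x.

Definition lin_indep (R : realType) dS (S : measurableType dS)
    (Q : probability S R) (k : nat) (b : 'I_k -> S -> R) : Prop :=
  forall c : 'I_k -> R, {ae Q, forall x, \sum_i c i * b i x = 0} ->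
    forall i, c i = 0.

Definition orth_proj (R : realType) dS (S : measurableType dS)
    (Q : probability S R) (k : nat) (b : 'I_k -> S -> R) (f : S -> R) : S -> R :=
  xget (fun=> 0) [set g | in_span b g /\
    forall h, in_span b h -> inner Q (f \- g) h = 0].

(* The spectrum of an operator T on the real space L^2 is that of its
   complexification, which acts on L^2 + i L^2. *)
Definition L2C (R : realType) dS (S : measurableType dS)
    (Q : probability S R) : set (S -> R[i]) :=
  [set h | L2 Q (fun x => complex.Re (h x)) /\ L2 Q (fun x => complex.Im (h x))].

Definition L2Cnorm (R : realType) dS (S : measurableType dS)
    (Q : probability S R) (h : S -> R[i]) : \bar R :=
  L2norm Q (fun x => ComplexField.Normc.normc (h x)).

Definition complexify (R : realType) (S : Type) (T : (S -> R) -> (S -> R))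
    (h : S -> R[i]) : S -> R[i] :=
  fun x => Complex (T (fun y => complex.Re (h y)) x)
                   (T (fun y => complex.Im (h y)) x).

Definition in_resolvent (R : realType) dS (S : measurableType dS)
    (Q : probability S R) (T : (S -> R) -> (S -> R)) (l : R[i]) : Prop :=
  exists C : R, forall u, L2C Q u -> exists h,
    [/\ L2C Q h,
        {ae Q, forall x, complexify T h x - l * h x = u x},
        (L2Cnorm Q h <= C%:E * L2Cnorm Q u)%E &
        forall h', L2C Q h' ->
          {ae Q, forall x, complexify T h' x - l * h' x = u x} ->
          {ae Q, forall x, h' x = h x}].

Definition spectrum (R : realType) dS (S : measurableType dS)
    (Q : probability S R) (T : (S -> R) -> (S -> R)) : set R[i] :=
  [set l | ~ in_resolvent Q T l].

Definition eigenfunction (R : realType) dS (S : measurableType dS)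
    (Q : probability S R) (T : (S -> R) -> (S -> R)) (l : R[i])
    (h : S -> R[i]) : Prop :=
  [/\ L2C Q h, ~ {ae Q, forall x, h x = 0} &
      {ae Q, forall x, complexify T h x = l * h x}].

Definition eigenvalue (R : realType) dS (S : measurableType dS)
    (Q : probability S R) (T : (S -> R) -> (S -> R)) (l : R[i]) : Prop :=
  exists h, eigenfunction Q T l h.

Definition simple_eigenvalue (R : realType) dS (S : measurableType dS)
    (Q : probability S R) (T : (S -> R) -> (S -> R)) (l : R[i]) : Prop :=
  eigenvalue Q T l /\
  forall h1 h2, eigenfunction Q T l h1 -> eigenfunction Q T l h2 ->
    exists c : R[i], {ae Q, forall x, h2 x = c * h1 x}.

Definition isolated_eigenvalue (R : realType) dS (S : measurableType dS)
    (Q : probability S R) (T : (S -> R) -> (S -> R)) (l : R[i]) : Prop :=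
  eigenvalue Q T l /\
  exists2 e : R, 0 < e & forall z, spectrum Q T z ->
    ComplexField.Normc.normc (z - l) < e -> z = l.

Definition largest_eigenvalue (R : realType) dS (S : measurableType dS)
    (Q : probability S R) (T : (S -> R) -> (S -> R)) (l : R) : Prop :=
  eigenvalue Q T (Complex l 0) /\
  forall z, eigenvalue Q T z -> ComplexField.Normc.normc z <= l.

Definition ae_pos (R : realType) dS (S : measurableType dS)
    (Q : probability S R) (f : S -> R) : Prop := {ae Q, forall x, 0 < f x}.

(* f is, up to scale, the only positive solution in L^2 of T f = r f *)
Definition unique_positive_eigenfunction (R : realType) dS (S : measurableType dS)
    (Q : probability S R) (T : (S -> R) -> (S -> R)) (r : R) (f : S -> R) : Prop :=
  [/\ L2 Q f, ae_pos Q f, {ae Q, forall x, T f x = r * f x} &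
      forall g, L2 Q g -> ae_pos Q g -> {ae Q, forall x, T g x = r * g x} ->
        exists c : R, {ae Q, forall x, g x = c * f x}].

(* The operator psi |-> E[m(X_t,X_{t+1}) psi(X_{t+1}) | X_t = x] and its
   adjoint; by stationarity they do not depend on t. *)
Definition Mop (R : realType) dO (Omega : measurableType dO)
    (P : probability Omega R) dS (S : measurableType dS)
    (X : nat -> Omega -> S) (m : S -> S -> R) (psi : S -> R) : S -> R :=
  cond_exp P (X 0%N) (fun w => m (X 0%N w) (X 1%N w) * psi (X 1%N w)).

Definition Mop_adj (R : realType) dO (Omega : measurableType dO)
    (P : probability Omega R) dS (S : measurableType dS)
    (X : nat -> Omega -> S) (m : S -> S -> R) (psi : S -> R) : S -> R :=
  cond_exp P (X 1%N) (fun w => m (X 0%N w) (X 1%N w) * psi (X 0%N w)).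

(* The integrability clause says that the conditional expectation defining
   Mop exists on the whole of L^2. *)
Definition Mop_bounded (R : realType) dO (Omega : measurableType dO)
    (P : probability Omega R) dS (S : measurableType dS) (Q : probability S R)
    (X : nat -> Omega -> S) (m : S -> S -> R) : Prop :=
  (forall psi, L2 Q psi ->
     finite_mean P (fun w => m (X 0%N w) (X 1%N w) * psi (X 1%N w))) /\
  bounded_op Q (Mop P X m).

Definition Gmat (R : realType) dO (Omega : measurableType dO)
    (P : probability Omega R) (S : Type) (X : nat -> Omega -> S)
    (k : nat) (b : 'I_k -> S -> R) : 'M[R]_k :=
  \matrix_(i, j) Ex P (fun w => b i (X 0%N w) * b j (X 0%N w)).

Definition Mmat (R : realType) dO (Omega : measurableType dO)
    (P : probability Omega R) (S : Type) (X : nat -> Omega -> S)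
    (m : S -> S -> R) (k : nat) (b : 'I_k -> S -> R) : 'M[R]_k :=
  \matrix_(i, j)
    Ex P (fun w => b i (X 0%N w) * m (X 0%N w) (X 1%N w) * b j (X 1%N w)).

Definition Ghat (R : realType) (S : Type) (k : nat) (b : 'I_k -> S -> R)
    (x : nat -> S) (n : nat) : 'M[R]_k :=
  n%:R^-1 *: \sum_(t < n) \matrix_(i, j) (b i (x t) * b j (x t)).

Definition Mhat (R : realType) (S : Type) (m : S -> S -> R) (k : nat)
    (b : 'I_k -> S -> R) (x : nat -> S) (n : nat) : 'M[R]_k :=
  n%:R^-1 *: \sum_(t < n) \matrix_(i, j) (b i (x t) * m (x t) (x t.+1) * b j (x t.+1)).

Definition psi_rho (R : realType) (S : Type) (m : S -> S -> R) (rho : R)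
    (phi phis : S -> R) (x0 x1 : S) : R :=
  phis x0 * m x0 x1 * phi x1 - rho * phis x0 * phi x0.

(* Main.v *)
(* The matrix problem is the compression of M to B_k, perturbed by sampling
   errors of operator norm eta = o_p(n^{-1/4}).  Since Pi_k M -> M in norm, M is
   a norm limit of finite-rank operators; a compactness argument then turns
   "rho is simple, isolated and the largest eigenvalue" into a uniform bound
   |M f - l f| >= c |f| for l >= rho - e and f orthogonal to phi^*.  A bordered
   matrix argument, uniform in k, shows that the perturbed problem has a largest
   real eigenvalue, equal to
       rho + <phi^*_k, (Mhat - rho Ghat) phi_k> + O((eta + |phi - phi_k| + |phi^* - phi^*_k|)^2),
   where phi_k and phi^*_k are the projections on B_k.  Multiplied by sqrt n the
   remainder is o_p(1), and the linear term is a sample average of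
   phi^*_k(X_t) m(X_t, X_{t+1}; alphahat) phi_k(X_{t+1}) - rho phi^*_k(X_t) phi_k(X_t).
   The projections are replaced by phi and phi^* using (A4)(a), the estimated
   parameter by a first-order expansion whose derivative average converges by the
   ergodic theorem, and Slutsky's lemma concludes. *)
Require Import Defs.
From HB Require Import structures.
From mathcomp Require Import all_boot all_order all_algebra.
From mathcomp Require Import all_classical all_reals all_analysis.
From mathcomp Require Import complex measurable_realfun.
From mathcomp Require Import ring lra.

Set Implicit Arguments.
Unset Strict Implicit.
Unset Printing Implicit Defensive.

Import Order.TTheory GRing.Theory Num.Theory.
Import numFieldNormedType.Exports.

Local Open Scope classical_set_scope.
Local Open Scope ring_scope.

(** * Semi-inner products *)

(** The norm of Pi_k M - M comes without a rate, so it may not enter the remainder. It does not,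
    because in the expansion the projection error of the operator acts only on a difference
    orthogonal to [phis], where the gap absorbs it; the left eigenvalue equation for [phis] then
    cancels the first-order effect of the eigenvector error. The pencil is not symmetric, so a real
    eigenvalue has to be produced: a cofactor of the bordered matrix, multiplied by its determinant,
    changes sign across rho. Functions are not quotiented and conditional expectations are chosen up
    to null sets, so the Hilbert space part is written for a semi-inner product and an operator that
    is linear up to null vectors. In the parameter step, weighted products of projection errors have
    no integrable bound of their own. The largest projection error along the sample is o_p(1), since
    its square is at most the sum of the squares, whose mean is n o(1/n). The linearization error is
    a supremum over rational increments, measurable and dominated, so pointwise differentiability
    and dominated convergence suffice. *)

Record semi_ip (R : realType) (H : lmodType R) (ip : H -> H -> R) : Prop := SemiIp {
  ipC : forall f g, ip f g = ip g f;
  ipDl : forall f g h, ip (f + g) h = ip f h + ip g h;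
  ipZl : forall a f h, ip (a *: f) h = a * ip f h;
  ip_ge0 : forall f, 0 <= ip f f }.

Definition snorm (R : realType) (H : lmodType R) (ip : H -> H -> R) (f : H) : R :=
  Num.sqrt (ip f f).

Section semi_ip_theory.
Context (R : realType) (H : lmodType R) (ip : H -> H -> R).
Hypothesis hip : semi_ip ip.
Local Notation nrm := (snorm ip).

Lemma ip0l h : ip 0 h = 0.
Proof. by rewrite -(scale0r (0 : H)) (ipZl hip) mul0r. Qed.

Lemma ipNl f h : ip (- f) h = - ip f h.
Proof. by rewrite -scaleN1r (ipZl hip) mulN1r. Qed.

Lemma ipBl f g h : ip (f - g) h = ip f h - ip g h.
Proof. by rewrite (ipDl hip) ipNl. Qed.

Lemma ipDr f g h : ip h (f + g) = ip h f + ip h g.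
Proof. by rewrite !(ipC hip h) (ipDl hip). Qed.

Lemma ipZr a f h : ip h (a *: f) = a * ip h f.
Proof. by rewrite !(ipC hip h) (ipZl hip). Qed.

Lemma ipBr f g h : ip h (f - g) = ip h f - ip h g.
Proof. by rewrite !(ipC hip h) ipBl. Qed.

Lemma ip_suml (I : finType) (F : I -> H) h : ip (\sum_i F i) h = \sum_i ip (F i) h.
Proof.
by apply: (big_morph (ip^~ h)) => [f g|]; rewrite ?(ipDl hip) ?ip0l.
Qed.

Lemma ip_sumr (I : finType) (F : I -> H) h : ip h (\sum_i F i) = \sum_i ip h (F i).
Proof. by rewrite (ipC hip) ip_suml; apply: eq_bigr => i _; rewrite (ipC hip). Qed.

Lemma snorm_ge0 f : 0 <= nrm f. Proof. exact: sqrtr_ge0. Qed.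

Lemma sqr_snorm f : nrm f ^+ 2 = ip f f.
Proof. by rewrite sqr_sqrtr // (ip_ge0 hip). Qed.

Lemma snormZ a f : nrm (a *: f) = `|a| * nrm f.
Proof.
by rewrite /snorm (ipZl hip) ipZr mulrA -expr2 sqrtrM ?sqr_ge0// sqrtr_sqr.
Qed.

Lemma snorm0 : nrm 0 = 0. Proof. by rewrite /snorm ip0l sqrtr0. Qed.

Lemma snormN f : nrm (- f) = nrm f.
Proof. by rewrite -scaleN1r snormZ normrN1 mul1r. Qed.

Lemma ip_snorm0 f g : nrm f = 0 -> ip f g = 0.
Proof.
move=> f0; have ff : ip f f = 0 by rewrite -sqr_snorm f0 expr0n.
have gg := ip_ge0 hip g.
apply/eqP/negPn/negP => fg.
(* As <f, f> = 0, this multiple of f gives the square -2 - <g, g>, which is negative. *)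
have := ip_ge0 hip (g - ((1 + ip g g) / ip f g) *: f).
rewrite ipBl !ipBr !(ipZl hip) !ipZr ff (ipC hip g f).
rewrite !mulr0 subr0 !divfK //; lra.
Qed.

Lemma ip_le f g : `|ip f g| <= nrm f * nrm g.
Proof.
have [f0|f0] := eqVneq (nrm f) 0.
  by rewrite ip_snorm0 // normr0 mulr_ge0 // snorm_ge0.
have f1 : 0 < nrm f by rewrite lt_neqAle eq_sym f0 snorm_ge0.
have ff : 0 < ip f f by rewrite -sqr_snorm exprn_gt0.
rewrite -(ler_pXn2r (_ : 0 < 2)%N) ?nnegrE ?mulr_ge0 ?snorm_ge0 //.
rewrite exprMn !sqr_snorm real_normK ?num_real //.
have := ip_ge0 hip (ip f f *: g - ip f g *: f).
rewrite ipBl !ipBr !(ipZl hip) !ipZr (ipC hip g f) => h.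
have : 0 <= ip f f * (ip f f * ip g g - ip f g ^+ 2).
  by apply: le_trans h _; rewrite le_eqVlt; apply/orP; left; apply/eqP; ring.
by rewrite pmulr_rge0 // subr_ge0.
Qed.

Lemma snormD f g : nrm (f + g) <= nrm f + nrm g.
Proof.
rewrite -(ler_pXn2r (_ : 0 < 2)%N) ?nnegrE ?addr_ge0 ?snorm_ge0 //.
rewrite sqr_snorm (ipDl hip) !ipDr sqrrD !sqr_snorm (ipC hip g f).
have := le_trans (ler_norm _) (ip_le f g); lra.
Qed.

Lemma snormB f g : nrm (f - g) <= nrm f + nrm g.
Proof. by rewrite -(snormN g) snormD. Qed.

Lemma snorm_distD g f h : nrm (f - h) <= nrm (f - g) + nrm (g - h).
Proof. by rewrite (_ : f - h = (f - g) + (g - h)) ?snormD // addrA subrK. Qed.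

Lemma snorm_distC f g : nrm (f - g) = nrm (g - f).
Proof. by rewrite -opprB snormN. Qed.

Lemma snorm_le_dist f g : nrm f <= nrm g + nrm (f - g).
Proof. by rewrite -{1}(subrK g f) addrC snormD. Qed.

Lemma snorm_sum (I : finType) (F : I -> H) : nrm (\sum_i F i) <= \sum_i nrm (F i).
Proof.
elim/big_ind2: _ => [|x a y b ha hb|//]; first by rewrite snorm0.
by rewrite (le_trans (snormD _ _)) // lerD.
Qed.

End semi_ip_theory.

(** Limits along an ultrafilter replace the extraction of subsequences: finitely many bounded
    coordinate sequences converge along the same ultrafilter, with no diagonal argument. *)
Lemma ultra_bounded_cvg (R : realType) (U : set_system nat) (x : nat -> R) (a b : R) :
  UltraFilter U -> (forall j, a <= x j <= b) ->
  exists2 l, a <= l <= b & forall e : R, 0 < e -> U [set j | `|x j - l| <= e].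
Proof.
move=> UU xab.
have [|l [lab cl]] := @segment_compact R a b (x @ U) _.
  by rewrite /= nbhs_simpl /=; apply: filterE => j /=; rewrite in_itv /= xab.
exists l => [|e e0]; first by move: lab; rewrite /= in_itv.
have [//|UC] := in_ultra_setVsetC [set j | `|x j - l| <= e] UU.
have [y [/= yA yB]] :
    (~` [set y | `|y - l| <= e] `&` ball l e) !=set0.
  by apply: cl; [exact: UC | exact: nbhsx_ballx].
by exfalso; apply: yA; apply: ltW; rewrite distrC.
Qed.

Lemma le0_mul_eps (R : realType) (x K : R) : (forall e : R, 0 < e -> x <= K * e) -> x <= 0.
Proof.
move=> h; apply/ler_addgt0Pr => e e0; rewrite add0r.
have K0 : 0 < `|K| + 1 by rewrite ltr_pwDr.
apply: le_trans (h (e / (`|K| + 1)) _) _; first by rewrite divr_gt0.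
rewrite mulrC -mulrA ler_piMr ?(ltW e0) // mulrC ler_pdivrMr // mul1r.
by rewrite (le_trans (ler_norm K)) // lerDl.
Qed.

Definition orthonormal_family (R : realType) (H : lmodType R) (ip : H -> H -> R) k
  (e : 'I_k -> H) : Prop := forall i j, ip (e i) (e j) = (i == j)%:R.

Definition complete_ip (R : realType) (H : lmodType R) (ip : H -> H -> R) : Prop :=
  forall u : nat -> H,
  (forall eps : R, 0 < eps -> exists N, forall i j, (N <= i)%N -> (N <= j)%N ->
     snorm ip (u i - u j) <= eps) ->
  exists g, forall eps : R, 0 < eps -> exists N, forall i, (N <= i)%N ->
     snorm ip (u i - g) <= eps.

(* Linearity is only required up to vectors of norm zero, since conditional
   expectations are chosen up to null sets. *)
Record bounded_linear (R : realType) (H : lmodType R) (ip : H -> H -> R)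
    (T : H -> H) (C : R) : Prop := BoundedLinear {
  op_linear : forall a f g, snorm ip (T (a *: f + g) - (a *: T f + T g)) = 0;
  op_bounded : forall f, snorm ip (T f) <= C * snorm ip f }.

(** Compactness of [T] in the form that a sieve provides: [T] is a norm limit of its compositions
    with finite-dimensional orthogonal projections. *)
Definition finite_rank_approx (R : realType) (H : lmodType R) (ip : H -> H -> R)
    (T : H -> H) : Prop :=
  forall eps : R, 0 < eps -> exists k (e : 'I_k -> H), orthonormal_family ip e /\
    forall f, snorm ip (T f - \sum_i ip (T f) (e i) *: e i) <= eps * snorm ip f.

Section gap.
Context (R : realType) (H : lmodType R) (ip : H -> H -> R).
Hypothesis hip : semi_ip ip.
Local Notation nrm := (snorm ip).
Context (T : H -> H) (TC : R).
Hypothesis hT : bounded_linear ip T TC.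

Lemma ip_op_linear a f g h : ip (T (a *: f + g)) h = a * ip (T f) h + ip (T g) h.
Proof.
rewrite -(ipZl hip) -(ipDl hip); apply/eqP.
by rewrite -subr_eq0 -(ipBl hip) (ip_snorm0 hip) // (op_linear hT).
Qed.

Lemma snorm_opB f g : nrm (T (f - g) - (T f - T g)) = 0.
Proof.
have := op_linear hT (-1) g f.
by rewrite !scaleN1r (addrC _ f) (addrC _ (T f)).
Qed.

Lemma snorm_eq0_dist f g : nrm (f - g) = 0 -> nrm f = nrm g.
Proof.
move=> fg; apply/le_anti/andP; split.
  by rewrite (le_trans (snorm_le_dist hip f g)) // fg addr0.
by rewrite (le_trans (snorm_le_dist hip g f)) // (snorm_distC hip) fg addr0.
Qed.

Lemma snorm_op_dist f g : nrm (T f - T g) <= TC * nrm (f - g).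
Proof. by rewrite -(snorm_eq0_dist (snorm_opB f g)) (op_bounded hT). Qed.

Lemma snorm_opZ a f : nrm (T (a *: f) - a *: T f) = 0.
Proof.
have /eqP := op_linear hT 1 0 0; rewrite scaler0 addr0 scale1r opprD addrA subrr sub0r.
rewrite (snormN hip) => /eqP T0.
have := op_linear hT a f 0; rewrite addr0 => h.
apply/eqP; rewrite eq_le snorm_ge0 andbT.
rewrite (le_trans (snorm_distD hip (a *: T f + T 0) _ _)) // h add0r.
by rewrite addrAC subrr add0r T0.
Qed.

Hypothesis TC0 : 0 <= TC.
Hypothesis hfr : finite_rank_approx ip T.

(** The part of [T (f j)] in a finite-dimensional space has coordinates that converge along [U], and
    the rest is at most [eps / 2]. The point [g] depends on [eps]; completeness later turns these
    approximations into a limit. *)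
Lemma ultra_op_approx (U : set_system nat) (f : nat -> H) : UltraFilter U ->
  (forall j, nrm (f j) <= 1) -> forall eps : R, 0 < eps ->
  exists g, U [set j | nrm (T (f j) - g) <= eps].
Proof.
move=> UU f1 eps eps0.
have e2 : 0 < eps / 2 by rewrite divr_gt0.
have [k [e [oe he]]] := hfr e2.
have e1 i : nrm (e i) = 1 by rewrite /snorm oe eqxx sqrtr1.
have hl i : exists l : R, forall r : R, 0 < r -> U [set j | `|ip (T (f j)) (e i) - l| <= r].
  have [j|l _ hl] := @ultra_bounded_cvg R U (fun j => ip (T (f j)) (e i)) (- TC) TC UU.
    rewrite -ler_norml (le_trans (ip_le hip _ _)) // e1 mulr1.
    by rewrite (le_trans (op_bounded hT _)) // ler_piMr.
  by exists l.
pose l i := projT1 (cid (hl i)).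
have lP i (r : R) : 0 < r -> U [set j | `|ip (T (f j)) (e i) - l i| <= r].
  by move: r; rewrite /l; case: cid.
exists (\sum_i l i *: e i).
(* The successor keeps the divisor nonzero when the family is empty. *)
pose r := eps / 2 / k.+1%:R.
have r0 : 0 < r by rewrite divr_gt0.
have : U [set j | forall i : 'I_k, `|ip (T (f j)) (e i) - l i| <= r].
  by apply: filter_forall => i; exact: lP.
apply: filterS => j hj /=.
rewrite (le_trans (snorm_distD hip (\sum_i ip (T (f j)) (e i) *: e i) _ _)) //.
rewrite (splitr eps) lerD //.
  by rewrite (le_trans (he _)) // ler_piMr // ltW.
rewrite -sumrB (le_trans (snorm_sum hip _)) //.
apply: (@le_trans _ _ (\sum_(i < k) r)).
  apply: ler_sum => i _.
  by rewrite -scalerBl (snormZ hip) e1 mulr1; exact: hj.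
rewrite sumr_const card_ord -[leLHS]mulr_natr /r mulrAC ler_pdivrMr ?ltr0Sn //.
by rewrite ler_pM2l // ler_nat.
Qed.

End gap.

(** * Spectral gap above the top eigenvalue *)

(** The spectral data on which the perturbation argument rests. Field [te_top] leaves [rho] as the
    only eigenvalue at or above [rho - e0], and [te_rho] keeps that range away from 0, where
    compactness would give no control of eigenvectors. Field [te_adj] is the left eigenvalue
    equation in weak form. *)
Record top_eigenvalue (R : realType) (H : lmodType R) (ip : H -> H -> R)
    (T : H -> H) (TC rho e0 : R) (phi phis : H) : Prop := TopEigenvalue {
  te_ip : semi_ip ip;
  te_lin : bounded_linear ip T TC;
  te_TC : 0 <= TC;
  te_complete : complete_ip ip;
  te_fr : finite_rank_approx ip T;
  te_norm : snorm ip phi = 1;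
  te_dual : ip phi phis = 1;
  te_eig : snorm ip (T phi - rho *: phi) = 0;
  te_adj : forall f, ip (T f) phis = rho * ip f phis;
  te_e0 : 0 < e0;
  te_rho : e0 < rho;
  te_top : forall (l : R) f, rho - e0 <= l -> snorm ip f != 0 ->
    snorm ip (T f - l *: f) = 0 -> l = rho;
  te_simple : forall f, snorm ip (T f - rho *: f) = 0 ->
    exists c, snorm ip (f - c *: phi) = 0 }.

Section gap.
Context (R : realType) (H : lmodType R) (ip : H -> H -> R) (T : H -> H)
  (TC rho e0 : R) (phi phis : H).
Hypothesis hte : top_eigenvalue ip T TC rho e0 phi phis.
Local Notation nrm := (snorm ip).
Let hip := te_ip hte.
Let hT := te_lin hte.

(** Completeness speaks of sequences, so a property of [U]-almost all indices at each tolerance is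
    turned into a genuine sequence of indices tending to infinity. *)
Lemma ultra_subseq (U : set_system nat) (A : R -> set nat) : UltraFilter U ->
  \oo `<=` U -> (forall e : R, 0 < e -> U (A e)) ->
  exists s : nat -> nat, forall i, (i <= s i)%N /\
    forall j, (j <= i)%N -> A j.+1%:R^-1 (s i).
Proof.
move=> UU oU hA.
suff h i : exists n, (i <= n)%N /\ forall j, (j <= i)%N -> A j.+1%:R^-1 n.
  by exists (fun i => projT1 (cid (h i))) => i; case: (cid (h i)).
have : U ([set n | (i <= n)%N] `&`
    [set n | forall j : 'I_i.+1, A (j : nat).+1%:R^-1 n]).
  apply: filterI; first by apply: oU; exists i => // n /=.
  by apply: filter_forall => j; apply: hA; rewrite invr_gt0.
move=> /filter_ex [n [/= hn hA']]; exists n; split=> // j ji.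
exact: (hA' (Ordinal (ji : (j < i.+1)%N))).
Qed.

(** The images [T (f j)] have a Cauchy subsequence. Its limit [g] is an eigenvector, because
    [l j *: f j] is close to [T (f j)] and the limit [lam] of [l j] is positive. Then [lam = rho],
    so [g] is a multiple of [phi] orthogonal to [phis], and duality makes it null, although its norm
    is [lam]. *)
Lemma no_unit_approx_eigenvectors (f : nat -> H) (l : nat -> R) :
  (forall j, nrm (f j) = 1) -> (forall j, ip (f j) phis = 0) ->
  (forall j, rho - e0 <= l j) ->
  (forall j, nrm (T (f j) - l j *: f j) <= j.+1%:R^-1) -> False.
Proof.
move=> f1 fphis lrho hf.
have TC0 := te_TC hte.
have inv1 (j : nat) : (j.+1%:R^-1 : R) <= 1 by rewrite invf_le1 // ler1n.
have lj j : rho - e0 <= l j <= TC + 1.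
  rewrite lrho /= -[l j]mulr1 -{1}(f1 j) (le_trans (ler_norm _)) //.
  rewrite normrM (ger0_norm (snorm_ge0 ip _)) -(snormZ hip).
  rewrite (le_trans (snorm_le_dist hip _ (T (f j)))) // lerD //.
    by rewrite (le_trans (op_bounded hT _)) // f1 mulr1.
  by rewrite (snorm_distC hip) (le_trans (hf j)).
have [U [UU oU]] := ultraFilterLemma (eventually_filter).
have [lam /andP[lam1 _] hlam] := ultra_bounded_cvg UU lj.
have f1' j : nrm (f j) <= 1 by rewrite f1.
have lam0 : 0 < lam by apply: lt_le_trans lam1; rewrite subr_gt0 (te_rho hte).
have hg (e : R) (ep : 0 < e) := ultra_op_approx hip hT TC0 (te_fr hte) UU f1' ep.
(* Membership asks for a point [g] near [T (f j)] that is also near [T (f n)] for [U]-almost every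
   [n]; two members are then compared through a common such [n]. *)
pose A (e : R) : set nat := [set j | `|l j - lam| <= e /\
  exists g, U [set j | nrm (T (f j) - g) <= e] /\ nrm (T (f j) - g) <= e].
have UA e : 0 < e -> U (A e).
  move=> ep; have [g hgU] := hg e ep.
  by apply: filterS (filterI (hlam e ep) hgU) => j [h1 h2]; split=> //; exists g.
have AA (e : R) i j : A e i -> A e j -> nrm (T (f i) - T (f j)) <= 4 * e.
  move=> [_ [g [Ug hi]]] [_ [g' [Ug' hj]]].
  have [n [/= n1 n2]] := filter_ex (filterI Ug Ug').
  have h1 := snorm_distD hip g (T (f i)) (T (f j)).
  have h2 := snorm_distD hip (T (f n)) g (T (f j)).
  have h3 := snorm_distD hip g' (T (f n)) (T (f j)).
  rewrite (snorm_distC hip g (T (f n))) in h2; rewrite (snorm_distC hip g' (T (f j))) in h3.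
  lra.
have [s hs] := ultra_subseq UU oU UA.
have invN (e : R) : 0 < e -> exists N : nat, N.+1%:R^-1 <= e.
  move=> ep; have [N _ hN] := near_infty_natSinv_lt (PosNum ep).
  by exists N; apply/ltW; apply: (hN N) => /=.
have [g hgl] : exists g, forall eps : R, 0 < eps -> exists N, forall i, (N <= i)%N ->
    nrm (T (f (s i)) - g) <= eps.
  apply: (te_complete hte) => eps ep.
  have [N hN] := invN (eps / 4) (divr_gt0 ep (ltr0Sn _ 3)).
  exists N => i j Ni Nj.
  apply: le_trans (AA N.+1%:R^-1 _ _ _ _) _; [exact: (hs i).2|exact: (hs j).2|].
  by rewrite mulrC -ler_pdivlMr.
have near_g (e : R) : 0 < e -> exists j, [/\ nrm (T (f j) - g) <= e,
    `|l j - lam| <= e & nrm (T (f j) - l j *: f j) <= e].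
  move=> ep; have [N1 h1] := invN e ep; have [N2 h2] := hgl e ep.
  have hi1 := leq_maxl N1 N2; have hi2 := leq_maxr N1 N2.
  set i := maxn N1 N2 in hi1 hi2.
  exists (s i); split; first exact: h2.
    by have [+ _] := (hs i).2 _ hi1; move=> h; exact: le_trans h h1.
  apply: le_trans (hf _) _; apply: le_trans h1.
  rewrite lef_pV2 ?posrE ?ltr0Sn // ler_nat ltnS.
  exact: leq_trans hi1 (hs i).1.
have near_lf (e : R) j : nrm (T (f j) - g) <= e -> `|l j - lam| <= e ->
    nrm (T (f j) - l j *: f j) <= e -> nrm (g - lam *: f j) <= 3 * e.
  move=> h1 h2 h3.
  have := snorm_distD hip (T (f j)) g (lam *: f j).
  have := snorm_distD hip (l j *: f j) (T (f j)) (lam *: f j).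
  rewrite (snorm_distC hip g (T (f j))) -scalerBl (snormZ hip (l j - lam)) f1; lra.
have Tg : nrm (T g - lam *: g) = 0.
  apply/eqP; rewrite eq_le snorm_ge0 andbT.
  apply: (@le0_mul_eps _ _ (3 * TC + lam)) => e ep.
  have [j [h1 h2 h3]] := near_g e ep.
  have h4 := near_lf e j h1 h2 h3.
  have := snorm_distD hip (T (lam *: f j)) (T g) (lam *: g).
  have := snorm_distD hip (lam *: T (f j)) (T (lam *: f j)) (lam *: g).
  have := snorm_op_dist hip hT g (lam *: f j).
  rewrite (snorm_opZ hip hT) -scalerBr (snormZ hip) (gtr0_norm lam0).
  have := ler_wpM2l TC0 h4; have := ler_wpM2l (ltW lam0) h1; lra.
have ng : nrm g != 0.
  apply/negP => /eqP g0; suff : lam <= 0 by rewrite leNgt lam0.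
  apply: (@le0_mul_eps _ _ 3) => e ep.
  have [j [h1 h2 h3]] := near_g e ep; have := near_lf e j h1 h2 h3.
  have := snorm_le_dist hip (lam *: f j) g.
  by rewrite (snormZ hip) (gtr0_norm lam0) f1 g0 add0r mulr1 (snorm_distC hip); lra.
have gphis : ip g phis = 0.
  apply/eqP; rewrite -normr_eq0 eq_le normr_ge0 andbT.
  apply: (@le0_mul_eps _ _ (3 * nrm phis)) => e ep.
  have [j [h1 h2 h3]] := near_g e ep; have h := near_lf e j h1 h2 h3.
  have := ip_le hip (g - lam *: f j) phis.
  rewrite (ipBl hip) (ipZl hip) fphis mulr0 subr0 => h4.
  by rewrite (le_trans h4) // mulrAC ler_wpM2r ?snorm_ge0.
have lamrho := te_top hte lam1 ng Tg.
have [c gc] : exists c, nrm (g - c *: phi) = 0.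
  by apply: (te_simple hte); rewrite -lamrho.
have := ip_snorm0 hip phis gc.
rewrite (ipBl hip) (ipZl hip) gphis (te_dual hte) mulr1 sub0r => /eqP.
rewrite oppr_eq0 => /eqP c0; move: gc.
by rewrite c0 scale0r subr0 => /eqP; rewrite (negbTE ng).
Qed.

(** If every constant [j.+1%:R^-1] failed, rescaling would give unit approximate eigenvectors. The
    constant is uniform over all [l] from [rho - e0] upwards, so the gap can be used at a sample
    eigenvalue before that eigenvalue is located. *)
Lemma spectral_gap : exists2 c : R, 0 < c & forall (l : R) f, rho - e0 <= l ->
  ip f phis = 0 -> c * nrm f <= nrm (T f - l *: f).
Proof.
apply: contrapT => hno.
have bad (j : nat) : exists fl : H * R, [/\ nrm fl.1 = 1, ip fl.1 phis = 0,
    rho - e0 <= fl.2 & nrm (T fl.1 - fl.2 *: fl.1) <= j.+1%:R^-1].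
  apply: contrapT => hj; apply: hno; exists j.+1%:R^-1; first by rewrite invr_gt0.
  move=> l f lr fp; rewrite leNgt; apply/negP => hlt; apply: hj.
  have n0 : 0 < nrm f.
    rewrite lt_neqAle snorm_ge0 andbT eq_sym; apply/negP => /eqP n0.
    by move: hlt; rewrite n0 mulr0 ltNge snorm_ge0.
  exists ((nrm f)^-1 *: f, l); split => //=.
  - by rewrite (snormZ hip) ger0_norm ?invr_ge0 ?snorm_ge0 // mulVf // gt_eqF.
  - by rewrite (ipZl hip) fp mulr0.
  - have := snorm_distD hip ((nrm f)^-1 *: T f) (T ((nrm f)^-1 *: f)) (l *: ((nrm f)^-1 *: f)).
    rewrite (snorm_opZ hip hT) add0r scalerA (mulrC l) -scalerA -scalerBr (snormZ hip).
    move=> h; apply: le_trans h _.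
    by rewrite ger0_norm ?invr_ge0 ?snorm_ge0 // mulrC ler_pdivrMr // ltW.
pose F j := projT1 (cid (bad j)).
have hF j : [/\ nrm (F j).1 = 1, ip (F j).1 phis = 0,
    rho - e0 <= (F j).2 & nrm (T (F j).1 - (F j).2 *: (F j).1) <= j.+1%:R^-1].
  by rewrite /F; case: cid.
by apply: (@no_unit_approx_eigenvectors (fun j => (F j).1) (fun j => (F j).2)) => j;
  have [] := hF j.
Qed.

End gap.

(** * Perturbed sieve eigenvalue problems *)

Definition dotc (R : realType) k (u v : 'cV[R]_k) : R := \sum_i u i 0 * v i 0.

Definition lincomb (R : realType) (H : lmodType R) k (e : 'I_k -> H) (v : 'cV[R]_k) : H :=
  \sum_i v i 0 *: e i.

Definition coords (R : realType) (H : lmodType R) (ip : H -> H -> R) k (e : 'I_k -> H)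
  (f : H) : 'cV[R]_k := \col_i ip f (e i).

Definition compression (R : realType) (H : lmodType R) (ip : H -> H -> R) (T : H -> H) k
  (e : 'I_k -> H) : 'M[R]_k := \matrix_(i, j) ip (e i) (T (e j)).

Section coordinates.
Context (R : realType) (H : lmodType R) (ip : H -> H -> R).
Hypothesis hip : semi_ip ip.
Context (k : nat) (e : 'I_k -> H).
Hypothesis oe : orthonormal_family ip e.
Local Notation nrm := (snorm ip).
Local Notation lc := (lincomb e).
Local Notation co := (coords ip e).

Lemma lincombD v w : lc (v + w) = lc v + lc w.
Proof. by rewrite /lincomb -big_split; apply: eq_bigr => i _; rewrite mxE scalerDl. Qed.

Lemma lincombZ a v : lc (a *: v) = a *: lc v.
Proof. by rewrite /lincomb scaler_sumr; apply: eq_bigr => i _; rewrite mxE scalerA. Qed.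

Lemma lincomb0 : lc 0 = 0.
Proof. by rewrite /lincomb big1 // => i _; rewrite mxE scale0r. Qed.

Lemma lincombB v w : lc (v - w) = lc v - lc w.
Proof. by rewrite -(scaleN1r w) lincombD lincombZ scaleN1r. Qed.

Lemma ip_lincomb v f : ip (lc v) f = dotc v (co f).
Proof.
rewrite (ip_suml hip); apply: eq_bigr => i _.
by rewrite (ipZl hip) mxE (ipC hip).
Qed.

Lemma coords_lincomb v : co (lc v) = v.
Proof.
apply/colP => i; rewrite mxE (ip_suml hip) (bigD1 i) //= (ipZl hip) oe eqxx mulr1.
rewrite big1 ?addr0 // => j ji.
by rewrite (ipZl hip) oe (negbTE ji) mulr0.
Qed.

Lemma ip_lincomb2 v w : ip (lc v) (lc w) = dotc v w.
Proof. by rewrite ip_lincomb coords_lincomb. Qed.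

Lemma dotcC (v w : 'cV[R]_k) : dotc v w = dotc w v.
Proof. by apply: eq_bigr => i _; rewrite mulrC. Qed.

Lemma ip_proj f w : ip (lc (co f)) (lc w) = ip f (lc w).
Proof. by rewrite ip_lincomb2 (ipC hip f) ip_lincomb dotcC. Qed.

Lemma snorm_proj f : nrm (lc (co f)) <= nrm f.
Proof.
rewrite -(ler_pXn2r (_ : 0 < 2)%N) ?nnegrE ?snorm_ge0 // !(sqr_snorm hip).
have := ip_ge0 hip (f - lc (co f)).
rewrite (ipBl hip) !(ipBr hip) ip_proj (ipC hip f (lc _)).
have := ip_proj f (co f); rewrite (ipC hip f); lra.
Qed.

Lemma snorm_lincomb v : nrm (lc v) = enorm v.
Proof.
rewrite /snorm ip_lincomb2 /enorm; congr Num.sqrt; apply: eq_bigr => i _.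
by rewrite big_ord1 expr2.
Qed.

Lemma coordsB f g : co (f - g) = co f - co g.
Proof. by apply/colP => i; rewrite !mxE (ipBl hip). Qed.

Lemma coordsZ a f : co (a *: f) = a *: co f.
Proof. by apply/colP => i; rewrite !mxE (ipZl hip). Qed.

Lemma coords_null f : nrm f = 0 -> co f = 0.
Proof. by move=> f0; apply/colP => i; rewrite !mxE (ip_snorm0 hip). Qed.

Context (T : H -> H) (TC : R).
Hypothesis hT : bounded_linear ip T TC.

Lemma ip_op0 g : ip (T 0) g = 0.
Proof.
have := ip_op_linear hip hT 1 0 0 g.
by rewrite scaler0 add0r mul1r => /eqP; rewrite eq_sym -subr_eq0 addrK => /eqP.
Qed.

Lemma ip_op_lincomb v g : ip (T (lc v)) g = \sum_i v i 0 * ip (T (e i)) g.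
Proof.
rewrite /lincomb.
apply: (big_rec2 (fun (x : H) y => ip (T x) g = y)); first exact: ip_op0.
by move=> i x y _ <-; rewrite (ip_op_linear hip hT).
Qed.

Lemma compressionE v : compression ip T e *m v = co (T (lc v)).
Proof.
apply/colP => i; rewrite !mxE ip_op_lincomb; apply: eq_bigr => j _.
by rewrite !mxE (ipC hip) mulrC.
Qed.

End coordinates.

Section perturbation.
Context (R : realType) (H : lmodType R) (ip : H -> H -> R) (T : H -> H)
  (TC rho e0 : R) (phi phis : H).
Hypothesis hte : top_eigenvalue ip T TC rho e0 phi phis.
Local Notation nrm := (snorm ip).
Let hip := te_ip hte.
Let hT := te_lin hte.
Let F := nrm phis.

Context (c : R).
Hypothesis c0 : 0 < c.
Hypothesis gap : forall (l : R) f, rho - e0 <= l -> ip f phis = 0 ->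
  c * nrm f <= nrm (T f - l *: f).

(** Write x = D phi + y with y orthogonal to [phis]. Pairing the residual with [phis] leaves exactly
    g - D (l - rho), and T y - l y is the residual minus that multiple of [phi], so the gap bounds
    y. *)
Lemma gap_decomp (l g : R) x : rho - e0 <= l ->
  let S := nrm (T x - l *: x + g *: phi) in let D := ip x phis in
  `|g - D * (l - rho)| <= S * F /\ c * nrm (x - D *: phi) <= S * (1 + F).
Proof.
move=> hl S D.
have h1 : `|g - D * (l - rho)| <= S * F.
  apply: le_trans (ip_le hip _ _).
  rewrite (ipDl hip) (ipBl hip) !(ipZl hip) (te_adj hte) (te_dual hte).
  by rewrite le_eqVlt; apply/orP; left; apply/eqP; congr `|_|; rewrite -/D; ring.
split=> //.
have Dy : ip (x - D *: phi) phis = 0.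
  by rewrite (ipBl hip) (ipZl hip) (te_dual hte) mulr1 subrr.
apply: le_trans (gap hl Dy) _.
set y := x - D *: phi.
have Ty : nrm (T y - (T x - (D * rho) *: phi)) = 0.
  apply/eqP; rewrite eq_le snorm_ge0 andbT.
  apply: le_trans (snorm_distD hip (T x - T (D *: phi)) _ _) _.
  rewrite (snorm_opB hT) add0r opprB addrC addrA subrK.
  rewrite (le_trans (snorm_distD hip (D *: T phi) _ _)) //.
  rewrite (snorm_distC hip _ (T (D *: phi))) (snorm_opZ hip hT) addr0.
  rewrite -scalerA -scalerBr (snormZ hip) (snorm_distC hip) (te_eig hte).
  by rewrite mulr0.
apply: le_trans (snorm_distD hip (T x - (D * rho) *: phi) _ _) _; rewrite Ty add0r.
rewrite [X in nrm X](_ : _ = (T x - l *: x + g *: phi) - (g - D * (l - rho)) *: phi).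
  rewrite (le_trans (snormB hip _ _)) // (snormZ hip) (te_norm hte) mulr1.
  by rewrite -/S (mulrDr S) mulr1 lerD2l.
rewrite /y (scalerBr l) scalerA (scalerBl g) mulrBr (scalerBl (D * l)) (mulrC l D).
rewrite !opprB (addrC _ (- (g *: phi))) (addrA _ (- (g *: phi))) addrK [LHS]addrACA [RHS]addrACA.
by rewrite [in RHS](addrC (- _)).
Qed.

End perturbation.

(** Collects finitely many smallness requirements K x <= t, listed as pairs (K, t), under one
    threshold. *)
Lemma small_scale (R : realType) (s : seq (R * R)) : all (fun p => 0 < p.2) s ->
  exists2 x0 : R, 0 < x0 & forall x, 0 <= x -> x <= x0 ->
    forall p, p \in s -> p.1 * x <= p.2.
Proof.
elim: s => [_|[K t] s IH /= /andP[t0 /IH [x1 x10 hx]]]; first by exists 1.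
have K1 : 0 < `|K| + 1 by rewrite ltr_wpDl.
exists (Num.min x1 (t / (`|K| + 1))); first by rewrite lt_min x10 divr_gt0.
move=> x x0; rewrite le_min => /andP[xx1 xt] p; rewrite inE => /orP[/eqP ->/=|]; last exact: hx.
move: xt; rewrite ler_pdivlMr // mulrC => xt.
apply: le_trans xt; rewrite ler_wpM2r //.
by rewrite (le_trans (ler_norm _)) // lerDl.
Qed.

Section perturbation.
Context (R : realType) (H : lmodType R) (ip : H -> H -> R) (T : H -> H)
  (TC rho e0 : R) (phi phis : H).
Hypothesis hte : top_eigenvalue ip T TC rho e0 phi phis.
Local Notation nrm := (snorm ip).
Let hip := te_ip hte.
Let hT := te_lin hte.
Let F := nrm phis.
Context (c : R).
Hypothesis c0 : 0 < c.
Hypothesis gap : forall (l : R) f, rho - e0 <= l -> ip f phis = 0 ->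
  c * nrm f <= nrm (T f - l *: f).
Context (k : nat) (e : 'I_k -> H).
Hypothesis oe : orthonormal_family ip e.
Local Notation lc := (lincomb e).
Local Notation co := (coords ip e).
Context (Mh Gh : 'M[R]_k) (eps eta L : R).
Hypothesis happ : forall f, nrm (T f - lc (co (T f))) <= eps * nrm f.
Hypothesis hMh : forall v : 'cV[R]_k, enorm ((Mh - compression ip T e) *m v) <= eta * enorm v.
Hypothesis hGh : forall v : 'cV[R]_k, enorm ((Gh - 1%:M) *m v) <= eta * enorm v.
Hypothesis eta0 : 0 <= eta.
Let u := co phis.
Let v := co phi.
Let a := nrm (phi - lc v).
Let as_ := nrm (phis - lc u).

Lemma pencilE (l : R) x : (Mh - l *: Gh) *m x =
  (co (T (lc x)) - l *: x) + ((Mh - compression ip T e) *m x - l *: ((Gh - 1%:M) *m x)).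
Proof.
rewrite -(compressionE hip e hT) !mulmxBl -scalemxAl mul1mx scalerBr opprB.
by rewrite addrACA addKr; congr (_ + _); rewrite addrC subrK.
Qed.

Lemma pencil_proj (l : R) x :
  nrm (lc ((Mh - l *: Gh) *m x) - (lc (co (T (lc x))) - l *: lc x)) <=
  eta * (1 + `|l|) * nrm (lc x).
Proof.
rewrite pencilE (lincombD e) (lincombB e (co _)) (lincombZ e) addrC addKr.
rewrite (lincombB e) (lincombZ e) (le_trans (snormB hip _ _)) // (snormZ hip).
rewrite !(snorm_lincomb hip oe).
have := hMh x; have := ler_wpM2l (normr_ge0 l) (hGh x).
move=> h1 h2; rewrite (_ : eta * _ * _ = eta * enorm x + `|l| * (eta * enorm x)); last ring.
by rewrite lerD.
Qed.

(** On coordinates the sample pencil acts like T - l: [eps] accounts for the projection of T f,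
    [eta] for the two sampling errors. *)
Lemma pencil_op (l : R) x :
  nrm (lc ((Mh - l *: Gh) *m x) - (T (lc x) - l *: lc x)) <=
  (eps + eta * (1 + `|l|)) * nrm (lc x).
Proof.
apply: le_trans (snorm_distD hip (lc (co (T (lc x))) - l *: lc x) _ _) _.
rewrite mulrDl addrC lerD ?pencil_proj //.
by rewrite opprB addrA subrK (snorm_distC hip) happ.
Qed.

Lemma ip_dual_lincomb x : ip (lc x) phis = dotc u x.
Proof. by rewrite (ip_lincomb hip) dotcC. Qed.

Lemma ip_lincomb_coords x : ip (lc x) phis = ip (lc x) (lc u).
Proof. by rewrite (ip_lincomb2 hip oe) ip_dual_lincomb dotcC. Qed.

Let F0 : 0 <= F := snorm_ge0 ip phis.
Let a0 : 0 <= a := snorm_ge0 ip _.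

Lemma snorm_lincomb_eq0 x : nrm (lc x) = 0 -> x = 0.
Proof. by move=> x0; rewrite -(coords_lincomb hip oe x) coords_null. Qed.

(** A solution of the bordered system approximately solves the unprojected equation. The term in [a]
    arises because [v] represents the projection of [phi] and not [phi] itself. *)
Lemma residual_bound (l g kap : R) x : eps + eta * (1 + `|l|) <= kap ->
  (Mh - l *: Gh) *m x + g *: v = 0 ->
  nrm (T (lc x) - l *: lc x + g *: phi) <= kap * nrm (lc x) + `|g| * a.
Proof.
move=> hk /(congr1 lc); rewrite (lincombD e) (lincombZ e) (lincomb0 e) => h.
have -> : T (lc x) - l *: lc x + g *: phi =
    (T (lc x) - l *: lc x - lc ((Mh - l *: Gh) *m x)) + g *: (phi - lc v).
  rewrite scalerBr (addrC (g *: phi)) addrA; congr (_ + _).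
  by rewrite -[LHS]subr0 -h opprD addrA.
rewrite (le_trans (snormD hip _ _)) // (snormZ hip) lerD //.
rewrite (snorm_distC hip) (le_trans (pencil_op _ _)) //.
by rewrite ler_wpM2r // snorm_ge0.
Qed.

(** The residual norm [S] is bounded in terms of itself: the hypotheses on [kap] and [a] make both
    occurrences of [S] at most [S / 4], whence S <= 2 |D| (kap + a r). The first conclusion
    determines the sign of [g] when |l - rho| = r; the second makes the bordered matrix
    injective. *)
Lemma bordered_estimate (l g kap r : R) x : rho - e0 <= l ->
  eps + eta * (1 + `|l|) <= kap -> 0 <= kap -> `|l - rho| <= r ->
  kap * (1 + F) <= c / 4 -> F * a <= 4^-1 -> 4 * F * (kap + a * r) <= r ->
  (Mh - l *: Gh) *m x + g *: v = 0 ->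
  `|g - dotc u x * (l - rho)| <= `|dotc u x| * (r / 2) /\
  (dotc u x = 0 -> x = 0).
Proof.
move=> hl hk k0 hr h1 h2 h3 hx.
have hS := residual_bound hk hx.
have [hg hy] := gap_decomp hte gap g (lc x) hl.
move: hS hg hy; rewrite ip_dual_lincomb.
set S := nrm (T _ - _ + _); set D := dotc u x; set X := nrm (lc x).
rewrite -/F => hS hg hy.
have S0 : 0 <= S := snorm_ge0 ip _.
have X0 : 0 <= X := snorm_ge0 ip _.
have hX : X <= `|D| + nrm (lc x - D *: phi).
  have := snorm_le_dist hip (lc x) (D *: phi).
  by rewrite (snormZ hip) (te_norm hte) mulr1.
have hg' : `|g| <= `|D| * r + S * F.
  rewrite -(subrK (D * (l - rho)) g) (le_trans (ler_normD _ _)) // addrC lerD //.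
  by rewrite normrM ler_wpM2l.
have r0 : 0 <= r by apply: le_trans hr.
have kX : kap * X <= kap * `|D| + S / 4.
  have q : kap * (c * nrm (lc x - D *: phi)) <= c * (S / 4).
    apply: le_trans (ler_wpM2l k0 hy) _.
    by have := ler_wpM2l S0 h1; lra.
  have : kap * nrm (lc x - D *: phi) <= S / 4.
    by rewrite -(ler_pM2l c0) mulrCA.
  by have := ler_wpM2l k0 hX; lra.
have ga : `|g| * a <= `|D| * (a * r) + S / 4.
  have := ler_wpM2r a0 hg'; have := ler_wpM2l S0 h2; lra.
have SD : S <= 2 * `|D| * (kap + a * r) by lra.
split.
  apply: le_trans hg _; have := ler_wpM2r F0 SD.
  have := ler_wpM2l (normr_ge0 D) h3; lra.
move=> D0; apply: snorm_lincomb_eq0.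
move: SD hy hX; rewrite D0 normr0 scale0r subr0 mulr0 mul0r => SD + hX.
have -> : S = 0 by apply/le_anti; rewrite SD S0.
rewrite mul0r pmulr_rle0 // => hX0.
by apply/le_anti; rewrite hX0 X0.
Qed.

(** This is the bordered system with [g = 0]: the residual is at most [kap] times the norm of the
    eigenvector, and by the gap that norm is at most twice its component along [phi]. *)
Lemma eigen_estimate (l kap : R) x : rho - e0 <= l ->
  eps + eta * (1 + `|l|) <= kap -> 0 <= kap ->
  kap * (1 + F) <= c / 2 -> x != 0 -> Mh *m x = l *: (Gh *m x) ->
  dotc u x != 0 /\ `|l - rho| <= 2 * kap * F.
Proof.
move=> hl hk k0 h1 x0 hx.
have hx' : (Mh - l *: Gh) *m x + 0 *: v = 0.
  by rewrite mulmxBl -scalemxAl hx subrr scale0r addr0.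
have hS := residual_bound hk hx'.
have [hg hy] := gap_decomp hte gap 0 (lc x) hl.
move: hS hg hy; rewrite ip_dual_lincomb normr0 mul0r addr0 sub0r normrN normrM.
set S := nrm (T _ - _ + _); set D := dotc u x; set X := nrm (lc x).
rewrite -/F => hS hg hy.
have X0 : 0 < X.
  rewrite lt_neqAle snorm_ge0 andbT eq_sym; apply: contra x0 => /eqP.
  by move=> /snorm_lincomb_eq0 ->.
have hX : X <= `|D| + nrm (lc x - D *: phi).
  have := snorm_le_dist hip (lc x) (D *: phi).
  by rewrite (snormZ hip) (te_norm hte) mulr1.
have F1 : 0 <= 1 + F by rewrite addr_ge0.
have XD : X <= 2 * `|D|.
  have : c * nrm (lc x - D *: phi) <= c * (X / 2).
    apply: le_trans hy _; apply: le_trans (ler_wpM2r F1 hS) _.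
    by have := ler_wpM2r (ltW X0) h1; lra.
  by rewrite ler_pM2l //; lra.
have D0 : 0 < `|D| by have := lt_le_trans X0 XD; lra.
split; first by rewrite -normr_gt0.
have : `|D| * `|l - rho| <= `|D| * (2 * kap * F).
  apply: le_trans hg _; apply: le_trans (ler_wpM2r F0 hS) _.
  by have := ler_wpM2l (mulr_ge0 k0 F0) XD; lra.
by rewrite ler_pM2l.
Qed.

Let rho0 : 0 <= rho := ltW (lt_trans (te_e0 hte) (te_rho hte)).
Let TC0 : 0 <= TC := te_TC hte.
Let as0 : 0 <= as_ := snorm_ge0 ip _.

Lemma snorm_lcv : nrm (lc v) <= 1.
Proof. by rewrite -(te_norm hte) (snorm_proj hip oe). Qed.

Lemma snorm_op_lcv : nrm (T (lc v) - rho *: lc v) <= (TC + rho) * a.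
Proof.
apply: le_trans (snorm_distD hip (T phi) _ _) _; rewrite mulrDl lerD //.
  by rewrite (le_trans (snorm_op_dist hip hT _ _)) // ler_wpM2l // (snorm_distC hip).
apply: le_trans (snorm_distD hip (rho *: phi) _ _) _.
by rewrite (te_eig hte) add0r -scalerBr (snormZ hip) ger0_norm.
Qed.

Lemma snorm_proj_sub f l : nrm (lc (co f) - l *: lc (co (lc v))) = nrm (lc (co (f - l *: lc v))).
Proof. by rewrite (coordsB hip) (coordsZ hip) (lincombB e) (lincombZ e). Qed.

(** For y orthogonal to [phis], <T y - rho y, phis> vanishes by the left eigenvalue equation. The
    factor that remains is of first order, so on a first-order eigenvector error the pencil
    contributes only at second order. *)
Lemma dual_pencil_le y : ip (lc y) phis = 0 ->
  `|dotc u ((Mh - rho *: Gh) *m y)| <= (TC * as_ + F * (1 + rho) * eta) * nrm (lc y).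
Proof.
move=> y0.
have -> : dotc u ((Mh - rho *: Gh) *m y) =
    ip (lc ((Mh - rho *: Gh) *m y) - (lc (co (T (lc y))) - rho *: lc y)) phis
    - ip (T (lc y)) (phis - lc u).
  rewrite -ip_dual_lincomb !(ipBl hip) (ipBr hip) (ipZl hip) y0.
  rewrite (te_adj hte) y0 (ip_lincomb_coords (co _)) (ip_proj hip oe); ring.
rewrite (le_trans (ler_normB _ _)) // mulrDl addrC lerD //.
  rewrite (le_trans (ip_le hip _ _)) // mulrAC ler_wpM2r //.
  exact: op_bounded hT _.
rewrite (le_trans (ip_le hip _ _)) //.
have := ler_wpM2r F0 (pencil_proj rho y); rewrite (ger0_norm rho0) -/F; lra.
Qed.

Lemma main_term_le :
  `|dotc u ((Mh - rho *: Gh) *m v)| <= F * (TC + rho) * a + F * (1 + rho) * eta.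
Proof.
rewrite -ip_dual_lincomb (le_trans (ip_le hip _ _)) // -/F.
have h1 := pencil_proj rho v; rewrite (ger0_norm rho0) in h1.
have h2 : nrm (lc (co (T (lc v))) - rho *: lc v) <= (TC + rho) * a.
  rewrite -{2}(coords_lincomb hip oe v) snorm_proj_sub.
  by rewrite (le_trans (snorm_proj hip oe _)) // snorm_op_lcv.
have h3 := snorm_le_dist hip (lc ((Mh - rho *: Gh) *m v)) (lc (co (T (lc v))) - rho *: lc v).
have h4 : eta * (1 + rho) * nrm (lc v) <= eta * (1 + rho).
  by rewrite ler_piMr ?snorm_lcv // mulr_ge0 // addr_ge0.
have : nrm (lc ((Mh - rho *: Gh) *m v)) <= (TC + rho) * a + eta * (1 + rho) by lra.
move/(ler_wpM2r F0); lra.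
Qed.

(** As x and v have the same pairing with [phis], the gap applies to their difference at rho. The
    projection error acts only on this difference and uses up half of the gap constant, which is why
    [eps] is absent from the bound. The unknown norm on the right is absorbed later. *)
Lemma direction_error (l : R) x : eps <= c / 2 -> `|l| <= L -> 0 <= L ->
  (Mh - l *: Gh) *m x = 0 -> ip (lc x) phis = ip (lc v) phis ->
  nrm (lc x - lc v) <=
    2 / c * (1 + L + TC + rho) * (eta + `|l - rho| + a) * (1 + nrm (lc x - lc v)).
Proof.
move=> he hl L0 hx hd; set X := nrm (lc x); set y := lc x - lc v; set Y := nrm y.
have Y0 : 0 <= Y := snorm_ge0 ip _.
have XY : X <= 1 + Y.
  by have := snorm_le_dist hip (lc x) (lc v); have := snorm_lcv; rewrite -/y -/Y -/X; lra.
have h1 : nrm (lc (co (T (lc x))) - l *: lc x) <= eta * (1 + L) * (1 + Y).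
  have := pencil_proj l x; rewrite hx (lincomb0 e) sub0r (snormN hip) => h.
  apply: le_trans h _; apply: ler_pM => //; rewrite ?snorm_ge0 ?mulr_ge0 ?addr_ge0 //.
  by rewrite ler_wpM2l // lerD2l.
have h2 : nrm (lc (co (T (lc x))) - rho *: lc x) <=
    eta * (1 + L) * (1 + Y) + `|l - rho| * (1 + Y).
  apply: le_trans (snorm_distD hip (l *: lc x) _ _) _; apply: lerD => //.
  by rewrite -scalerBl (snormZ hip) ler_wpM2l.
have h3 : nrm (lc (co (T (lc v))) - rho *: lc v) <= (TC + rho) * a.
  rewrite -{2}(coords_lincomb hip oe v) snorm_proj_sub.
  by rewrite (le_trans (snorm_proj hip oe _)) // snorm_op_lcv.
have h4 : nrm (lc (co (T y)) - rho *: y) <=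
    eta * (1 + L) * (1 + Y) + `|l - rho| * (1 + Y) + (TC + rho) * a.
  apply: le_trans _ (le_trans (snormB hip _ _) (lerD h2 h3)).
  have -> : co (T y) = co (T (lc x)) - co (T (lc v)).
    have := coords_null hip e (snorm_opB hT (lc x) (lc v)).
    by rewrite !(coordsB hip) => /eqP; rewrite subr_eq0 => /eqP.
  rewrite (lincombB e) /y scalerBr !opprB le_eqVlt; apply/orP; left; apply/eqP; congr nrm.
  by rewrite addrACA [RHS]addrACA; congr (_ + _); rewrite addrC.
have yphis : ip y phis = 0 by rewrite /y (ipBl hip) hd subrr.
have h5 : c * Y <= nrm (T y - rho *: y).
  by apply: gap => //; rewrite lerBlDr lerDl ltW // (te_e0 hte).
have h6 := snorm_distD hip (lc (co (T y))) (T y) (rho *: y).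
have h7 : nrm (T y - lc (co (T y))) <= c / 2 * Y.
  by apply: le_trans (happ y) _; rewrite ler_wpM2r.
have h8 : c / 2 * Y <= (1 + L + TC + rho) * (eta + `|l - rho| + a) * (1 + Y).
  have K0 : 0 <= 1 + Y by rewrite addr_ge0.
  have p1 : 0 <= (TC + rho) * eta * (1 + Y) by rewrite !mulr_ge0 ?addr_ge0.
  have p2 : 0 <= (L + TC + rho) * `|l - rho| * (1 + Y) by rewrite !mulr_ge0 ?addr_ge0.
  have p3 : 0 <= (1 + L) * a * (1 + Y) by rewrite !mulr_ge0 ?addr_ge0.
  have p4 : 0 <= (TC + rho) * a * Y by rewrite !mulr_ge0 ?addr_ge0.
  by lra.
have c2 : 0 < c / 2 by rewrite divr_gt0.
rewrite -(ler_pM2l c2) (le_trans h8) // le_eqVlt; apply/orP; left; apply/eqP.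
by field; rewrite gt_eqF.
Qed.

(** [C1] is the constant of [direction_error], [C2] that of [main_term_le] and [C3] that of
    [dual_pencil_le]; [C5 * th] will bound |l - rho|. *)
Let C1 := 2 / c * (1 + L + TC + rho).
Let C2 := F * (TC + rho) + F * (1 + rho).
Let C3 := TC + F * (1 + rho).
Let C5 := 2 * (C2 + C3).

(** Pairing (Mh - rho Gh) z = (l - rho) Gh z with u gives (l - rho) (b + q) = w + dd, where [w] is
    the main term. Here b + q - 1 and l - rho are O(th), and [dd] is O(th) times the eigenvector
    error, so both corrections are quadratic. *)
Lemma eigenvalue_expansion (l : R) x (th := eta + a + as_) : eps <= c / 2 -> `|l| <= L -> 0 <= L ->
  F * a <= 2^-1 -> C1 * (eta + `|l - rho| + a) <= 2^-1 -> 3 * F * th <= 2^-1 ->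
  dotc u x != 0 -> Mh *m x = l *: (Gh *m x) ->
  `|(l - rho) - dotc u ((Mh - rho *: Gh) *m v)| <=
  (3 * F * C5 + 2 * C1 * C3 * (1 + C5)) * th ^+ 2.
Proof.
move=> he hl L0 hFa hC1 hF3 D0 hx.
(* The eigenvector is rescaled to the pairing of [lc v] with [phis], so that z - v is orthogonal to
   [phis]. *)
pose b := ip (lc v) phis; pose D := dotc u x; pose z := (b / D) *: x.
have hz : (Mh - l *: Gh) *m z = 0.
  by rewrite -scalemxAr mulmxBl -scalemxAl hx subrr scaler0.
have zb : dotc u z = b.
  by rewrite -ip_dual_lincomb (lincombZ e) (ipZl hip) ip_dual_lincomb divfK.
have zv : ip (lc z) phis = ip (lc v) phis by rewrite ip_dual_lincomb zb.
have hb : `|b - 1| <= F * a.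
  rewrite -(te_dual hte) -(ipBl hip) (le_trans (ip_le hip _ _)) // mulrC.
  by rewrite (snorm_distC hip).
have hY := direction_error he hl L0 hz zv.
rewrite -/C1 in hY; set Y := nrm (lc z - lc v) in hY.
have Y0 : 0 <= Y := snorm_ge0 ip _.
have C10 : 0 <= C1 by rewrite !mulr_ge0 ?addr_ge0 ?invr_ge0 ?(ltW c0).
have C30 : 0 <= C3 by rewrite addr_ge0 // mulr_ge0 // addr_ge0.
have C20 : 0 <= C2 by rewrite addr_ge0 // mulr_ge0 // addr_ge0.
have Y1 : Y <= 1 by have := ler_wpM2r Y0 hC1; lra.
have th0 : 0 <= th by rewrite !addr_ge0.
have hYth : Y <= 2 * C1 * (th + `|l - rho|).
  have q : Y <= 2 * (C1 * (eta + `|l - rho| + a)) by have := ler_wpM2r Y0 hC1; lra.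
  by have := mulr_ge0 C10 as0; rewrite /th; lra.
have hw := main_term_le; set w := dotc u ((Mh - rho *: Gh) *m v) in hw *.
have hw' : `|w| <= C2 * th.
  have := mulr_ge0 (mulr_ge0 F0 (addr_ge0 TC0 rho0)) eta0.
  have := mulr_ge0 (mulr_ge0 F0 (addr_ge0 TC0 rho0)) as0.
  have := mulr_ge0 (mulr_ge0 F0 (addr_ge0 ler01 rho0)) a0.
  have := mulr_ge0 (mulr_ge0 F0 (addr_ge0 ler01 rho0)) as0.
  rewrite /C2 /th; lra.
have lzv : lc z - lc v = lc (z - v) by rewrite (lincombB e).
have zv0 : ip (lc (z - v)) phis = 0 by rewrite -lzv (ipBl hip) zv subrr.
have hd := dual_pencil_le zv0; rewrite -lzv -/Y in hd.
set dd := dotc u ((Mh - rho *: Gh) *m (z - v)) in hd.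
have hd' : `|dd| <= C3 * th * Y.
  apply: le_trans hd _; apply: ler_wpM2r => //.
  have := mulr_ge0 TC0 eta0; have := mulr_ge0 TC0 a0.
  have := mulr_ge0 (mulr_ge0 F0 (addr_ge0 ler01 rho0)) a0.
  have := mulr_ge0 (mulr_ge0 F0 (addr_ge0 ler01 rho0)) as0.
  rewrite /C3 /th; lra.
pose q := dotc u ((Gh - 1%:M) *m z).
have hq : `|q| <= 2 * F * eta.
  rewrite /q -ip_dual_lincomb (le_trans (ip_le hip _ _)) // -/F.
  have := hGh z; rewrite -!(snorm_lincomb hip oe) => h.
  have hX : nrm (lc z) <= 2.
    by have := snorm_le_dist hip (lc z) (lc v); have := snorm_lcv; rewrite -/Y; lra.
  have := ler_wpM2r F0 h; have := ler_wpM2l (mulr_ge0 eta0 F0) hX; lra.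
have key : (l - rho) * (b + q) = w + dd.
  have dotcD (s t : 'cV[R]_k) : dotc u (s + t) = dotc u s + dotc u t.
    by rewrite -!ip_dual_lincomb (lincombD e) (ipDl hip).
  have dotcZ r (s : 'cV[R]_k) : dotc u (r *: s) = r * dotc u s.
    by rewrite -!ip_dual_lincomb (lincombZ e) (ipZl hip).
  have vz (s t : 'cV[R]_k) : s + (t - s) = t by rewrite addrC subrK.
  have qE : b + q = dotc u (Gh *m z) by rewrite -zb -dotcD mulmxBl mul1mx vz.
  rewrite qE /w /dd -dotcD -mulmxDr vz -dotcZ; congr dotc; apply/eqP.
  move: hz; rewrite !mulmxBl -!scalemxAl => /eqP; rewrite subr_eq0 => /eqP ->.
  by rewrite scalerBl.
have hbq : `|b + q - 1| <= 3 * F * th.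
  rewrite addrAC (le_trans (ler_normD _ _)) //.
  have := mulr_ge0 F0 eta0; have := mulr_ge0 F0 a0; have := mulr_ge0 F0 as0.
  rewrite /th; lra.
have e1 : (l - rho) - w = dd - (l - rho) * (b + q - 1) by rewrite mulrBr key; ring.
(* On the right |l - rho| reappears with a factor of at most 1/2 and is moved to the left. *)
have hlr : `|l - rho| <= C5 * th.
  have : `|l - rho| <= `|w| + `|dd| + `|l - rho| * (3 * F * th).
    rewrite -{1}(subrK w (l - rho)) e1.
    apply: le_trans (ler_normD _ _) _; rewrite [leLHS]addrC -[leRHS]addrA lerD2l.
    apply: le_trans (ler_normB _ _) _; rewrite lerD2l normrM ler_wpM2l //.
  have := ler_wpM2l (normr_ge0 (l - rho)) hF3.
  have := ler_wpM2l (mulr_ge0 C30 th0) Y1.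
  rewrite /C5; lra.
rewrite e1 (le_trans (ler_normB _ _)) // normrM.
have t1 : `|l - rho| * `|b + q - 1| <= C5 * th * (3 * F * th) by apply: ler_pM.
have t2 : Y <= 2 * C1 * (1 + C5) * th by have := ler_wpM2l C10 hlr; lra.
have t3 := ler_wpM2l (mulr_ge0 C30 th0) t2.
rewrite expr2; lra.
Qed.

(** With [eta <= 2^-1] one has |x| <= 2 |Gh x| and |Mh x| <= (TC + 1/2) |x|. *)
Lemma gen_eigenvalue_bound (l : R) : eta <= 2^-1 -> gen_eigenvalue Mh Gh l ->
  `|l| <= 2 * TC + 1.
Proof.
move=> e2 [x x0 hx].
have X0 : 0 < nrm (lc x).
  rewrite lt_neqAle snorm_ge0 andbT eq_sym; apply: contra x0 => /eqP.
  by move=> /snorm_lincomb_eq0 ->.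
have hG : nrm (lc x) <= 2 * nrm (lc (Gh *m x)).
  have := hGh x; rewrite -!(snorm_lincomb hip oe) mulmxBl mul1mx (lincombB e).
  have := snorm_le_dist hip (lc x) (lc (Gh *m x)).
  rewrite (snorm_distC hip); have := ler_wpM2r (ltW X0) e2; lra.
have hM : nrm (lc (Mh *m x)) <= (TC + 2^-1) * nrm (lc x).
  have := hMh x; rewrite -!(snorm_lincomb hip oe) mulmxBl (lincombB e).
  rewrite (compressionE hip e hT).
  have := snorm_le_dist hip (lc (Mh *m x)) (lc (co (T (lc x)))).
  have := le_trans (snorm_proj hip oe (T (lc x))) (op_bounded hT (lc x)).
  have := ler_wpM2r (ltW X0) e2; lra.
rewrite -(ler_pM2r X0); apply: le_trans (ler_wpM2l (normr_ge0 l) hG) _.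
have : `|l| * nrm (lc (Gh *m x)) = nrm (lc (Mh *m x)).
  by rewrite -(snormZ hip) -(lincombZ e) -hx.
lra.
Qed.

(** The pencil bordered by the coordinates of [phi] and [phis] stays invertible near [rho], where
    the pencil itself becomes singular. Polynomial entries make its determinant and cofactors
    polynomials in [l]. *)
Let Bp : 'M[{poly R}]_(k + 1) := block_mx
  (map_mx polyC Mh - 'X *: map_mx polyC Gh) (map_mx polyC v) (map_mx polyC u^T) 0.
Let Bl (l : R) : 'M[R]_(k + 1) := block_mx (Mh - l *: Gh) v u^T 0.

Lemma horner_bordered l : map_mx (horner_eval l) Bp = Bl l.
Proof.
rewrite /Bp /Bl map_block_mx; congr block_mx.
- by apply/matrixP => i j; rewrite !mxE /horner_eval !hornerE mulrC.
- by apply/matrixP => i j; rewrite !mxE /horner_eval !hornerE.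
- by apply/matrixP => i j; rewrite !mxE /horner_eval !hornerE.
- by apply/matrixP => i j; rewrite !mxE /horner_eval !hornerE.
Qed.

Lemma bordered_mul l (z : 'cV[R]_(k + 1)) : Bl l *m z =
  col_mx ((Mh - l *: Gh) *m usubmx z + dsubmx z 0 0 *: v) (dotc u (usubmx z))%:M.
Proof.
rewrite -{1}(vsubmxK z) mul_block_col mul0mx addr0; congr col_mx.
  by congr (_ + _); rewrite {1}[dsubmx z]mx11_scalar mul_mx_scalar.
apply/matrixP => i j; rewrite !ord1 !mxE /= mulr1n; apply: eq_bigr => m _.
by rewrite !mxE.
Qed.

Lemma bordered_kernel (l r kap : R) : rho - e0 <= l ->
  eps + eta * (1 + `|l|) <= kap -> 0 <= kap -> `|l - rho| <= r ->
  kap * (1 + F) <= c / 4 -> F * a <= 4^-1 -> 4 * F * (kap + a * r) <= r ->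
  \det (Bl l) != 0.
Proof.
move=> hl hk k0 hr h1 h2 h3; apply/negP; rewrite -det_tr => /det0P [z z0 hz].
have : Bl l *m z^T = 0 by rewrite -[LHS]trmxK trmx_mul trmxK hz trmx0.
rewrite bordered_mul -[RHS]vsubmxK => /eq_col_mx [hu hd].
have D0 : dotc u (usubmx z^T) = 0.
  by move/matrixP: hd => /(_ 0 0); rewrite !mxE eqxx mulr1n.
have hu' : (Mh - l *: Gh) *m usubmx z^T + dsubmx z^T 0 0 *: v = 0.
  by rewrite hu; apply/matrixP => i j; rewrite !mxE.
have [hg /(_ D0) hx] := bordered_estimate hl hk k0 hr h1 h2 h3 hu'.
move: hg; rewrite D0 mul0r normr0 subr0 mul0r normr_le0 => /eqP hg.
move/negP: z0; apply; rewrite -[z]trmxK -(vsubmxK z^T) hx.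
rewrite (_ : dsubmx z^T = 0) ?col_mx0 ?trmx0 //.
by apply/matrixP => i j; rewrite !ord1 hg mxE.
Qed.

(** The last column of the adjugate solves the bordered system, with [dotc u x] equal to the
    determinant and [g] to the last diagonal cofactor. By [bordered_estimate], determinant times
    cofactor has the sign of l - rho at l = rho + r and l = rho - r, so this polynomial has a root
    in between. The determinant is nonzero there, hence the cofactor vanishes and x is an
    eigenvector. *)
Lemma exists_gen_eigenvalue (r kap : R) : 0 < r -> r <= e0 ->
  eps + eta * (1 + rho + r) <= kap -> 0 <= kap ->
  kap * (1 + F) <= c / 4 -> F * a <= 4^-1 -> 4 * F * (kap + a * r) <= r ->
  exists2 l, rho - e0 <= l & gen_eigenvalue Mh Gh l.
Proof.
move=> r0 re hk k0 h1 h2 h3.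
pose last : 'I_(k + 1) := rshift k ord0.
pose zl l : 'cV[R]_(k + 1) := col last (\adj (Bl l)).
have hz l : [/\ (Mh - l *: Gh) *m usubmx (zl l) + dsubmx (zl l) 0 0 *: v = 0,
    dotc u (usubmx (zl l)) = \det (Bl l) & dsubmx (zl l) 0 0 = \adj (Bl l) last last].
  have : Bl l *m zl l = \det (Bl l) *: delta_mx last 0.
    by rewrite /zl colE mulmxA mul_mx_adj mul_scalar_mx.
  rewrite bordered_mul -[RHS]vsubmxK => /eq_col_mx [hu hd]; split.
  - rewrite hu; apply/matrixP => i j; rewrite !mxE /last.
    by rewrite eq_lrshift mulr0.
  - move/matrixP: hd => /(_ 0 0); rewrite !mxE !eqxx mulr1n mulr1 => <- //.
  - by rewrite !mxE.
have range l : rho - r <= l <= rho + r -> [/\ rho - e0 <= l,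
    eps + eta * (1 + `|l|) <= kap & `|l - rho| <= r].
  move=> /andP[l1 l2].
  have hlr : `|l - rho| <= r by rewrite ler_distl l1.
  split=> //; first by lra.
  apply: le_trans hk; rewrite lerD2l ler_wpM2l // -addrA lerD2l.
  by have rho1 := rho0; rewrite ler_norml; apply/andP; split; lra.
(* The factor [\det Bp] makes the signs at the two ends independent of the sign of the
   determinant. *)
pose q : {poly R} := \det Bp * \adj Bp last last.
have qE l : q.[l] = \det (Bl l) * \adj (Bl l) last last.
  rewrite hornerM -!(horner_evalE l) -det_map_mx horner_bordered.
  by congr (_ * _); rewrite -horner_bordered -map_mx_adj [RHS]mxE.
have est l : rho - r <= l <= rho + r -> \det (Bl l) != 0 /\
    `|\adj (Bl l) last last - \det (Bl l) * (l - rho)| <= `|\det (Bl l)| * (r / 2).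
  move=> /range [l1 l2 l3]; split; first exact: bordered_kernel l1 l2 k0 l3 h1 h2 h3.
  have [hu <- <-] := hz l.
  by have [] := bordered_estimate l1 l2 k0 l3 h1 h2 h3 hu.
have [l hl rl] : exists2 l, rho - r <= l <= rho + r & root q l.
  apply: poly_ivt; first by lra.
  rewrite !qE; apply/andP; split.
    have /est [] : rho - r <= rho - r <= rho + r by rewrite lexx /=; lra.
    set D := \det _; set g := \adj _ _ _; rewrite addrAC subrr add0r mulrN opprK => D0.
    move=> /(ler_wpM2l (normr_ge0 D)); rewrite -normrM mulrA -expr2 real_normK ?num_real //.
    move=> /(le_trans (ler_norm _)); have := mulr_ge0 (sqr_ge0 D) (ltW r0); lra.
  have /est [] : rho - r <= rho + r <= rho + r by rewrite lexx andbT; lra.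
  set D := \det _; set g := \adj _ _ _; rewrite addrAC subrr add0r => D0.
  move=> /(ler_wpM2l (normr_ge0 D)); rewrite -normrM mulrA -expr2 real_normK ?num_real //.
  rewrite -normrN.
  move=> /(le_trans (ler_norm _)); have := mulr_ge0 (sqr_ge0 D) (ltW r0); lra.
have [l1 _ _] := range l hl; have [D0 _] := est l hl.
exists l => //; have [hu hD hg] := hz l; exists (usubmx (zl l)).
  apply/negP => /eqP x0; move/negP: D0; apply; rewrite -hD x0 /dotc.
  by rewrite big1 // => i _; rewrite [X in _ * X]mxE mulr0.
move: rl; rewrite /root qE mulf_eq0 (negbTE D0) /= -hg => /eqP g0.
by move: hu; rewrite g0 scale0r addr0 mulmxBl -scalemxAl => /eqP; rewrite subr_eq0 => /eqP.
Qed.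

Lemma gen_eigenvalue_root (l : R) : gen_eigenvalue Mh Gh l <->
  root (\det (map_mx polyC Mh - 'X *: map_mx polyC Gh)) l.
Proof.
rewrite /root -(horner_evalE l) -det_map_mx.
rewrite (_ : map_mx (horner_eval l) _ = Mh - l *: Gh); last first.
  by apply/matrixP => i j; rewrite !mxE /horner_eval !hornerE mulrC.
rewrite -det_tr; split.
  move=> [x x0 hx]; apply/det0P; exists x^T; first by rewrite -(inj_eq trmx_inj) trmxK trmx0.
  by rewrite -trmx_mul mulmxBl -scalemxAl hx subrr trmx0.
move=> /det0P [x x0 hx]; exists x^T; first by rewrite -(inj_eq trmx_inj) trmxK trmx0.
move/(congr1 trmx): hx; rewrite trmx_mul trmxK trmx0 mulmxBl -scalemxAl => /eqP.
by rewrite subr_eq0 => /eqP.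
Qed.

(** Without a maximum there would be strictly monotone chains of roots longer than the degree
    allows. The bound [B] excludes the zero characteristic polynomial, of which every number is a
    root. *)
Lemma exists_largest_gen_eigenvalue (B : R) : (exists l, gen_eigenvalue Mh Gh l) ->
  (forall l, gen_eigenvalue Mh Gh l -> l <= B) ->
  exists l, largest_gen_eigenvalue Mh Gh l.
Proof.
move=> [l0 hl0] hB; set p := \det (map_mx polyC Mh - 'X *: map_mx polyC Gh).
have p0 : p != 0.
  apply/negP => /eqP p0; have : gen_eigenvalue Mh Gh (B + 1).
    by apply/gen_eigenvalue_root; rewrite -/p p0 root0.
  by move/hB; rewrite leNgt ltrDl ltr01.
apply: contrapT => hno.
have up l : gen_eigenvalue Mh Gh l -> exists l', gen_eigenvalue Mh Gh l' /\ l < l'.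
  move=> hl; apply: contrapT => h; apply: hno; exists l; split=> // l' hl'.
  by rewrite leNgt; apply/negP => ll'; apply: h; exists l'.
have chain n : exists s : seq R, [/\ size s = n.+1, all (root p) s & sorted >%R s].
  elim: n => [|n [s [sn rs ss]]].
    by exists [:: l0]; split=> //=; rewrite andbT; apply/gen_eigenvalue_root.
  case: s sn rs ss => // x s [sn] /= /andP[rx rs] ss.
  have [y [hy xy]] := up x (proj2 (gen_eigenvalue_root x) rx).
  exists (y :: x :: s); split=> /=; first by rewrite sn.
    by rewrite rx rs !andbT; apply/gen_eigenvalue_root.
  by rewrite ss andbT.
have [s [sn rs ss]] := chain (size p).
have := max_poly_roots p0 rs (sorted_uniq (rev_trans lt_trans) ltxx ss).
by rewrite sn ltnNge leqW // leqnn.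
Qed.

End perturbation.

(** The deterministic core. The constants [x0] and [C] are chosen before the dimension, the basis
    and the matrices, so the estimate applies pathwise to random matrices of growing size. Of [eps]
    only smallness is asked, and it is absent from the remainder. *)
Theorem largest_gen_eigenvalue_expansion (R : realType) (H : lmodType R) (ip : H -> H -> R)
    (T : H -> H) (TC rho e0 : R) (phi phis : H) :
  top_eigenvalue ip T TC rho e0 phi phis ->
  exists2 x0 : R, 0 < x0 & exists2 C : R, 0 <= C &
  forall (k : nat) (e : 'I_k -> H), orthonormal_family ip e ->
  forall (Mh Gh : 'M[R]_k) (eps eta : R),
  let u := coords ip e phis in let v := coords ip e phi in
  let a := snorm ip (phi - lincomb e v) in
  let as_ := snorm ip (phis - lincomb e u) in
  (forall f, snorm ip (T f - lincomb e (coords ip e (T f))) <= eps * snorm ip f) ->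
  (forall w : 'cV[R]_k, enorm ((Mh - compression ip T e) *m w) <= eta * enorm w) ->
  (forall w : 'cV[R]_k, enorm ((Gh - 1%:M) *m w) <= eta * enorm w) ->
  0 <= eta <= x0 -> 0 <= eps <= x0 -> a <= x0 -> as_ <= x0 ->
  exists2 l, largest_gen_eigenvalue Mh Gh l &
    `|(l - rho) - dotc u ((Mh - rho *: Gh) *m v)| <= C * (eta + a + as_) ^+ 2.
Proof.
move=> hte; have [c c0 gap] := spectral_gap hte.
set F := snorm ip phis; have F0 : 0 <= F := snorm_ge0 ip _.
have e00 := te_e0 hte; have rho0 := lt_trans e00 (te_rho hte).
have erho := te_rho hte; have TC0 := te_TC hte.
(* [L] exceeds both the a priori bound [2 * TC + 1] on generalized eigenvalues and [rho + e0]. *)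
pose L := 2 * TC + 2 + 2 * rho.
have L0 : 0 <= L by rewrite /L; lra.
pose C1 := 2 / c * (1 + L + TC + rho).
have C10 : 0 <= C1.
  by apply: mulr_ge0; [rewrite divr_ge0 // ltW|lra].
(* Each pair is one smallness hypothesis of the preceding lemmas with every error replaced by [x];
   the factor 2 + L comes from eps + eta (1 + |l|) <= (2 + L) x. *)
pose s : seq (R * R) := [:: ((2 + L) * (1 + F), c / 4); (F, 4^-1);
  (4 * F * (2 + L + e0), e0); (1, 2^-1); (1, c / 2);
  (C1 * (2 + 2 * (2 + L) * F), 2^-1); (9 * F, 2^-1)].
have [] := @small_scale R s.
  by rewrite /= !divr_gt0 // !invr_gt0 e00 !ltr0n.
move=> x x0 /(_ x (ltW x0) (lexx x)) hx.
have h1 := hx _ (mem_nth (0, 0) (isT : (0 < size s)%N)).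
have h2 := hx _ (mem_nth (0, 0) (isT : (1 < size s)%N)).
have h3 := hx _ (mem_nth (0, 0) (isT : (2 < size s)%N)).
have h4 := hx _ (mem_nth (0, 0) (isT : (3 < size s)%N)).
have h5 := hx _ (mem_nth (0, 0) (isT : (4 < size s)%N)).
have h6 := hx _ (mem_nth (0, 0) (isT : (5 < size s)%N)).
have h7 := hx _ (mem_nth (0, 0) (isT : (6 < size s)%N)).
rewrite /= ?mul1r in h1 h2 h3 h4 h5 h6 h7.
set C2 := F * (TC + rho) + F * (1 + rho); set C3 := TC + F * (1 + rho).
set C5 := 2 * (C2 + C3).
have rho1 := ltW rho0.
have C30 : 0 <= C3 by rewrite addr_ge0 // mulr_ge0 // addr_ge0.
have C20 : 0 <= C2 by rewrite /C2 addr_ge0 // mulr_ge0 // addr_ge0.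
have C50 : 0 <= C5 by rewrite mulr_ge0 // addr_ge0.
exists x => //; exists (3 * F * C5 + 2 * C1 * C3 * (1 + C5)).
  have C51 : 0 <= 1 + C5 by rewrite addr_ge0.
  by have := mulr_ge0 F0 C50; have := mulr_ge0 (mulr_ge0 C10 C30) C51; lra.
move=> k e oe Mh Gh eps eta u v a as_ happ hMh hGh /andP[eta0 etax] /andP[ep0 epx] ax asx.
have a0 : 0 <= a := snorm_ge0 ip _; have as0 : 0 <= as_ := snorm_ge0 ip _.
pose kap := (2 + L) * x.
have hk l : `|l| <= L -> eps + eta * (1 + `|l|) <= kap.
  move=> hl; have : eta * (1 + `|l|) <= x * (1 + L) by apply: ler_pM => //; rewrite ?addr_ge0 ?lerD2l.
  by rewrite /kap; lra.
have k0 : 0 <= kap by exact: mulr_ge0 (addr_ge0 (ler0n _ 2) L0) (ltW x0).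
have k1 : kap * (1 + F) <= c / 4 by rewrite /kap mulrAC.
have Fa : F * a <= F * x by rewrite ler_wpM2l.
have Fa4 : F * a <= 4^-1 by lra.
have k3 : 4 * F * (kap + a * e0) <= e0.
  apply: le_trans h3; rewrite -[leRHS]mulrA ler_wpM2l ?mulr_ge0 // mulrDl lerD2l mulrC.
  by rewrite ler_wpM2l // ltW.
have [l1 hl1 gl1] : exists2 l, rho - e0 <= l & gen_eigenvalue Mh Gh l.
  apply: (@exists_gen_eigenvalue _ _ _ _ _ _ _ _ _ hte c c0 gap k e oe Mh Gh eps eta
    happ hMh hGh eta0 e0 kap) => //.
  have <- : 1 + (rho + e0) = 1 + rho + e0 by rewrite addrA.
  by rewrite -[rho + e0]ger0_norm; [apply: hk; rewrite ger0_norm|]; rewrite /L; lra.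
have bnd l : gen_eigenvalue Mh Gh l -> `|l| <= 2 * TC + 1.
  by apply: (@gen_eigenvalue_bound _ _ _ _ _ _ _ _ _ hte k e oe Mh Gh eta hMh hGh); lra.
have [l hl] : exists l, largest_gen_eigenvalue Mh Gh l.
  apply: (@exists_largest_gen_eigenvalue _ k Mh Gh (2 * TC + 1)); first by exists l1.
  by move=> l /bnd; apply: le_trans; exact: ler_norm.
exists l => //; have [gl lmax] := hl.
have lrho : rho - e0 <= l := le_trans hl1 (lmax _ gl1).
have lL : `|l| <= L by rewrite (le_trans (bnd _ gl)) // /L; lra.
have [y y0 hy] := gl.
have [D0 hlr] : dotc u y != 0 /\ `|l - rho| <= 2 * kap * F.
  apply: (@eigen_estimate _ _ _ _ _ _ _ _ _ hte c c0 gap k e oe Mh Gh eps eta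
    happ hMh hGh l kap) => //; first exact: hk.
  by rewrite -/F; apply: le_trans k1 _; lra.
apply: (@eigenvalue_expansion _ _ _ _ _ _ _ _ _ hte c c0 gap k e oe Mh Gh eps eta L
    happ hMh hGh eta0 l y) => //; rewrite -/v -/u -/a -/as_ -/F.
- by lra.
- by lra.
- apply: le_trans h6; rewrite -/C1 -[leRHS]mulrA ler_wpM2l //.
  move: hlr; rewrite /kap; lra.
- apply: le_trans h7.
  have : F * (eta + a + as_) <= F * (3 * x) by rewrite ler_wpM2l //; lra.
  lra.
Qed.

(** * Expectations of real random variables *)

Section expectation.
Context (R : realType) (d : measure_display) (T : measurableType d) (P : probability T R).
Local Notation fm := (finite_mean P).
Local Notation E := (Ex P).
Implicit Types f g : T -> R.

Lemma fm_measurable f : fm f -> measurable_fun [set: T] f.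
Proof. by move=> /integrableP[/measurable_EFinP]. Qed.

Lemma fmD f g : fm f -> fm g -> fm (fun x => f x + g x).
Proof. exact: integrableD. Qed.

Lemma fmB f g : fm f -> fm g -> fm (fun x => f x - g x).
Proof. exact: integrableB. Qed.

Lemma fmZ (a : R) f : fm f -> fm (fun x => a * f x).
Proof. exact: integrableZl. Qed.

Lemma fm_cst (a : R) : fm (fun=> a).
Proof. exact: finite_measure_integrable_cst. Qed.

Lemma fm_abs f : fm f -> fm (fun x => `|f x|).
Proof. exact: integrable_abse. Qed.

Lemma fm_eq f g : f =1 g -> fm f -> fm g.
Proof. by move=> /funext ->. Qed.

Lemma fm_le f g : measurable_fun [set: T] f -> (forall x, `|f x| <= g x) -> fm g -> fm f.
Proof.
move=> mf fg; apply: le_integrable => //; first exact/measurable_EFinP.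
by move=> x _ /=; rewrite lee_fin (le_trans (fg x)) // ler_norm.
Qed.

Lemma fm_sum n (f : nat -> T -> R) : (forall i, fm (f i)) ->
  fm (fun x => \sum_(i < n) f i x).
Proof.
move=> hf; elim: n => [|n IH].
  by apply: fm_eq (fm_cst 0) => x; rewrite big_ord0.
by apply: fm_eq (fmD IH (hf n)) => x; rewrite big_ord_recr.
Qed.

Lemma ExE f : fm f -> (E f)%:E = (\int[P]_x (f x)%:E)%E.
Proof. by move=> hf; rewrite fineK //; exact: integrable_fin_num. Qed.

Lemma ExD f g : fm f -> fm g -> E (fun x => f x + g x) = E f + E g.
Proof. exact: RintegralD. Qed.

Lemma ExB f g : fm f -> fm g -> E (fun x => f x - g x) = E f - E g.
Proof. exact: RintegralB. Qed.

Lemma ExZ (a : R) f : fm f -> E (fun x => a * f x) = a * E f.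
Proof. exact: RintegralZl. Qed.

Lemma Ex_cst (a : R) : E (fun=> a) = a.
Proof.
apply: EFin_inj; rewrite ExE; last exact: fm_cst.
have := expectation_cst P a; rewrite unlock; exact.
Qed.

Lemma Ex_eq f g : f =1 g -> E f = E g. Proof. by move=> /funext ->. Qed.

Lemma Ex_ge0 f : (forall x, 0 <= f x) -> 0 <= E f.
Proof. by move=> h; apply: Rintegral_ge0. Qed.

Lemma Ex_le f g : fm f -> fm g -> (forall x, f x <= g x) -> E f <= E g.
Proof. by move=> hf hg h; apply: le_Rintegral. Qed.

Lemma Ex_abs f : fm f -> `|E f| <= E (fun x => `|f x|).
Proof. exact: le_normr_Rintegral. Qed.

Lemma Ex_sum n (f : nat -> T -> R) : (forall i, fm (f i)) ->
  E (fun x => \sum_(i < n) f i x) = \sum_(i < n) E (f i).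
Proof.
move=> hf; elim: n => [|n IH].
  by rewrite big_ord0 -[RHS]Ex_cst; apply: Ex_eq => x; rewrite big_ord0.
rewrite [RHS]big_ord_recr /= -IH -ExD //; last exact: fm_sum.
by apply: Ex_eq => x; rewrite big_ord_recr.
Qed.

Lemma fm_ge0 f (C : R) : measurable_fun [set: T] f -> (forall x, 0 <= f x) ->
  (\int[P]_x (f x)%:E <= C%:E)%E -> fm f /\ E f <= C.
Proof.
move=> mf f0 fC; have hf : fm f.
  apply/integrableP; split; first exact/measurable_EFinP.
  apply: le_lt_trans (ltry C); apply: le_trans fC.
  apply: ge0_le_integral => //.
  - by apply: measurableT_comp => //; exact/measurable_EFinP.
  - exact/measurable_EFinP.
  - by move=> x _; rewrite /= ger0_norm.
by split=> //; rewrite -lee_fin ExE.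
Qed.

Lemma ae_fm f g : measurable_fun [set: T] g -> {ae P, forall x, f x = g x} -> fm f -> fm g.
Proof.
move=> mg fg hf; apply/integrableP; split; first exact/measurable_EFinP.
have /integrableP [mf hfi] := hf; apply: le_lt_trans hfi.
rewrite (_ : \int[P]_x `|(EFin \o g) x| = \int[P]_x `|(EFin \o f) x|)%E //.
apply: ge0_ae_eq_integral => //.
- by apply: measurableT_comp => //; exact/measurable_EFinP.
- exact: measurableT_comp.
- by apply: filterS fg => x /= -> _.
Qed.

Lemma ae_Ex f g : fm f -> measurable_fun [set: T] g -> {ae P, forall x, f x = g x} ->
  E f = E g.
Proof.
move=> hf mg fg; have hg := ae_fm mg fg hf.
rewrite /Ex /Rintegral; congr fine; apply: ae_eq_integral => //.
- exact/measurable_EFinP/fm_measurable.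
- exact/measurable_EFinP.
- by apply: filterS fg => x /= -> _.
Qed.

Lemma ae_Ex_le f g : fm f -> fm g -> {ae P, forall x, f x <= g x} -> E f <= E g.
Proof.
move=> hf hg fg.
have mmax : measurable_fun [set: T] (fun x => Num.max (f x) (g x)).
  by apply: measurable_maxr; exact: fm_measurable.
have ae : {ae P, forall x, g x = Num.max (f x) (g x)}.
  by apply: filterS fg => x /max_r.
rewrite (ae_Ex hg mmax ae); apply: Ex_le => //; first exact: ae_fm ae hg.
by move=> x; rewrite le_max lexx.
Qed.

Lemma fm_ae_le f g : measurable_fun [set: T] f -> {ae P, forall x, `|f x| <= g x} ->
  fm g -> fm f.
Proof.
move=> mf fg hg; apply/integrableP; split; first exact/measurable_EFinP.
have /integrableP [mg hgi] := hg; apply: le_lt_trans hgi.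
have mmax : measurable_fun [set: T] (fun x => Num.min `|f x| `|g x|).
  apply: measurable_minr; apply: measurableT_comp => //; exact: fm_measurable.
rewrite (_ : \int[P]_x `|(EFin \o f) x| = \int[P]_x (Num.min `|f x| `|g x|)%:E)%E; last first.
  apply: ge0_ae_eq_integral => //.
  - by apply: measurableT_comp => //; exact/measurable_EFinP.
  - exact/measurable_EFinP.
  - by apply: filterS fg => x h _ /=; rewrite min_l // (le_trans h) // ler_norm.
apply: ge0_le_integral => //.
- exact/measurable_EFinP.
- exact: measurableT_comp.
- by move=> x _; rewrite lee_fin ge_min lexx orbT.
Qed.

Lemma Ex_eq0 f : fm f -> (forall x, 0 <= f x) -> E f = 0 -> {ae P, forall x, f x = 0}.
Proof.
move=> hf f0 Ef; have mf := fm_measurable hf.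
have mf' : measurable_fun [set: T] (EFin \o f) by exact/measurable_EFinP.
have [+ _] := ae_eq_integral_abs P measurableT mf'.
have -> : (\int[P]_x `|(EFin \o f) x| = 0)%E.
  rewrite -[RHS]/(0%:E) -Ef ExE //; apply: eq_integral => x _.
  by rewrite /= ger0_norm.
by move=> /(_ erefl); apply: filterS => x /(_ I) /= [].
Qed.

Lemma fm_indic (A : set T) : measurable A -> fm (\1_A : T -> R) /\ (E \1_A)%:E = P A.
Proof.
move=> mA; have h : fm (\1_A : T -> R).
  apply: (@fm_le _ (fun=> 1)); last exact: fm_cst.
    exact: measurable_indic.
  by move=> x; rewrite indicE ger0_norm ?lern1 ?leq_b1.
by split=> //; rewrite ExE // integral_indic // setIT.
Qed.

Lemma markov_le f (e : R) : fm f -> (forall x, 0 <= f x) -> 0 < e ->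
  measurable [set x | e <= f x] /\ (P [set x | (e <= f x)%R] <= (E f / e)%:E)%E.
Proof.
move=> hf f0 e0; have mf := fm_measurable hf.
have mA : measurable [set x | e <= f x].
  rewrite [X in measurable X](_ : _ = [set: T] `&` f @^-1` [set` `[e, +oo[]).
    exact: mf.
  by rewrite setTI; apply/seteqP; split => x /=; rewrite in_itv /= andbT.
split=> //; have [hi hP] := fm_indic mA.
rewrite -hP lee_fin ler_pdivlMr // mulrC -ExZ //; apply: Ex_le => //; first exact: fmZ.
move=> x; rewrite indicE; case: (boolP (x \in _)) => [|_]; last by rewrite mulr0.
by rewrite inE /= mulr1.
Qed.

Lemma Ex_dominated_cvg (f_ : nat -> T -> R) f g :
  (forall n, measurable_fun [set: T] (f_ n)) -> measurable_fun [set: T] f ->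
  {ae P, forall x, f_ n x @[n --> \oo] --> f x} -> fm g ->
  (forall n, {ae P, forall x, `|f_ n x| <= g x}) ->
  E (f_ n) @[n --> \oo] --> E f.
Proof.
move=> mf_ mf ff hg fg.
have hfn n : fm (f_ n) by exact: fm_ae_le (fg n) hg.
have [hf _ cv] : [/\ P.-integrable setT (EFin \o f),
    (\int[P]_x (`|(EFin \o f_ n) x - (EFin \o f) x|))%E @[n --> \oo] --> 0%E &
    (\int[P]_x ((EFin \o f_ n) x))%E @[n --> \oo] --> (\int[P]_x ((EFin \o f) x))%E].
  apply: (@dominated_convergence _ _ _ P setT measurableT _ _ (EFin \o g)).
  - by move=> n; exact/measurable_EFinP.
  - exact/measurable_EFinP.
  - by apply: filterS ff => x h _; apply/cvg_EFin; [exact: nearW|].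
  - exact: hg.
  - have : {ae P, forall x n, `|f_ n x| <= g x} by exact/ae_foralln.
    by apply: filterS => x h n _ /=; rewrite lee_fin.
have hfE : (\int[P]_x ((EFin \o f) x))%E = (E f)%:E by rewrite ExE.
by rewrite hfE in cv; exact: fine_cvg cv.
Qed.

(** Fatou's lemma with integrability of the limit as part of the conclusion: it is what provides
    membership in L^2 for limits and integrability of products under conditioning. *)
Lemma Ex_fatou (f_ : nat -> T -> R) f (C : R) :
  (forall n, fm (f_ n)) -> (forall n x, 0 <= f_ n x) -> measurable_fun [set: T] f ->
  (forall x, 0 <= f x) -> (\forall n \near \oo, E (f_ n) <= C) ->
  {ae P, forall x, f_ n x @[n --> \oo] --> f x} -> fm f /\ E f <= C.
Proof.
move=> hf_ f_0 mf f0 hC ff.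
have mf_ n := fm_measurable (hf_ n).
apply: fm_ge0 => //.
have le1 : (\int[P]_x limn_einf (fun n => (f_ n x)%:E) <= C%:E)%E.
  apply: le_trans (fatou P measurableT (f := fun n => EFin \o f_ n) _ _) _.
  - by move=> n; exact/measurable_EFinP.
  - by move=> n x _; rewrite /= lee_fin.
  rewrite limn_einf_lim; apply: lime_le; first exact: is_cvg_einfs.
  have [N _ hN] := hC; apply: nearW => n.
  apply: le_trans (_ : (\int[P]_x (f_ (maxn n N) x)%:E <= C%:E)%E).
    by apply: ereal_inf_lbound; exists (maxn n N) => //=; exact: leq_maxl.
  by rewrite -ExE // lee_fin; apply: hN => /=; exact: leq_maxr.
apply: le_trans le1; rewrite le_eqVlt; apply/orP; left; apply/eqP.
apply: ge0_ae_eq_integral => //.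
- exact/measurable_EFinP.
- rewrite (_ : (fun x => _) = fun x => (- limn_esup (fun n => - (f_ n x)%:E))%E).
    apply: measurableT_comp => //; apply: measurable_fun_limn_esup => n.
    by apply: measurableT_comp => //; exact/measurable_EFinP.
  apply/funext => x; have -> := limn_esupN (fun n => (f_ n x)%:E).
  by rewrite oppeK.
- by move=> x _; rewrite lee_fin.
- move=> x _; rewrite limn_einf_lim; apply: lime_ge; first exact: is_cvg_einfs.
  apply: nearW => n; apply: le_ereal_inf_tmp => _ [m _ <-].
  by rewrite lee_fin.
- apply: filterS ff => x h _.
  have h' : (f_ n x)%:E @[n --> \oo] --> (f x)%:E.
    by apply: cvg_EFin; [exact: nearW|exact: h].
  by have [-> _] := cvg_limn_einf_sup h'.
Qed.

(** By monotone convergence the supremum has integral at most [C], so it is finite almost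
    everywhere. *)
Lemma Ex_monotone_ae_bounded (g : nat -> T -> R) (C : R) :
  (forall n, fm (g n)) -> (forall n x, 0 <= g n x) ->
  (forall x, nondecreasing_seq (g ^~ x)) -> (forall n, E (g n) <= C) ->
  {ae P, forall x, exists B, forall n, g n x <= B}.
Proof.
move=> hg g0 gnd hC.
have mg n : measurable_fun [set: T] (EFin \o g n).
  by apply/measurable_EFinP; exact: fm_measurable.
pose G x := limn (fun n => (g n x)%:E).
have nd x : nondecreasing_seq (fun n => (g n x)%:E).
  by move=> m n mn; rewrite lee_fin; exact: gnd.
have G0 x : (0 <= G x)%E.
  apply: lime_ge; first exact: ereal_nondecreasing_is_cvgn.
  by apply: nearW => n; rewrite lee_fin.
have mG : measurable_fun [set: T] G.
  by apply: emeasurable_fun_cvg mg _ => x _; exact: (ereal_nondecreasing_is_cvgn (nd x)).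
have GC : (\int[P]_x G x <= C%:E)%E.
  rewrite (monotone_convergence P measurableT mg).
  - apply: lime_le; first by apply: ereal_nondecreasing_is_cvgn => m n mn;
      apply: ge0_le_integral => // x _; [rewrite /= lee_fin|exact: nd].
    by apply: nearW => n; rewrite -ExE // lee_fin.
  - by move=> n x _; rewrite /= lee_fin.
  - by move=> x _; exact: nd.
have iG : P.-integrable setT G.
  apply/integrableP; split => //; apply: le_lt_trans (ltry C).
  by under eq_integral do rewrite gee0_abs //.
apply: filterS (integrable_ae measurableT iG) => x /(_ I) fG.
exists (fine (G x)) => n; rewrite -lee_fin fineK //.
have -> : G x = ereal_sup (range (fun n => (g n x)%:E)).
  by apply/cvg_lim => //; exact: ereal_nondecreasing_cvgn.
by apply: ereal_sup_ubound; exists n.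
Qed.

End expectation.

(** * Change of variables under an image law *)

Section same_law.
Context (R : realType) (d1 d2 : measure_display) (X : measurableType d1)
  (Y : measurableType d2) (P : probability X R) (nu : probability Y R) (phi : X -> Y).
Hypothesis mphi : measurable_fun [set: X] phi.
Hypothesis law : forall B, measurable B -> P (phi @^-1` B) = nu B.

Lemma law_ge0_integral (f : Y -> \bar R) : measurable_fun [set: Y] f ->
  (forall y, (0 <= f y)%E) -> (\int[nu]_y f y = \int[P]_x f (phi x))%E.
Proof.
move=> mf f0; have := ge0_integral_pushforward mphi P measurableT mf (fun y _ => f0 y).
rewrite preimage_setT => <-; apply: eq_measure_integral => A mA _.
exact: (esym (law mA)).
Qed.

Lemma law_fm (f : Y -> R) : measurable_fun [set: Y] f ->
  finite_mean nu f <-> finite_mean P (fun x => f (phi x)).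
Proof.
move=> mf.
have mf' : measurable_fun [set: Y] (EFin \o f) by exact/measurable_EFinP.
have eqi : (\int[nu]_y `|(f y)%:E| = \int[P]_x `|(f (phi x))%:E|)%E.
  by rewrite (@law_ge0_integral (fun y => `|(f y)%:E|%E)) //; exact: measurableT_comp.
split=> /integrableP[_ hf]; apply/integrableP; split => //=.
- apply/measurable_EFinP; exact: measurableT_comp.
- by rewrite -eqi.
- by rewrite eqi.
Qed.

Lemma law_Ex (f : Y -> R) : measurable_fun [set: Y] f ->
  finite_mean nu f -> Ex nu f = Ex P (fun x => f (phi x)).
Proof.
move=> mf hf; apply: EFin_inj; rewrite ExE // ExE; last exact/law_fm.
have mf' : measurable_fun [set: Y] (EFin \o f) by exact/measurable_EFinP.
rewrite integralE [RHS]integralE; congr (_ - _)%E.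
- rewrite (@law_ge0_integral (EFin \o f)^\+%E) //; last exact: measurable_funepos.
  by apply: eq_integral => x _; rewrite -[LHS]/(((EFin \o f)^\+%E \o phi) x) -funepos_comp.
- rewrite (@law_ge0_integral (EFin \o f)^\-%E) //; last exact: measurable_funeneg.
  by apply: eq_integral => x _; rewrite -[LHS]/(((EFin \o f)^\-%E \o phi) x) -funeneg_comp.
Qed.

Lemma law_ae (A : set Y) : {ae nu, forall y, A y} -> {ae P, forall x, A (phi x)}.
Proof.
move=> [N [mN N0 hN]]; exists (phi @^-1` N); split.
- by rewrite -[X in measurable X]setTI; exact: mphi.
- by apply: etrans N0; exact: law.
- by move=> x /= h; apply: hN.
Qed.

End same_law.

(** * The space L^2(Q) as a semi-inner product space *)

Section L2.
Context (R : realType) (d : measure_display) (S : measurableType d) (Q : probability S R).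
Implicit Types f g : S -> R.

Lemma L2_measurable f : L2 Q f -> measurable_fun [set: S] f.
Proof. by move=> /sub_Lfun_mfun; rewrite inE. Qed.

Lemma L2_fmM f g : L2 Q f -> L2 Q g -> finite_mean Q (fun x => f x * g x).
Proof. by move=> hf hg; apply/Lfun1_integrable; exact: Lfun2_mul_Lfun1. Qed.

Lemma L2norm_sqr f : measurable_fun [set: S] f -> finite_mean Q (fun x => f x ^+ 2) ->
  L2norm Q f = (Num.sqrt (Ex Q (fun x => f x ^+ 2)))%:E.
Proof.
move=> mf hf; rewrite /L2norm unlock.
rewrite -powR12_sqrt; last by apply: Ex_ge0 => x; exact: sqr_ge0.
rewrite -poweR_EFin ExE //; congr (_ `^ _)%E; apply: eq_integral => x _.
by rewrite /= powR_mulrn ?normr_ge0 // real_normK ?num_real.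
Qed.

Lemma L2P f : measurable_fun [set: S] f -> finite_mean Q (fun x => f x ^+ 2) -> L2 Q f.
Proof.
move=> mf hf; rewrite /L2 /= inE; apply/andP; split; rewrite inE //=.
by rewrite /finite_norm -[X in (X < _)%E]/(L2norm Q f) L2norm_sqr // ltry.
Qed.

Lemma L2_sqr f : L2 Q f -> finite_mean Q (fun x => f x ^+ 2).
Proof. by move=> hf; apply: fm_eq (L2_fmM hf hf) => x; rewrite expr2. Qed.

Lemma L2_lin (a : R) f g : L2 Q f -> L2 Q g -> L2 Q (fun x => a * f x + g x).
Proof. exact: (Lfun_submod_closed Q (lee1n 2)).2 a f g. Qed.

Lemma L2D f g : L2 Q f -> L2 Q g -> L2 Q (fun x => f x + g x).
Proof.
move=> hf hg; rewrite (_ : (fun x => _) = fun x => 1 * f x + g x); first exact: L2_lin.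
by apply/funext => x; rewrite mul1r.
Qed.

Lemma L2_cst (a : R) : L2 Q (fun=> a).
Proof. by apply: L2P; [exact: measurable_cst|exact: fm_cst]. Qed.

Lemma L2Z (a : R) f : L2 Q f -> L2 Q (fun x => a * f x).
Proof.
move=> hf; rewrite (_ : (fun x => _) = fun x => a * f x + 0).
  by apply: L2_lin => //; exact: L2_cst.
by apply/funext => x; rewrite addr0.
Qed.

Lemma L2_abs f : L2 Q f -> L2 Q (fun x => `|f x|).
Proof.
move=> hf; apply: L2P.
  by apply: measurableT_comp => //; exact: L2_measurable.
by apply: fm_eq (L2_sqr hf) => x; rewrite real_normK ?num_real.
Qed.

Lemma L2_ae f g : L2 Q f -> measurable_fun [set: S] g -> {ae Q, forall x, f x = g x} -> L2 Q g.
Proof.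
move=> hf mg fg; apply: L2P => //; apply: (@ae_fm _ _ _ _ (fun x => f x ^+ 2)).
- exact: measurable_funX.
- by apply: filterS fg => x ->.
- exact: L2_sqr.
Qed.

(** The module of square-integrable functions without passage to classes. Hence [ipL] is only a
    semi-inner product, whose null vectors are the functions vanishing almost everywhere. *)
Definition L2T : lmodType R := LfunType Q (lee1n 2).
Definition toL2 f (hf : L2 Q f) : L2T := Lfun_Sub (lee1n 2) hf.
Definition L2fun (u : L2T) : S -> R := (u : LfunType Q (lee1n 2)).
Definition ipL (u v : L2T) : R := inner Q (L2fun u) (L2fun v).

Lemma L2fun_L2 (u : L2T) : L2 Q (L2fun u). Proof. exact: LfunP. Qed.

Lemma toL2K f (hf : L2 Q f) : L2fun (toL2 hf) = f. Proof. by []. Qed.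

Lemma L2funD (u v : L2T) x : L2fun (u + v) x = L2fun u x + L2fun v x. Proof. by []. Qed.
Lemma L2funZ a (u : L2T) x : L2fun (a *: u) x = a * L2fun u x. Proof. by []. Qed.
Lemma L2funB (u v : L2T) x : L2fun (u - v) x = L2fun u x - L2fun v x. Proof. by []. Qed.

End L2.

Section L2_complete.
Context (R : realType) (d : measure_display) (S : measurableType d) (Q : probability S R).
Local Notation ipQ := (@ipL R d S Q).
Local Notation nrm := (snorm ipQ).

Lemma semi_ip_L2 : semi_ip ipQ.
Proof.
split.
- by move=> f g; apply: Ex_eq => x; rewrite mulrC.
- move=> f g h; rewrite -ExD; try exact: L2_fmM (L2fun_L2 _) (L2fun_L2 _).
  by apply: Ex_eq => x; rewrite L2funD mulrDl.
- move=> a f h; rewrite -ExZ; last exact: L2_fmM (L2fun_L2 _) (L2fun_L2 _).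
  by apply: Ex_eq => x; rewrite L2funZ mulrA.
- by move=> f; apply: Ex_ge0 => x; rewrite -expr2 sqr_ge0.
Qed.

Lemma snorm_L2 (u : L2T Q) : (nrm u)%:E = L2norm Q (L2fun u).
Proof.
rewrite L2norm_sqr; [|exact: L2_measurable (L2fun_L2 _)|exact: L2_sqr (L2fun_L2 _)].
by congr (Num.sqrt _)%:E; apply: Ex_eq => x; rewrite expr2.
Qed.

Lemma Ex_sqr_L2 (u : L2T Q) : Ex Q (fun x => L2fun u x ^+ 2) = nrm u ^+ 2.
Proof.
by rewrite (sqr_snorm semi_ip_L2); apply: Ex_eq => x; rewrite expr2.
Qed.

(** The partial sums of |v_{j+1} - v_j| increase and have norm at most 2, so they are bounded almost
    everywhere; there the telescoping series converges absolutely. *)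
Lemma cauchy_ae_cvg (v : nat -> L2T Q) :
  (forall j, nrm (v j.+1 - v j) <= 2^-1 ^+ j) ->
  {ae Q, forall x, cvgn (fun j => L2fun (v j) x)}.
Proof.
move=> hv; pose w j : L2T Q := toL2 (L2_abs (L2fun_L2 (v j.+1 - v j))).
have wE j x : L2fun (w j) x = `|L2fun (v j.+1) x - L2fun (v j) x| by [].
have nw j : nrm (w j) <= 2^-1 ^+ j.
  apply: le_trans (hv j); rewrite -lee_fin !snorm_L2 /L2norm.
  by rewrite -(Lnorm_abse _ (EFin \o L2fun (v j.+1 - v j))).
pose g n : L2T Q := \sum_(j < n) w j.
have gE n x : L2fun (g n) x = \sum_(j < n) L2fun (w j) x.
  elim: n => [|n IH]; first by rewrite /g !big_ord0.
  rewrite /g !big_ord_recr /=.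
  by transitivity (L2fun (g n) x + L2fun (w n) x); rewrite // IH.
have ng n : nrm (g n) <= 2.
  apply: le_trans (snorm_sum semi_ip_L2 _) _.
  apply: (@le_trans _ _ (\sum_(j < n) 2^-1 ^+ j)); first by apply: ler_sum => j _; exact: nw.
  suff -> : \sum_(j < n) (2^-1 : R) ^+ j = 2 - 2 * 2^-1 ^+ n.
    by rewrite gerBl mulr_ge0 // exprn_ge0.
  elim: n => [|n IH]; first by rewrite big_ord0 expr0 mulr1 subrr.
  by rewrite big_ord_recr /= IH exprS; field.
have g0 n x : 0 <= L2fun (g n) x by rewrite gE; apply: sumr_ge0 => j _; rewrite wE.
have gnd x : nondecreasing_seq (fun n => L2fun (g n) x).
  by apply/nondecreasing_seqP => n; rewrite !gE big_ord_recr lerDl wE.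
have ae : {ae Q, forall x, exists B : R, forall n, L2fun (g n) x ^+ 2 <= B}.
  apply: (@Ex_monotone_ae_bounded _ _ _ Q (fun n x => L2fun (g n) x ^+ 2) 4).
  - by move=> n; exact: L2_sqr (L2fun_L2 _).
  - by move=> n x; exact: sqr_ge0.
  - by move=> x m n mn; rewrite lerXn2r ?nnegrE //; exact: gnd.
  - move=> n; rewrite Ex_sqr_L2 (_ : 4 = 2 ^+ 2); last by rewrite -natrX.
    by rewrite lerXn2r ?nnegrE ?snorm_ge0.
apply: filterS ae => x [B hB].
pose U : nat -> R := fun n => `|telescope (fun j => L2fun (v j) x) n|.
have cs : cvgn (series (telescope (fun j => L2fun (v j) x))).
  apply: normed_cvg.
  suff h : cvgn (fun n => \sum_(j < n) U j).
    have e : (fun n => \sum_(j < n) U j) = series U by apply/funext => n; rewrite seriesEord.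
    by rewrite e in h; exact: h.
  apply: nondecreasing_is_cvgn.
    by apply/nondecreasing_seqP => n; rewrite big_ord_recr lerDl /U.
  exists (1 + B) => _ [n _ <-].
  have gB : L2fun (g n) x <= 1 + B.
    by have := sqr_ge0 (L2fun (g n) x - 1); rewrite sqrrB1; have := hB n; have := g0 n x; lra.
  by apply: le_trans gB; rewrite gE; apply: ler_sum => j _; rewrite wE.
have := cs; rewrite telescopeK => h.
have : cvgn ((fun n => L2fun (v n) x - L2fun (v 0%N) x) + cst (L2fun (v 0%N) x)).
  by apply: is_cvgD => //; exact: is_cvg_cst.
by congr (cvgn _); apply/funext => n /=; rewrite /cst /= fctE subrK.
Qed.

(** The Riesz-Fischer argument: a rapidly Cauchy subsequence converges almost everywhere, and
    Fatou's lemma bounds the distance of the original sequence to the limit. *)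
Lemma complete_L2 : complete_ip ipQ.
Proof.
have hip := semi_ip_L2.
move=> u hu.
have hN j : exists N, forall i l, (N <= i)%N -> (N <= l)%N -> nrm (u i - u l) <= 2^-1 ^+ j.
  by apply: hu; rewrite exprn_gt0.
pose N j := projT1 (cid (hN j)).
have NP j : forall i l, (N j <= i)%N -> (N j <= l)%N -> nrm (u i - u l) <= 2^-1 ^+ j.
  by rewrite /N; case: cid.
(* Summing the thresholds makes [s] monotone and at least [N j]; adding [j] makes it tend to
   infinity. *)
pose s j := (\sum_(i < j.+1) N i + j)%N.
have sN j : (N j <= s j)%N by rewrite /s big_ord_recr /= addnAC leq_addl.
have sS j : (s j <= s j.+1)%N by rewrite /s [X in (_ <= X + _)%N]big_ord_recr /= leq_add // leq_addr.
pose v j := u (s j).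
have hv j : nrm (v j.+1 - v j) <= 2^-1 ^+ j.
  by apply: NP => //; exact: leq_trans (sN j) (sS j).
(* The limit superior is measurable on the whole space, while the limit exists only almost
   everywhere. *)
pose f x := fine (limn_esup (fun j => (L2fun (v j) x)%:E)).
have mv j : measurable_fun [set: S] (L2fun (v j)) := L2_measurable (L2fun_L2 _).
have mf : measurable_fun [set: S] f.
  apply: measurableT_comp => //; apply: measurable_fun_limn_esup => j.
  exact/measurable_EFinP.
have vf : {ae Q, forall x, L2fun (v j) x @[j --> \oo] --> f x}.
  apply: filterS (cauchy_ae_cvg hv) => x hx.
  have h : (L2fun (v j) x)%:E @[j --> \oo] --> (limn (fun j => L2fun (v j) x))%:E.
    by apply: cvg_EFin; [exact: nearW|exact: hx].
  by rewrite /f (cvg_limn_einf_sup h).2.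
(* Fatou's lemma along [j], with [i] fixed. *)
have key (i : nat) (C : R) : (\forall j \near \oo, nrm (v j - u i) <= C) ->
    finite_mean Q (fun x => (f x - L2fun (u i) x) ^+ 2) /\
    Ex Q (fun x => (f x - L2fun (u i) x) ^+ 2) <= C ^+ 2.
  move=> hC; apply: (@Ex_fatou _ _ _ Q (fun j x => L2fun (v j - u i) x ^+ 2)).
  - by move=> n; exact: L2_sqr (L2fun_L2 _).
  - by move=> n x; exact: sqr_ge0.
  - by apply: measurable_funX; apply: measurable_funB => //; exact: L2_measurable (L2fun_L2 _).
  - by move=> x; exact: sqr_ge0.
  - apply: filterS hC => j hj; rewrite Ex_sqr_L2 lerXn2r ?nnegrE ?snorm_ge0 //.
    exact: le_trans (snorm_ge0 _ _) hj.
  - apply: filterS vf => x hx.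
    have hh : L2fun (v j) x - L2fun (u i) x @[j --> \oo] --> f x - L2fun (u i) x.
      by apply: cvgB => //; exact: cvg_cst.
    exact: (cvgM hh hh).
have near_v (eps : R) : 0 < eps -> exists M, forall i, (M <= i)%N ->
    \forall j \near \oo, nrm (v j - u i) <= eps.
  move=> e0; have [M hM] := hu eps e0; exists M => i Mi.
  by exists M => // j /= Mj; apply: hM => //; apply: leq_trans Mj _; rewrite /s leq_addl.
have [M hM] := near_v 1 ltr01.
have [hf _] := key M 1 (hM M (leqnn M)).
have fL2 : L2 Q f.
  rewrite (_ : f = fun x => (f x - L2fun (u M) x) + L2fun (u M) x); last first.
    by apply/funext => x; rewrite subrK.
  apply: L2D; last exact: L2fun_L2.
  by apply: L2P => //; apply: measurable_funB => //; exact: L2_measurable (L2fun_L2 _).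
exists (toL2 fL2) => eps e0; have [K hK] := near_v eps e0; exists K => i Ki.
rewrite (snorm_distC hip) -(ler_pXn2r (_ : 0 < 2)%N) ?nnegrE ?snorm_ge0 ?(ltW e0) //.
by rewrite -Ex_sqr_L2; exact: (key i eps (hK i Ki)).2.
Qed.

End L2_complete.

(** * Conditional expectations and the operator *)

Section dyadic.
Context (R : realType).

(* min (floor y) N, as a sum of indicators *)
Definition count_below (N : nat) (y : R) : R := \sum_(k < N) ((k.+1%:R <= y)%R : nat)%:R.

Lemma count_belowP N y : 0 <= y ->
  [/\ N%:R <= y -> count_below N y = N%:R, count_below N y <= y &
      y <= N%:R -> y - 1 <= count_below N y].
Proof.
move=> y0; elim: N => [|N [IH1 IH2 IH3]].
  by rewrite /count_below big_ord0; split=> // y0'; lra.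
rewrite /count_below big_ord_recr /= -/(count_below N y).
have [h|h] := leP N.+1%:R y.
  have Ny : N%:R <= y by apply: le_trans h; rewrite ler_nat.
  rewrite IH1 // -natr1 -[true%:R]/(1 : R); split => //.
  - by rewrite natr1.
  - by move=> h2; lra.
rewrite -[false%:R]/(0 : R) addr0; split => //.
move=> _; have [Ny|/ltW /IH3 //] := leP N%:R y.
  by rewrite IH1 //; move: h; rewrite -natr1; lra.
Qed.

Lemma count_below_ge0 N y : 0 <= count_below N y.
Proof. by apply: sumr_ge0 => k _. Qed.

(** For y >= 0 this is min (floor (2^n y), n 2^n) / 2^n, written as a multiple of a plain sum of
    indicators, the form to which the defining property of conditional expectations extends at
    once. *)
Definition dyadic (n : nat) (y : R) : R :=
  2^-1 ^+ n * count_below (n * 2 ^ n) (2 ^+ n * y).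

Lemma dyadic_ge0 n y : 0 <= dyadic n y.
Proof. by rewrite mulr_ge0 ?exprn_ge0 ?count_below_ge0. Qed.

Lemma dyadic_le n y : 0 <= y -> dyadic n y <= y.
Proof.
move=> y0; have [//|_ h _] := @count_belowP (n * 2 ^ n) (2 ^+ n * y).
  by rewrite mulr_ge0 ?exprn_ge0.
rewrite /dyadic -[leRHS](@mulKf _ (2 ^+ n)) ?expf_neq0 // exprVn.
by rewrite ler_wpM2l ?invr_ge0 ?exprn_ge0.
Qed.

Lemma dyadic_ge n y : 0 <= y -> y <= n%:R -> y - 2^-1 ^+ n <= dyadic n y.
Proof.
move=> y0 yn; have [//|_ _ h] := @count_belowP (n * 2 ^ n) (2 ^+ n * y).
  by rewrite mulr_ge0 ?exprn_ge0.
have /h : 2 ^+ n * y <= (n * 2 ^ n)%:R.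
  by rewrite natrM natrX mulrC ler_wpM2r ?exprn_ge0.
rewrite /dyadic exprVn => /(ler_wpM2l (_ : 0 <= (2 ^+ n)^-1)).
by rewrite mulrBr mulr1 mulKf ?expf_neq0 //; apply; rewrite invr_ge0 exprn_ge0.
Qed.

Lemma dyadic_cvg y : 0 <= y -> dyadic n y @[n --> \oo] --> y.
Proof.
move=> y0; apply: (@squeeze_cvgr _ _ _ _ (fun n => y - 2^-1 ^+ n) (cst y)).
- exists (Num.bound y) => // n /= hn; rewrite dyadic_le // andbT dyadic_ge //.
  apply: ltW; apply: lt_le_trans (archi_boundP y0) _.
  by rewrite ler_nat.
- rewrite -[X in _ --> X]subr0; apply: cvgB; first exact: cvg_cst.
  apply: cvg_expr; rewrite ger0_norm //; lra.
- exact: cvg_cst.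
Qed.

End dyadic.

Section conditional_expectation.
Context (R : realType) (d1 d2 : measure_display) (T : measurableType d1)
  (S : measurableType d2) (P : probability T R) (Q : probability S R) (X : T -> S).
Hypothesis mX : measurable_fun [set: T] X.
Hypothesis law : forall B, measurable B -> P (X @^-1` B) = Q B.

Lemma Rintegral_indic (A : set T) (Z : T -> R) :
  \int[P]_(w in A) Z w = Ex P (fun w => \1_A w * Z w).
Proof.
rewrite /Ex Rintegral_mkcond; congr Rintegral; apply/funext => w.
by rewrite patchE indicE; case: (w \in A); rewrite ?mul1r ?mul0r.
Qed.

Lemma fm_indicM (A : set T) (Z : T -> R) : measurable A -> finite_mean P Z ->
  finite_mean P (fun w => \1_A w * Z w).
Proof.
move=> mA hZ; apply: (@fm_le _ _ _ _ _ (fun w => `|Z w|)); last exact: fm_abs.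
  by apply: measurable_funM; [exact: measurable_indic|exact: fm_measurable hZ].
move=> w; rewrite normrM indicE; case: (w \in A); rewrite ?normr1 ?mul1r //.
by rewrite normr0 mul0r.
Qed.

(** The conditional expectation is the Radon-Nikodym derivative with respect to [Q] of the image
    under [X] of the signed measure with density [Z]; domination holds because [Q] is the law of
    [X]. *)
Lemma cond_exp_exists (Z : T -> R) : finite_mean P Z -> exists g, is_cond_exp P X Z g.
Proof.
move=> hZ; have hZ' : P.-integrable [set: T] (EFin \o Z) := hZ.
have mZ := fm_measurable hZ.
have mXB B : measurable B -> measurable (X @^-1` B).
  by move=> mB; rewrite -[X in measurable X]setTI; exact: mX.
pose nu_ : {charge set S -> \bar R} :=
  pushforward (induced_charge hZ') X.
pose nu := nu_ mX.
have nuE A : nu A = (\int[P]_(w in X @^-1` A) (Z w)%:E)%E by [].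
have nuQ : nu `<< Q.
  apply/null_content_dominatesP => A mA QA; rewrite nuE.
  apply: null_set_integral; first exact: mXB.
    by apply/measurable_EFinP; exact: measurable_funTS.
  by apply: etrans QA; exact: law.
pose h := Radon_Nikodym nu Q; pose g x := fine (h x).
have hint : Q.-integrable [set: S] h by exact: Radon_Nikodym_integrable.
have hE : h = EFin \o g.
  by apply/funext => x /=; rewrite fineK //; exact: Radon_Nikodym_fin_num.
have hg : finite_mean Q g by rewrite /finite_mean -hE.
have mg := fm_measurable hg.
exists g; split => //; first exact/(law_fm mX law mg).
move=> B mB; rewrite /Rintegral -nuE (Radon_Nikodym_integral nuQ mB) -/h hE.
have mgB : measurable_fun [set: S] (fun x => \1_B x * g x).
  by apply: measurable_funM => //; exact: measurable_indic.
have hgB : finite_mean Q (fun x => \1_B x * g x).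
  apply: (@fm_le _ _ _ _ _ (fun x => `|g x|)) => //; last exact: fm_abs.
  move=> x; rewrite normrM indicE; case: (x \in B); rewrite ?normr1 ?mul1r //.
  by rewrite normr0 mul0r.
rewrite -[RHS]/(\int[P]_(w in X @^-1` B) g (X w)) Rintegral_indic.
rewrite -[LHS]/(\int[Q]_(x in B) g x).
have -> : \int[Q]_(x in B) g x = Ex Q (fun x => \1_B x * g x).
  rewrite /Ex Rintegral_mkcond; congr Rintegral; apply/funext => w.
  by rewrite patchE indicE; case: (w \in B); rewrite ?mul1r ?mul0r.
by rewrite (law_Ex mX law mgB hgB).
Qed.

Section given.
Context (Z : T -> R) (g : S -> R).
Hypothesis hce : is_cond_exp P X Z g.

Lemma ce_fmZ : finite_mean P Z. Proof. by case: hce. Qed.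
Lemma ce_mg : measurable_fun [set: S] g. Proof. by case: hce. Qed.
Lemma ce_fmg : finite_mean P (fun w => g (X w)). Proof. by case: hce. Qed.

Lemma ce_indic B : measurable B ->
  Ex P (fun w => \1_B (X w) * Z w) = Ex P (fun w => \1_B (X w) * g (X w)).
Proof.
move=> mB; have [_ _ _ /(_ B mB)] := hce; rewrite !Rintegral_indic.
by [].
Qed.

Lemma ce_sum n (B : nat -> set S) : (forall k, measurable (B k)) ->
  Ex P (fun w => (\sum_(k < n) \1_(B k) (X w)) * Z w) =
  Ex P (fun w => (\sum_(k < n) \1_(B k) (X w)) * g (X w)).
Proof.
move=> mB.
have mXB k : measurable (X @^-1` B k) by rewrite -[X in measurable X]setTI; exact: mX.
rewrite (@Ex_eq _ _ _ _ _ (fun w => \sum_(k < n) \1_(B k) (X w) * Z w)); last first.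
  by move=> w; rewrite mulr_suml.
rewrite [RHS](@Ex_eq _ _ _ _ _ (fun w => \sum_(k < n) \1_(B k) (X w) * g (X w))); last first.
  by move=> w; rewrite mulr_suml.
rewrite (@Ex_sum _ _ _ _ _ (fun k w => \1_(B k) (X w) * Z w)); last first.
  by move=> k; apply: fm_indicM (mXB k) ce_fmZ.
rewrite (@Ex_sum _ _ _ _ _ (fun k w => \1_(B k) (X w) * g (X w))); last first.
  by move=> k; apply: fm_indicM (mXB k) ce_fmg.
by apply: eq_bigr => k _; exact: ce_indic.
Qed.

Lemma ce_dyadic n (h : S -> R) : measurable_fun [set: S] h ->
  Ex P (fun w => dyadic n (h (X w)) * Z w) = Ex P (fun w => dyadic n (h (X w)) * g (X w)).
Proof.
move=> mh; pose B k : set S := [set x | (k.+1%:R : R) <= 2 ^+ n * h x].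
have mB k : measurable (B k).
  rewrite (_ : B k = [set: S] `&` (fun x => 2 ^+ n * h x) @^-1` [set` `[k.+1%:R, +oo[]).
    by apply: measurable_funM => //.
  by rewrite setTI; apply/seteqP; split => x /=; rewrite in_itv /= andbT.
have dE w : dyadic n (h (X w)) = 2^-1 ^+ n * \sum_(k < n * 2 ^ n) \1_(B k) (X w).
  congr (_ * _); apply: eq_bigr => k _; rewrite indicE; congr (nat_of_bool _)%:R.
  by apply/idP/idP; rewrite inE.
have fmS W : finite_mean P W ->
    finite_mean P (fun w => (\sum_(k < n * 2 ^ n) \1_(B k) (X w)) * W w).
  move=> hW; apply: fm_eq (@fm_sum _ _ _ P (n * 2 ^ n) (fun k w => \1_(B k) (X w) * W w) _).
    by move=> w; rewrite mulr_suml.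
  move=> k; apply: fm_indicM hW.
  by rewrite -[X in measurable X]setTI; exact: mX.
rewrite (@Ex_eq _ _ _ _ _ (fun w => 2^-1 ^+ n *
    ((\sum_(k < n * 2 ^ n) \1_(B k) (X w)) * Z w))); last by move=> w; rewrite dE mulrA.
rewrite [RHS](@Ex_eq _ _ _ _ _ (fun w => 2^-1 ^+ n *
    ((\sum_(k < n * 2 ^ n) \1_(B k) (X w)) * g (X w)))); last by move=> w; rewrite dE mulrA.
by rewrite !ExZ ?ce_sum //; apply: fmS; [exact: ce_fmg|exact: ce_fmZ].
Qed.

Lemma measurable_dyadic n (h : S -> R) : measurable_fun [set: S] h -> (forall x, 0 <= h x) ->
  measurable_fun [set: S] (fun x => dyadic n (h x)).
Proof.
move=> mh h0; apply: measurable_funM => //; apply: measurable_sum => k.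
rewrite (_ : (fun x => _) = \1_[set x | (k.+1%:R : R) <= 2 ^+ n * h x]).
  apply: measurable_indic.
  rewrite (_ : [set _ | _] = [set: S] `&` (fun x => 2 ^+ n * h x) @^-1` [set` `[k.+1%:R, +oo[]).
    by apply: measurable_funM => //.
  by rewrite setTI; apply/seteqP; split => x /=; rewrite in_itv /= andbT.
apply/funext => x; rewrite indicE; congr (nat_of_bool _)%:R.
by apply/idP/idP; rewrite inE.
Qed.

(** The defining property gives the identity for dyadic approximations of [h], and dominated
    convergence passes to the limit on both sides. *)
Lemma ce_tower_ge0 (h : S -> R) : measurable_fun [set: S] h -> (forall x, 0 <= h x) ->
  finite_mean P (fun w => h (X w) * Z w) -> finite_mean P (fun w => h (X w) * g (X w)) ->
  Ex P (fun w => h (X w) * Z w) = Ex P (fun w => h (X w) * g (X w)).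
Proof.
move=> mh h0 hZ hg.
have mZ := fm_measurable ce_fmZ; have mgX := fm_measurable ce_fmg.
have mhX : measurable_fun [set: T] (fun w => h (X w)) by exact: measurableT_comp.
have cv (W : T -> R) : measurable_fun [set: T] W -> finite_mean P (fun w => h (X w) * W w) ->
    Ex P (fun w => dyadic n (h (X w)) * W w) @[n --> \oo] --> Ex P (fun w => h (X w) * W w).
  move=> mW hW; apply: (@Ex_dominated_cvg _ _ _ P _ _ (fun w => `|h (X w) * W w|)).
  - move=> n; apply: measurable_funM => //.
    exact: measurableT_comp (measurable_dyadic n mh h0) mX.
  - exact: measurable_funM.
  - by apply: nearW => w; apply: cvgMl; exact: dyadic_cvg.
  - exact: fm_abs.
  - move=> n; apply: nearW => w; rewrite normrM [leRHS]normrM ler_wpM2r //.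
    by rewrite !ger0_norm ?dyadic_ge0 // dyadic_le.
have c1 := cv _ mZ hZ; have c2 := cv _ mgX hg.
have e : (fun n => Ex P (fun w => dyadic n (h (X w)) * Z w)) =
    (fun n => Ex P (fun w => dyadic n (h (X w)) * g (X w))).
  by apply/funext => n; exact: ce_dyadic.
by rewrite e in c1; exact: (cvg_unique _ c1 c2).
Qed.

(** The expectations of the dyadic approximations of h Z are bounded by that of h g, so Fatou's
    lemma yields integrability of h Z, which is not known beforehand. *)
Lemma ce_fm_ge0 (h : S -> R) : measurable_fun [set: S] h -> (forall x, 0 <= h x) ->
  (forall w, 0 <= Z w) -> {ae P, forall w, 0 <= g (X w)} ->
  finite_mean P (fun w => h (X w) * g (X w)) -> finite_mean P (fun w => h (X w) * Z w).
Proof.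
move=> mh h0 Z0 g0 hg.
have mZ := fm_measurable ce_fmZ; have mgX := fm_measurable ce_fmg.
have mhX : measurable_fun [set: T] (fun w => h (X w)) by exact: measurableT_comp.
have dle n (W : T -> R) w : 0 <= W w -> dyadic n (h (X w)) * W w <= h (X w) * W w.
  by move=> W0; rewrite ler_wpM2r // dyadic_le.
have mdX n : measurable_fun [set: T] (fun w => dyadic n (h (X w))).
  exact: measurableT_comp (measurable_dyadic n mh h0) mX.
have dbound n y : 0 <= y -> dyadic n y <= n%:R + 1 :> R.
  move=> y0; rewrite /dyadic exprVn mulrC ler_pdivrMr ?exprn_gt0 //.
  apply: (@le_trans _ _ (\sum_(k < n * 2 ^ n) (1 : R))).
    by apply: ler_sum => k _; rewrite -[X in _ <= X]/(1%:R) ler_nat leq_b1.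
  by rewrite sumr_const card_ord -[X in X <= _]/((n * 2 ^ n)%:R) natrM natrX ler_wpM2r ?exprn_ge0 // lerDl.
have [||||||//] := @Ex_fatou _ _ _ P (fun n w => dyadic n (h (X w)) * Z w)
  (fun w => h (X w) * Z w) (Ex P (fun w => h (X w) * g (X w))).
- move=> n; apply: (@fm_le _ _ _ _ _ (fun w => (n%:R + 1) * Z w)).
  + exact: measurable_funM.
  + move=> w; rewrite normrM (ger0_norm (Z0 w)) ger0_norm ?dyadic_ge0 //.
    by rewrite ler_wpM2r // dbound.
  + exact: fmZ ce_fmZ.
- by move=> n w; rewrite mulr_ge0 ?dyadic_ge0.
- exact: measurable_funM.
- by move=> w; rewrite mulr_ge0.
- apply: nearW => n; rewrite ce_dyadic //; apply: ae_Ex_le => //.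
    apply: (@fm_le _ _ _ _ _ (fun w => (n%:R + 1) * `|g (X w)|)).
    + exact: measurable_funM.
    + move=> w; rewrite normrM ger0_norm ?dyadic_ge0 //.
      by rewrite ler_wpM2r // dbound.
    + exact: fmZ (fm_abs ce_fmg).
  by apply: filterS g0 => w; exact: (dle n (fun w => g (X w))).
- by apply: nearW => w; apply: cvgMl; exact: dyadic_cvg.
Qed.

End given.

Lemma ce_tower (Z : T -> R) (g h : S -> R) (hce : is_cond_exp P X Z g) :
  measurable_fun [set: S] h ->
  finite_mean P (fun w => h (X w) * Z w) -> finite_mean P (fun w => h (X w) * g (X w)) ->
  Ex P (fun w => h (X w) * Z w) = Ex P (fun w => h (X w) * g (X w)).
Proof.
move=> mh hZ hg.
have mZ := fm_measurable (ce_fmZ hce); have mgX := fm_measurable (ce_fmg hce).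
pose hp x := Num.max (h x) 0; pose hn x := Num.max (- h x) 0.
have mhp : measurable_fun [set: S] hp by apply: measurable_maxr.
have mhn : measurable_fun [set: S] hn.
  by apply: measurable_maxr => //; exact: measurableT_comp.
have hE x : h x = hp x - hn x.
  by rewrite /hp /hn; case: (leP (h x) 0) => h0; case: (leP (- h x) 0) => h1; lra.
have hp0 x : 0 <= hp x by rewrite le_max lexx orbT.
have hn0 x : 0 <= hn x by rewrite le_max lexx orbT.
have hpl x : hp x <= `|h x| by rewrite ge_max ler_norm normr_ge0.
have hnl x : hn x <= `|h x| by rewrite ge_max -normrN ler_norm normr_ge0.
have fmW (W : T -> R) (f : S -> R) : measurable_fun [set: S] f -> (forall x, 0 <= f x) ->
    (forall x, f x <= `|h x|) -> measurable_fun [set: T] W ->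
    finite_mean P (fun w => h (X w) * W w) -> finite_mean P (fun w => f (X w) * W w).
  move=> mf f0 fh mW; move=> /fm_abs; apply: fm_le.
    by apply: measurable_funM => //; exact: measurableT_comp.
  by move=> w; rewrite !normrM ler_wpM2r // ger0_norm.
have e (W : T -> R) : measurable_fun [set: T] W -> finite_mean P (fun w => h (X w) * W w) ->
    Ex P (fun w => h (X w) * W w) =
    Ex P (fun w => hp (X w) * W w) - Ex P (fun w => hn (X w) * W w).
  move=> mW hW; rewrite -ExB; [|exact: fmW hW|exact: fmW hW].
  by apply: Ex_eq => w; rewrite hE mulrBl.
rewrite !e //; congr (_ - _).
  by apply: (ce_tower_ge0 hce) => //; exact: fmW.
by apply: (ce_tower_ge0 hce) => //; exact: fmW.
Qed.

(** Testing on B, the set where g' <= g: there E[(g - g') 1_B] <= 0 although the integrand is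
    nonnegative, so g = g' almost everywhere on B. *)
Lemma ce_le (Z Z' : T -> R) (g g' : S -> R) :
  is_cond_exp P X Z g -> is_cond_exp P X Z' g' -> {ae P, forall w, Z w <= Z' w} ->
  {ae Q, forall x, g x <= g' x}.
Proof.
move=> hg hg' ZZ.
have mg := ce_mg hg; have mg' := ce_mg hg'.
pose B : set S := [set x | g' x <= g x].
have mB : measurable B.
  rewrite (_ : B = [set: S] `&` (fun x => g x - g' x) @^-1` [set` `[0, +oo[]).
    by apply: measurable_funB.
  by rewrite setTI; apply/seteqP; split => x /=; rewrite in_itv /= andbT subr_ge0.
have mXB : measurable (X @^-1` B) by rewrite -[X in measurable X]setTI; exact: mX.
have fmi W : finite_mean P W -> finite_mean P (fun w => \1_B (X w) * W w).
  by move=> hW; exact: fm_indicM mXB hW.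
have mf : measurable_fun [set: S] (fun x => \1_B x * (g x - g' x)).
  by apply: measurable_funM; [exact: measurable_indic|exact: measurable_funB].
have f0 x : 0 <= \1_B x * (g x - g' x).
  rewrite indicE; case: (boolP (x \in B)) => [|_]; last by rewrite mul0r.
  by rewrite inE /B /= mul1r subr_ge0.
have hfP : finite_mean P (fun w => \1_B (X w) * (g (X w) - g' (X w))).
  by apply: fmi; apply: fmB; [exact: ce_fmg hg|exact: ce_fmg hg'].
have hf : finite_mean Q (fun x => \1_B x * (g x - g' x)) by exact/(law_fm mX law mf).
have : Ex Q (fun x => \1_B x * (g x - g' x)) = 0.
  apply/le_anti; rewrite Ex_ge0 // andbT (law_Ex mX law mf hf).
  rewrite (@Ex_eq _ _ _ _ _ (fun w => \1_B (X w) * g (X w) - \1_B (X w) * g' (X w))); last first.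
    by move=> w; rewrite mulrBr.
  rewrite ExB; [|exact/fmi/(ce_fmg hg)|exact/fmi/(ce_fmg hg')].
  rewrite -(ce_indic hg mB) -(ce_indic hg' mB) subr_le0.
  apply: ae_Ex_le; [exact/fmi/(ce_fmZ hg)|exact/fmi/(ce_fmZ hg')|].
  by apply: filterS ZZ => w; apply: ler_wpM2l; rewrite indicE.
move=> /(Ex_eq0 hf f0); apply: filterS => x.
rewrite indicE; case: (boolP (x \in B)) => [_|].
  by rewrite mul1r => /eqP; rewrite subr_eq0 => /eqP ->.
by rewrite notin_setE /B /= => /negP; rewrite -ltNge => /ltW.
Qed.

Lemma ce_unique (Z Z' : T -> R) (g g' : S -> R) :
  is_cond_exp P X Z g -> is_cond_exp P X Z' g' -> {ae P, forall w, Z w = Z' w} ->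
  {ae Q, forall x, g x = g' x}.
Proof.
move=> hg hg' ZZ.
have h1 : {ae Q, forall x, g x <= g' x}.
  by apply: ce_le hg hg' _; apply: filterS ZZ => w ->.
have h2 : {ae Q, forall x, g' x <= g x}.
  by apply: ce_le hg' hg _; apply: filterS ZZ => w ->.
by apply: filterS2 h1 h2 => x a b; apply/le_anti; rewrite a b.
Qed.

Lemma ce_lin (a : R) (Z Z' : T -> R) (g g' : S -> R) :
  is_cond_exp P X Z g -> is_cond_exp P X Z' g' ->
  is_cond_exp P X (fun w => a * Z w + Z' w) (fun x => a * g x + g' x).
Proof.
move=> hg hg'; split.
- by apply: fmD; [apply: fmZ; exact: ce_fmZ hg|exact: ce_fmZ hg'].
- apply: measurable_funD; last exact: ce_mg hg'.
  by apply: measurable_funM => //; exact: ce_mg hg.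
- by apply: fmD; [apply: fmZ; exact: ce_fmg hg|exact: ce_fmg hg'].
move=> B mB; have mXB : measurable (X @^-1` B) by rewrite -[X in measurable X]setTI; exact: mX.
have fmi W : finite_mean P W -> finite_mean P (fun w => \1_B (X w) * W w).
  by move=> hW; exact: fm_indicM mXB hW.
have e (W W' : T -> R) : finite_mean P W -> finite_mean P W' ->
    \int[P]_(w in X @^-1` B) (a * W w + W' w) =
    a * Ex P (fun w => \1_B (X w) * W w) + Ex P (fun w => \1_B (X w) * W' w).
  move=> hW hW'; rewrite Rintegral_indic -(ExZ a (fmi _ hW)) -(ExD (fmZ a (fmi _ hW)) (fmi _ hW')).
  by apply: Ex_eq => w; rewrite mulrDr mulrCA.
rewrite e; [|exact: ce_fmZ hg|exact: ce_fmZ hg'].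
rewrite [RHS]e; [|exact: ce_fmg hg|exact: ce_fmg hg'].
by rewrite (ce_indic hg mB) (ce_indic hg' mB).
Qed.

Lemma cond_expP (Z : T -> R) : finite_mean P Z -> is_cond_exp P X Z (cond_exp P X Z).
Proof.
move=> /cond_exp_exists [g hg].
by have := @xgetPex _ (fun=> 0) [set g | is_cond_exp P X Z g] (ex_intro _ g hg).
Qed.

End conditional_expectation.

Section L2_norms.
Context (R : realType) (d : measure_display) (S : measurableType d) (Q : probability S R).
Local Notation nrm := (snorm (@ipL R d S Q)).

Lemma snorm_ae0 (u : L2T Q) : nrm u = 0 <-> {ae Q, forall x, L2fun u x = 0}.
Proof.
have hip := semi_ip_L2 Q; split=> h.
  have := Ex_sqr_L2 u; rewrite h expr0n => h0.
  have := Ex_eq0 (L2_sqr (L2fun_L2 u)) (fun x => sqr_ge0 _) h0.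
  by apply: filterS => x /eqP; rewrite sqrf_eq0 => /eqP.
apply/eqP; rewrite -(sqrf_eq0 (nrm u)) -Ex_sqr_L2.
rewrite (@ae_Ex _ _ _ _ _ (fun=> 0)) ?Ex_cst //; first exact: L2_sqr (L2fun_L2 u).
by apply: filterS h => x ->; rewrite expr0n.
Qed.

Lemma snorm_ae_eq (u v : L2T Q) : {ae Q, forall x, L2fun u x = L2fun v x} -> nrm (u - v) = 0.
Proof. by move=> h; apply/snorm_ae0; apply: filterS h => x; rewrite L2funB => ->; rewrite subrr. Qed.

Lemma L2_fmM_bound (f g : S -> R) (hf : L2 Q f) (hg : L2 Q g) :
  Ex Q (fun x => `|f x * g x|) <= nrm (toL2 hf) * nrm (toL2 hg).
Proof.
have := ip_le (semi_ip_L2 Q) (toL2 (L2_abs hf)) (toL2 (L2_abs hg)).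
have na (f' : S -> R) (h' : L2 Q f') : nrm (toL2 (L2_abs h')) = nrm (toL2 h').
  apply: EFin_inj; rewrite !snorm_L2 !toL2K /L2norm.
  by rewrite -(Lnorm_abse _ (EFin \o f')).
rewrite !na; apply: le_trans; apply: le_trans (ler_norm _).
by rewrite le_eqVlt; apply/orP; left; apply/eqP; apply: Ex_eq => x; rewrite normrM.
Qed.

End L2_norms.

(** * The operator on square-integrable functions *)

Section operator.
Context (R : realType) (d1 d2 : measure_display) (Omega : measurableType d1)
  (S : measurableType d2) (P : probability Omega R) (Q : probability S R)
  (X : nat -> Omega -> S) (m : S -> S -> R).
Hypothesis mX : forall t, measurable_fun [set: Omega] (X t).
Hypothesis law : forall t B, measurable B -> P (X t @^-1` B) = Q B.
Hypothesis mm : measurable_fun [set: Omega] (fun w => m (X 0%N w) (X 1%N w)).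
Hypothesis mpos : {ae P, forall w, 0 < m (X 0%N w) (X 1%N w)}.
Hypothesis hM : Mop_bounded P Q X m.
Local Notation T := (Mop P X m).
Local Notation nrm := (snorm (@ipL R d2 S Q)).

Lemma Mop_ce psi : L2 Q psi ->
  is_cond_exp P (X 0%N) (fun w => m (X 0%N w) (X 1%N w) * psi (X 1%N w)) (T psi).
Proof. by move=> hpsi; apply: (cond_expP (mX 0%N) (@law 0%N)); exact: hM.1. Qed.

Lemma Mop_L2 psi : L2 Q psi -> L2 Q (T psi).
Proof. by move=> hpsi; have [C /(_ _ hpsi) []] := hM.2. Qed.

Lemma Mop_lin (a : R) f g : L2 Q f -> L2 Q g ->
  {ae Q, forall x, T (fun y => a * f y + g y) x = a * T f x + T g x}.
Proof.
move=> hf hg.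
apply: (ce_unique (mX 0%N) (@law 0%N) (Mop_ce (L2_lin a hf hg))
  (ce_lin (mX 0%N) a (Mop_ce hf) (Mop_ce hg))).
by apply: nearW => w; rewrite mulrDr mulrCA.
Qed.

Lemma Mop_ae f g : L2 Q f -> L2 Q g -> {ae Q, forall x, f x = g x} ->
  {ae Q, forall x, T f x = T g x}.
Proof.
move=> hf hg fg; apply: (ce_unique (mX 0%N) (@law 0%N) (Mop_ce hf) (Mop_ce hg)).
by apply: filterS (law_ae (mX 1%N) (@law 1%N) fg) => w /= ->.
Qed.

Lemma Mop0 : {ae Q, forall x, T (fun=> 0) x = 0}.
Proof.
have h := Mop_lin 1 (L2_cst Q 0) (L2_cst Q 0).
apply: filterS2 (Mop_ae (L2_lin 1 (L2_cst Q 0) (L2_cst Q 0)) (L2_cst Q 0) _) h => [x ->|].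
  by rewrite mul1r => /eqP; rewrite eq_sym -subr_eq0 addrK => /eqP.
by apply: nearW => x; rewrite mulr0 addr0.
Qed.

Definition MopH (u : L2T Q) : L2T Q := toL2 (Mop_L2 (L2fun_L2 u)).

Lemma MopH_bounded_linear : exists2 C, 0 <= C & bounded_linear (@ipL R d2 S Q) MopH C.
Proof.
have [C hC] := hM.2; exists `|C| => //; split.
  move=> a f g; apply: snorm_ae_eq; apply: filterS (Mop_lin a (L2fun_L2 f) (L2fun_L2 g)).
  by move=> x.
move=> f; have [_ ] := hC _ (L2fun_L2 f).
rewrite -(snorm_L2 f) -[X in L2norm Q X]/(L2fun (MopH f)) -snorm_L2 -EFinM lee_fin.
by move=> h; apply: le_trans h _; rewrite ler_wpM2r ?snorm_ge0 // ler_norm.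
Qed.

Context (C : R).
Hypothesis C0 : 0 <= C.
Hypothesis hC : bounded_linear (@ipL R d2 S Q) MopH C.

(** Positivity of [m] gives |m psi| = m |psi|, so the absolute value of the product can itself be
    conditioned on X_0. Cauchy-Schwarz and the boundedness of the operator at |psi| then bound its
    mean, which provides integrability before the tower identity is used. *)
Lemma Mop_pair (f psi : S -> R) (hf : L2 Q f) (hpsi : L2 Q psi) :
  let Z w := f (X 0%N w) * m (X 0%N w) (X 1%N w) * psi (X 1%N w) in
  [/\ finite_mean P Z,
      Ex P Z = ipL (toL2 hf) (MopH (toL2 hpsi)) &
      Ex P (fun w => `|Z w|) <= C * nrm (toL2 hf) * nrm (toL2 hpsi)].
Proof.
move=> Z.
have mf := L2_measurable hf; have mpsi := L2_measurable hpsi.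
have mfX : measurable_fun [set: Omega] (fun w => f (X 0%N w)) by exact: measurableT_comp.
have mpsiX : measurable_fun [set: Omega] (fun w => psi (X 1%N w)) by exact: measurableT_comp.
have hapsi := L2_abs hpsi; have haf := L2_abs hf.
have ce := Mop_ce hapsi.
pose Za w := `|m (X 0%N w) (X 1%N w) * psi (X 1%N w)|.
have ceA : is_cond_exp P (X 0%N) Za (T (fun x => `|psi x|)).
  have hZa : finite_mean P Za by exact/fm_abs/hM.1.
  have [_ cmg cfm cint] := ce; split; [exact: hZa|exact: cmg|exact: cfm|].
  move=> B mB; have mXB : measurable (X 0%N @^-1` B) by rewrite -[X in measurable X]setTI; exact: mX.
  rewrite -cint // !Rintegral_indic; apply: ae_Ex.
  - exact: fm_indicM.
  - by apply: fm_measurable; apply: fm_indicM => //; exact: ce_fmZ ce.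
  - by apply: filterS mpos => w m0; rewrite /Za normrM gtr0_norm.
have g0 : {ae Q, forall x, 0 <= T (fun x => `|psi x|) x}.
  have ce0 : is_cond_exp P (X 0%N) (fun=> 0) (fun=> 0).
    by split => //; exact: fm_cst.
  apply: (ce_le (mX 0%N) (@law 0%N) ce0 ceA).
  by apply: nearW => w; exact: normr_ge0.
have hgL2 := Mop_L2 hapsi.
have mgf : measurable_fun [set: S] (fun x => `|f x| * T (fun y => `|psi y|) x).
  by apply: measurable_funM; [exact: (L2_measurable haf)|exact: (L2_measurable hgL2)].
have hfg : finite_mean P (fun w => `|f (X 0%N w)| * T (fun y => `|psi y|) (X 0%N w)).
  exact/(law_fm (mX 0%N) (@law 0%N) mgf)/(L2_fmM haf hgL2).
have hfZa : finite_mean P (fun w => `|f (X 0%N w)| * Za w).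
  apply: (ce_fm_ge0 (mX 0%N) ceA (h := fun x => `|f x|)) => //.
  - exact: (L2_measurable haf).
  - by move=> w; exact: normr_ge0.
  - by have h := law_ae (mX 0%N) (@law 0%N) g0; exact: h.
have mZ : measurable_fun [set: Omega] Z by apply: measurable_funM => //; apply: measurable_funM.
have ZE w : `|Z w| = `|f (X 0%N w)| * Za w by rewrite /Z /Za -mulrA normrM.
have hZ : finite_mean P Z.
  by apply: fm_le mZ _ hfZa => w; rewrite ZE.
split=> //.
  have mTf : measurable_fun [set: S] (fun x => f x * T psi x).
    by apply: measurable_funM => //; exact/L2_measurable/Mop_L2.
  have hfT : finite_mean P (fun w => f (X 0%N w) * T psi (X 0%N w)).
    exact/(law_fm (mX 0%N) (@law 0%N) mTf)/(L2_fmM hf (Mop_L2 hpsi)).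
  rewrite /ipL /inner -[RHS]/(Ex Q (fun x => f x * T psi x)).
  rewrite (law_Ex (mX 0%N) (@law 0%N) mTf (L2_fmM hf (Mop_L2 hpsi))).
  rewrite -(ce_tower (mX 0%N) (Mop_ce hpsi) mf _ hfT).
    by apply: Ex_eq => w; rewrite /Z mulrA.
  by apply: fm_eq hZ => w; rewrite /Z mulrA.
rewrite (Ex_eq _ ZE) (ce_tower (mX 0%N) ceA (h := fun x => `|f x|)) //; last exact: (L2_measurable haf).
rewrite -(law_Ex (mX 0%N) (@law 0%N) mgf (L2_fmM haf hgL2)).
have na (f' : S -> R) (h' : L2 Q f') (h'' : L2 Q (fun x => `|f' x|)) :
    nrm (toL2 h'') = nrm (toL2 h').
  apply: EFin_inj; rewrite !snorm_L2 !toL2K /L2norm.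
  by rewrite -(Lnorm_abse _ (EFin \o f')).
have := ip_le (semi_ip_L2 Q) (toL2 haf) (MopH (toL2 hapsi)).
have := ler_wpM2l (snorm_ge0 (@ipL R d2 S Q) (toL2 haf)) (op_bounded hC (toL2 hapsi)).
rewrite (na _ hf haf) (na _ hpsi hapsi) => h1 h2; apply: le_trans (le_trans (ler_norm _) h2) _.
by apply: le_trans h1 _; rewrite mulrCA mulrA.
Qed.

(** Both sides equal E[phis(X_0) m(X_0, X_1) u(X_1)], conditioned on X_0 for one and on X_1 for the
    other. *)
Lemma Mop_adjoint (rho : R) (phis : S -> R) (hphis : L2 Q phis) :
  {ae Q, forall x, Mop_adj P X m phis x = rho * phis x} ->
  forall u : L2T Q, ipL (MopH u) (toL2 hphis) = rho * ipL u (toL2 hphis).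
Proof.
move=> hadj u; have hip := semi_ip_L2 Q.
have hu := L2fun_L2 u; set psi := L2fun u in hu.
have eu : {ae Q, forall x, L2fun (toL2 hu) x = L2fun u x} by exact: nearW.
have [hZ EZ _] := Mop_pair hphis hu.
(* Pairing with the constant 1 gives the integrability of m phis(X_0) needed to condition on X_1. *)
have [hZ1 _ _] := Mop_pair hphis (L2_cst Q 1).
have h1 : finite_mean P (fun w => m (X 0%N w) (X 1%N w) * phis (X 0%N w)).
  by apply: fm_eq hZ1 => w; rewrite mulr1 mulrC.
have ce := cond_expP (mX 1%N) (@law 1%N) h1.
have adjL2 : L2 Q (Mop_adj P X m phis).
  apply: (L2_ae (L2Z rho hphis)); first exact: ce_mg ce.
  by apply: filterS hadj => x ->.
have mpsi := L2_measurable hu.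
have mpa : measurable_fun [set: S] (fun x => psi x * Mop_adj P X m phis x).
  by apply: measurable_funM => //; exact: (L2_measurable adjL2).
have hpa := L2_fmM hu adjL2.
have hpaP : finite_mean P (fun w => psi (X 1%N w) * Mop_adj P X m phis (X 1%N w)).
  exact/(law_fm (mX 1%N) (@law 1%N) mpa).
have e1 : Ex P (fun w => phis (X 0%N w) * m (X 0%N w) (X 1%N w) * psi (X 1%N w)) =
    Ex Q (fun x => psi x * Mop_adj P X m phis x).
  rewrite (law_Ex (mX 1%N) (@law 1%N) mpa hpa) -(ce_tower (mX 1%N) ce mpsi _ hpaP).
    by apply: Ex_eq => w; rewrite mulrC (mulrC (m _ _)).
  by apply: fm_eq hZ => w; rewrite mulrC (mulrC (m _ _)).
have eZ : ipL (MopH u) (toL2 hphis) = Ex P (fun w => phis (X 0%N w) * m (X 0%N w) (X 1%N w) * psi (X 1%N w)).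
  by rewrite (ipC hip); exact: esym EZ.
rewrite eZ e1.
rewrite (@ae_Ex _ _ _ _ _ (fun x => rho * (psi x * phis x)) hpa).
- by rewrite ExZ //; exact: L2_fmM.
- by apply: measurable_funM => //; apply: measurable_funM => //; exact: (L2_measurable hphis).
- by apply: filterS hadj => x ->; rewrite mulrCA.
Qed.

End operator.

(** * Orthonormalized sieve matrices *)

(** Lets an expansion proved for the orthonormalized matrices apply to [rhohat], which is defined
    from the raw ones. *)
Lemma gen_eigenvalue_congr (R : realType) k (M G S : 'M[R]_k) (r : R) : S \in unitmx ->
  gen_eigenvalue (S *m M *m S) (S *m G *m S) r <-> gen_eigenvalue M G r.
Proof.
move=> uS; split=> [[v v0 hv]|[v v0 hv]].
  exists (S *m v).
    by apply: contra v0 => /eqP h; rewrite -(mulKmx uS v) h mulmx0.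
  rewrite -[LHS](mulKmx uS) -[RHS](mulKmx uS); congr (invmx S *m _).
  by rewrite -scalemxAr !mulmxA.
exists (invmx S *m v).
  by apply: contra v0 => /eqP h; rewrite -(mulKVmx uS v) h mulmx0.
by rewrite -!mulmxA !(mulKVmx uS) hv -scalemxAr.
Qed.

Lemma largest_gen_eigenvalue_congr (R : realType) k (M G S : 'M[R]_k) (r : R) : S \in unitmx ->
  largest_gen_eigenvalue (S *m M *m S) (S *m G *m S) r -> largest_gen_eigenvalue M G r.
Proof.
move=> uS [h1 h2]; split; first exact: (gen_eigenvalue_congr M G r uS).1 h1.
by move=> r' hr'; apply: h2; exact: (gen_eigenvalue_congr M G r' uS).2 hr'.
Qed.

(** * Euclidean and operator norms of matrices *)

Lemma enorm_ge0 (R : realType) m n (A : 'M[R]_(m, n)) : 0 <= enorm A.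
Proof. exact: sqrtr_ge0. Qed.

Lemma enormZ (R : realType) m n (a : R) (A : 'M[R]_(m, n)) : enorm (a *: A) = `|a| * enorm A.
Proof.
rewrite /enorm -sqrtr_sqr -sqrtrM ?sqr_ge0 //; congr Num.sqrt.
rewrite mulr_sumr; apply: eq_bigr => i _; rewrite mulr_sumr; apply: eq_bigr => j _.
by rewrite mxE exprMn.
Qed.

Lemma enorm_eq0 (R : realType) m n (A : 'M[R]_(m, n)) : enorm A = 0 -> A = 0.
Proof.
move=> /eqP; rewrite sqrtr_eq0 => h.
have hs : \sum_i \sum_j A i j ^+ 2 = 0.
  by apply/le_anti; rewrite h; apply: sumr_ge0 => i _; apply: sumr_ge0 => j _; exact: sqr_ge0.
apply/matrixP => i j; rewrite mxE; apply/eqP; rewrite -sqrf_eq0; apply/eqP.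
have hi := psumr_eq0P (fun i _ => sumr_ge0 _ (fun j _ => sqr_ge0 (A i j))) hs.
exact: (psumr_eq0P (fun j _ => sqr_ge0 (A i j)) (hi i isT)).
Qed.

Lemma abs_le_enorm (R : realType) m n (A : 'M[R]_(m, n)) i j : `|A i j| <= enorm A.
Proof.
rewrite -sqrtr_sqr ler_sqrt.
  rewrite (bigD1 i) //= (bigD1 j) //= -addrA lerDl addr_ge0 //.
    by apply: sumr_ge0 => ? _; exact: sqr_ge0.
  by apply: sumr_ge0 => ? _; apply: sumr_ge0 => ? _; exact: sqr_ge0.
by apply: sumr_ge0 => ? _; apply: sumr_ge0 => ? _; exact: sqr_ge0.
Qed.

Lemma enorm_le_sum (R : realType) m n (A : 'M[R]_(m, n)) : enorm A <= \sum_i \sum_j `|A i j|.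
Proof.
have s0 : 0 <= \sum_i \sum_j `|A i j| by apply: sumr_ge0 => ? _; apply: sumr_ge0.
rewrite -[leRHS]ger0_norm // -sqrtr_sqr ler_wsqrtr //.
have sq (I : finType) (f : I -> R) : (forall i, 0 <= f i) -> \sum_i f i ^+ 2 <= (\sum_i f i) ^+ 2.
  move=> f0; rewrite expr2 mulr_suml; apply: ler_sum => i _; rewrite expr2 ler_wpM2l //.
  by rewrite (bigD1 i) //= lerDl sumr_ge0.
apply: le_trans (sq _ _ _) => [|i]; last exact: sumr_ge0.
apply: ler_sum => i _; apply: le_trans (sq _ _ _) => [|//].
by apply: ler_sum => j _; rewrite real_normK ?num_real.
Qed.

(** The set under [sup] has to be shown bounded for the supremum to be meaningful; the sum of the
    absolute values of the entries is a bound. *)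
Lemma mx_opnorm_le (R : realType) m n (A : 'M[R]_(m, n)) (v : 'cV[R]_n) :
  enorm (A *m v) <= mx_opnorm A * enorm v.
Proof.
have ub (w : 'cV[R]_n) : enorm w <= 1 -> enorm (A *m w) <= mx_opnorm A.
  move=> w1; apply: ub_le_sup; last by exists w.
  exists (\sum_i \sum_(j < 1) \sum_l `|A i l|) => _ [z z1 <-].
  apply: le_trans (enorm_le_sum _) _; apply: ler_sum => i _; apply: ler_sum => j _.
  rewrite mxE (le_trans (ler_norm_sum _ _ _)) //; apply: ler_sum => l _.
  by rewrite normrM ler_piMr // (le_trans (abs_le_enorm z l j)).
have [v0|v0] := eqVneq (enorm v) 0.
  rewrite v0 mulr0 (enorm_eq0 v0) mulmx0 /enorm big1 ?sqrtr0 // => i _.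
  by rewrite big1 // => j _; rewrite mxE expr0n.
have vp : 0 < enorm v by rewrite lt_neqAle eq_sym v0 enorm_ge0.
have := ub ((enorm v)^-1 *: v).
rewrite enormZ ger0_norm ?invr_ge0 ?enorm_ge0 // mulVf // => /(_ (lexx _)).
rewrite -scalemxAr enormZ ger0_norm ?invr_ge0 ?enorm_ge0 //.
by rewrite mulrC ler_pdivrMr.
Qed.

Lemma enorm_delta (R : realType) n : enorm (delta_mx 0 0 : 'cV[R]_n.+1) = 1.
Proof.
rewrite /enorm -[RHS]sqrtr1; congr Num.sqrt.
rewrite (eq_bigr (fun i => (i == 0)%:R)).
  by rewrite (bigD1 0) //= big1 ?addr0 // => i /negbTE ->.
by move=> i _; rewrite big_ord1 mxE eqxx andbT; case: (i == 0); rewrite ?expr1n ?expr0n.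
Qed.

Lemma mx_opnorm_ge0 (R : realType) m n (A : 'M[R]_(m, n.+1)) : 0 <= mx_opnorm A.
Proof.
have := mx_opnorm_le A (delta_mx 0 0).
by rewrite enorm_delta mulr1; apply: le_trans; exact: enorm_ge0.
Qed.

(** If [inv_sqrtm] took its default value 0, the orthonormalized Gram matrix would be 0; its
    distance to the identity would then be at least 1, against consistency. *)
Lemma mx_opnorm_N1 (R : realType) n : 1 <= mx_opnorm (0 - 1%:M : 'M[R]_n.+1).
Proof.
have := mx_opnorm_le (0 - 1%:M : 'M[R]_n.+1) (delta_mx 0 0).
by rewrite sub0r mulNmx mul1mx -scaleN1r enormZ normrN1 mul1r enorm_delta mulr1.
Qed.

(** * The orthonormalized sieve basis *)

Section sieve.
Context (R : realType) (d2 : measure_display)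
  (S : measurableType d2) (Q : probability S R) (k : nat) (b : 'I_k -> S -> R).
Hypothesis hb : forall i, L2 Q (b i).
Hypothesis hind : lin_indep Q b.
Local Notation ipQ := (@ipL R d2 S Q).
Local Notation nrm := (snorm ipQ).
Let hip := semi_ip_L2 Q.

Definition bH (i : 'I_k) : L2T Q := toL2 (hb i).

Definition gram : 'M[R]_k := \matrix_(i, j) ipQ (bH i) (bH j).

Lemma L2fun_lincomb n (f : 'I_n -> L2T Q) (v : 'cV[R]_n) x :
  L2fun (lincomb f v) x = \sum_i v i 0 * L2fun (f i) x.
Proof.
rewrite /lincomb; apply: (big_rec2 (fun (u : L2T Q) y => L2fun u x = y)) => // i y u _ <-.
by [].
Qed.

Lemma ip_lincomb_gram (v w : 'cV[R]_k) :
  ipQ (lincomb bH v) (lincomb bH w) = dotc v (gram *m w).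
Proof.
rewrite (ip_lincomb hip); apply: eq_bigr => i _; congr (_ * _).
rewrite !mxE (ipC hip) (ip_sumr hip); apply: eq_bigr => j _.
by rewrite (ipZr hip) mxE mulrC.
Qed.

Lemma gram_unit : gram \in unitmx.
Proof.
rewrite unitmxE unitfE -det_tr; apply/det0P => -[v v0 hv].
have hv' : gram *m v^T = 0 by rewrite -[LHS]trmxK trmx_mul trmxK hv trmx0.
have n0 : nrm (lincomb bH v^T) = 0.
  by rewrite /snorm ip_lincomb_gram hv' /dotc big1 ?sqrtr0 // => i _; rewrite [X in _ * X]mxE mulr0.
have h : {ae Q, forall x, \sum_i v 0 i * b i x = 0}.
  have := (snorm_ae0 (lincomb bH v^T)).1 n0; apply: filterS => x.
  rewrite L2fun_lincomb => e0; rewrite -[RHS]e0; apply: eq_bigr => i _; by rewrite mxE.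
move/negP: v0; apply; apply/eqP/rowP => i; rewrite mxE.
exact: (hind h i).
Qed.

Context (s : 'M[R]_k).
Hypothesis sT : s^T = s.
Hypothesis ss : s *m s = invmx gram.

Lemma sgs : s *m gram *m s = 1%:M.
Proof.
have h : s *m (s *m gram) = 1%:M by rewrite mulmxA ss mulVmx ?gram_unit.
exact: mulmx1C h.
Qed.

Lemma s_unit : s \in unitmx.
Proof. by have /mulmx1_unit [] := sgs; rewrite unitmx_mul => /andP[]. Qed.

(** The columns of G^{-1/2} orthonormalize the sieve, so multiplying a sieve matrix by G^{-1/2} on
    both sides expresses it in this basis. *)
Definition ortho_basis (i : 'I_k) : L2T Q := lincomb bH (col i s).

Lemma lincomb_ortho_basis v : lincomb ortho_basis v = lincomb bH (s *m v).
Proof.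
rewrite /lincomb (eq_bigr (fun i => \sum_j (s j i * v i 0) *: bH j)); last first.
  move=> i _; rewrite /ortho_basis /lincomb scaler_sumr; apply: eq_bigr => j _.
  by rewrite scalerA mxE mulrC.
by rewrite exchange_big; apply: eq_bigr => j _; rewrite mxE scaler_suml.
Qed.

Lemma ortho_basisP : orthonormal_family ipQ ortho_basis.
Proof.
move=> i j; rewrite ip_lincomb_gram.
transitivity ((s *m gram *m s) i j); last by rewrite sgs mxE.
rewrite -mulmxA mxE; apply: eq_bigr => l _.
have sE p q : s p q = s q p by rewrite -{1}sT mxE.
congr (_ * _); first by rewrite mxE sE.
by rewrite !mxE; apply: eq_bigr => q _; rewrite [X in _ * X]mxE.
Qed.

(** The value of [orth_proj] is some element of the span with orthogonal residual. Two such elements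
    differ by a null function, so the distances to [f] agree even though the functions need not. *)
Lemma orth_proj_dist (f : L2T Q) :
  L2norm Q (orth_proj Q b (L2fun f) \- L2fun f) =
  (nrm (f - lincomb ortho_basis (coords ipQ ortho_basis f)))%:E.
Proof.
pose p := lincomb ortho_basis (coords ipQ ortho_basis f).
have spanE g : in_span b g <-> exists v, g = L2fun (lincomb bH v).
  split=> [[c ->]|[v ->]].
    exists (\col_i c i); apply/funext => x; rewrite L2fun_lincomb.
    by apply: eq_bigr => i _; rewrite mxE.
  by exists (fun i => v i 0); apply/funext => x; rewrite L2fun_lincomb.
have spanE' g : in_span b g -> exists v, g = L2fun (lincomb ortho_basis v).
  move=> /spanE [v ->]; exists (invmx s *m v).
  by rewrite lincomb_ortho_basis mulKVmx ?s_unit.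
have ex : [set g | in_span b g /\ forall h, in_span b h -> inner Q (L2fun f \- g) h = 0] (L2fun p).
  split; first by apply/spanE; exists (s *m coords ipQ ortho_basis f); rewrite -lincomb_ortho_basis.
  move=> h /spanE' [v ->]; rewrite -[LHS]/(ipQ (f - p) (lincomb ortho_basis v)).
  by rewrite (ipBl hip) (ip_proj hip ortho_basisP) subrr.
have := @xgetPex _ (fun=> 0) _ (ex_intro _ _ ex).
rewrite -/(orth_proj Q b (L2fun f)); set g := orth_proj _ _ _ => -[/spanE' [v gv] gorth].
have pv : nrm (lincomb ortho_basis v - p) = 0.
  apply/eqP; rewrite -sqrf_eq0 (sqr_snorm hip) -(lincombB ortho_basis).
  have h w : ipQ (f - lincomb ortho_basis v) (lincomb ortho_basis w) = 0.
    rewrite -[LHS]/(inner Q (L2fun f \- L2fun (lincomb ortho_basis v)) (L2fun (lincomb ortho_basis w))).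
    by rewrite -gv; apply: gorth; apply/spanE; exists (s *m w); rewrite -lincomb_ortho_basis.
  set w := v - _; have := h w; rewrite (ipBl hip) -(ip_proj hip ortho_basisP) -(ipBl hip).
  rewrite -(lincombB ortho_basis) -opprB -/w => /eqP.
  by rewrite -scaleN1r (lincombZ ortho_basis) (ipZl hip) mulN1r oppr_eq0.
rewrite gv -[X in L2norm Q X]/(L2fun (lincomb ortho_basis v - f)) -snorm_L2; congr EFin.
rewrite (snorm_distC hip); apply/le_anti/andP; split.
  by apply: le_trans (snorm_distD hip p _ _) _; rewrite (snorm_distC hip p) pv addr0.
by apply: le_trans (snorm_distD hip (lincomb ortho_basis v) _ _) _; rewrite pv addr0.
Qed.

End sieve.

(** An operator norm controls the unit ball only. Homogeneity of [T] holds up to null vectors, which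
    the projection respects, and a null [u] is treated apart because it cannot be normalized. *)
Lemma proj_residual_scale (R : realType) (H : lmodType R) (ip : H -> H -> R) (T : H -> H)
    (C : R) k (e : 'I_k -> H) (eps : R) :
  semi_ip ip -> bounded_linear ip T C -> orthonormal_family ip e ->
  (forall w, snorm ip w <= 1 -> snorm ip (T w - lincomb e (coords ip e (T w))) <= eps) ->
  forall u, snorm ip (T u - lincomb e (coords ip e (T u))) <= eps * snorm ip u.
Proof.
move=> hip hC oe key u.
have dist w w' : snorm ip (w - w') = 0 ->
    snorm ip (w - lincomb e (coords ip e w)) = snorm ip (w' - lincomb e (coords ip e w')).
  move=> ww; apply: (snorm_eq0_dist hip).
  rewrite (_ : _ - _ = (w - w') - lincomb e (coords ip e (w - w'))); last first.
    rewrite (coordsB hip) (lincombB e) !opprB addrACA [RHS]addrACA; congr (_ + _).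
    by rewrite addrC.
  apply/eqP; rewrite eq_le snorm_ge0 andbT (le_trans (snormB hip _ _)) // ww.
  by rewrite add0r (le_trans (snorm_proj hip oe _)) // ww.
have [u0|u0] := eqVneq (snorm ip u) 0.
  rewrite u0 mulr0; have := snorm_proj hip oe (T u).
  have T0 : snorm ip (T u) <= 0 by rewrite -(mulr0 C) -u0; exact: (op_bounded hC).
  by have := snormB hip (T u) (lincomb e (coords ip e (T u))); lra.
have up : 0 < snorm ip u by rewrite lt_neqAle eq_sym u0 snorm_ge0.
have := key ((snorm ip u)^-1 *: u).
rewrite (snormZ hip) ger0_norm ?invr_ge0 ?(ltW up) // mulVf // => /(_ (lexx _)).
rewrite (dist _ _ (snorm_opZ hip hC (snorm ip u)^-1 u)).
rewrite (coordsZ hip) (lincombZ e) -scalerBr (snormZ hip) ger0_norm ?invr_ge0 ?(ltW up) //.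
by rewrite mulrC ler_pdivrMr.
Qed.

(** * Sample matrices as bilinear forms *)

Section sample_matrices.
Context (R : realType) (d2 : measure_display)
  (S : measurableType d2) (Q : probability S R) (k : nat) (b : 'I_k -> S -> R).
Hypothesis hb : forall i, L2 Q (b i).
Context (s : 'M[R]_k).
Hypothesis sT : s^T = s.
Local Notation ob := (ortho_basis hb s).

Lemma L2fun_ortho_basis (v : 'cV[R]_k) x :
  L2fun (lincomb ob v) x = dotc v (s *m \col_i b i x).
Proof.
rewrite lincomb_ortho_basis L2fun_lincomb.
have sE p q : s p q = s q p by rewrite -{1}sT mxE.
rewrite (eq_bigr (fun i => \sum_j s i j * v j 0 * b i x)); last first.
  by move=> i _; rewrite mxE mulr_suml.
rewrite exchange_big; apply: eq_bigr => j _; rewrite [X in _ * X]mxE mulr_sumr.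
by apply: eq_bigr => i _; rewrite [X in _ * (_ * X)]mxE sE mulrCA mulrA.
Qed.

(** Every summand of the sample matrices is a multiple of some y z^T. Its bilinear form factors into
    values of two sieve functions, so the whole form is a sample average. *)
Lemma dotc_rank1 (u v y z : 'cV[R]_k) : dotc u ((s *m (y *m z^T) *m s) *m v) =
  dotc u (s *m y) * dotc v (s *m z).
Proof.
have -> : s *m (y *m z^T) *m s *m v = (s *m y) *m ((s *m z)^T *m v).
  by rewrite trmx_mul sT !mulmxA.
rewrite [(_^T *m v)]mx11_scalar mul_mx_scalar /dotc.
have -> : ((s *m z)^T *m v) 0 0 = \sum_i v i 0 * (s *m z) i 0.
  by rewrite mxE; apply: eq_bigr => i _; rewrite mulrC mxE.
rewrite mulr_suml; apply: eq_bigr => i _.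
by rewrite [X in _ * X]mxE mulrCA mulrC.
Qed.

Lemma dotc_sum_mx n (c : R) (A : 'I_n -> 'M[R]_k) (u v : 'cV[R]_k) :
  dotc u ((s *m (c *: \sum_t A t) *m s) *m v) = c * \sum_t dotc u ((s *m A t *m s) *m v).
Proof.
rewrite -scalemxAr -!scalemxAl mulmx_sumr !mulmx_suml /dotc mulr_sumr.
rewrite (eq_bigr (fun i => \sum_t c * (u i 0 * (s *m A t *m s *m v) i 0))); last first.
  by move=> i _; rewrite !mxE summxE !mulr_sumr; apply: eq_bigr => t _; rewrite mulrCA.
by rewrite exchange_big; apply: eq_bigr => t _; rewrite mulr_sumr.
Qed.

Lemma dotc_Ghat (x : nat -> S) n (u v : 'cV[R]_k) :
  dotc u ((s *m Ghat b x n *m s) *m v) =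
  n%:R^-1 * \sum_(t < n) L2fun (lincomb ob u) (x t) * L2fun (lincomb ob v) (x t).
Proof.
rewrite /Ghat dotc_sum_mx; congr (_ * _); apply: eq_bigr => t _.
rewrite !L2fun_ortho_basis -dotc_rank1; congr (dotc _ (_ *m _ *m _ *m _)).
by apply/matrixP => i j; rewrite !mxE big_ord1 !mxE.
Qed.

Lemma dotc_Mhat (m : S -> S -> R) (x : nat -> S) n (u v : 'cV[R]_k) :
  dotc u ((s *m Mhat m b x n *m s) *m v) =
  n%:R^-1 * \sum_(t < n) L2fun (lincomb ob u) (x t) * m (x t) (x t.+1) *
    L2fun (lincomb ob v) (x t.+1).
Proof.
rewrite /Mhat dotc_sum_mx; congr (_ * _); apply: eq_bigr => t _.
have dZ (c : R) (w : 'cV[R]_k) : dotc u (c *: w) = c * dotc u w.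
  by rewrite /dotc mulr_sumr; apply: eq_bigr => i _; rewrite mxE mulrCA.
rewrite !L2fun_ortho_basis mulrAC -dotc_rank1 mulrC -dZ; congr dotc.
set y := \col_i b i (x t); set z := \col_i b i (x t.+1).
rewrite (_ : \matrix_(i, j) _ = m (x t) (x t.+1) *: (y *m z^T)).
  by rewrite -scalemxAr -!scalemxAl.
by apply/matrixP => i j; rewrite !mxE big_ord1 !mxE; ring.
Qed.

End sample_matrices.

Section operator_sieve.
Context (R : realType) (d1 d2 : measure_display) (Omega : measurableType d1)
  (S : measurableType d2) (P : probability Omega R) (Q : probability S R)
  (X : nat -> Omega -> S) (m : S -> S -> R).
Hypothesis mX : forall t, measurable_fun [set: Omega] (X t).
Hypothesis law : forall t B, measurable B -> P (X t @^-1` B) = Q B.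
Hypothesis mm : measurable_fun [set: Omega] (fun w => m (X 0%N w) (X 1%N w)).
Hypothesis mpos : {ae P, forall w, 0 < m (X 0%N w) (X 1%N w)}.
Hypothesis hM : Mop_bounded P Q X m.
Local Notation T := (Mop P X m).
Local Notation ipQ := (@ipL R d2 S Q).
Local Notation nrm := (snorm ipQ).
Local Notation TH := (MopH hM).
Let hip := semi_ip_L2 Q.
Context (C : R).
Hypothesis C0 : 0 <= C.
Hypothesis hC : bounded_linear ipQ TH C.
Context (k : nat) (b : 'I_k -> S -> R).
Hypothesis hb : forall i, L2 Q (b i).

Lemma Gmat_gram : Gmat P X b = gram hb.
Proof.
apply/matrixP => i j; rewrite !mxE /ipL /inner.
rewrite -[RHS]/(Ex Q (fun x => b i x * b j x)) (law_Ex (mX 0%N) (@law 0%N)) //.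
- by apply: measurable_funM; [exact: L2_measurable (hb i)|exact: L2_measurable (hb j)].
- exact: L2_fmM.
Qed.

Context (s : 'M[R]_k).
Hypothesis sT : s^T = s.
Local Notation ob := (ortho_basis hb s).

Lemma Mmat_compression : s *m Mmat P X m b *m s = compression ipQ TH ob.
Proof.
have ME i j : Mmat P X m b i j = ipQ (bH hb i) (TH (bH hb j)).
  by rewrite mxE; have [_ -> _] := Mop_pair mX law mm mpos hC (hb i) (hb j).
have sE p q : s p q = s q p by rewrite -{1}sT mxE.
apply/matrixP => i j; rewrite [RHS]mxE /ortho_basis (ipC hip) (ip_op_lincomb hip _ hC).
rewrite mxE; apply: eq_bigr => l _; rewrite [in RHS]mulrC [in RHS]mxE; congr (_ * _).
rewrite (ipC hip) (ip_suml hip) mxE; apply: eq_bigr => q _.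
by rewrite (ipZl hip) ME [in RHS]mxE sE.
Qed.

Hypothesis hind : lin_indep Q b.
Hypothesis ss : s *m s = invmx (gram hb).

Lemma proj_op_norm (eps : R) : 0 <= eps ->
  (op_norm Q (fun psi => orth_proj Q b (T psi) \- T psi)%R <= eps%:E)%E ->
  forall u, nrm (TH u - lincomb ob (coords ipQ ob (TH u))) <= eps * nrm u.
Proof.
move=> eps0 hop u.
have oe := ortho_basisP hind sT ss.
have key w : nrm w <= 1 -> nrm (TH w - lincomb ob (coords ipQ ob (TH w))) <= eps.
  move=> w1; rewrite -lee_fin -(orth_proj_dist hind sT ss); apply: le_trans hop.
  apply: ereal_sup_ubound; exists (L2fun w) => //; split; first exact: L2fun_L2.
  by rewrite -snorm_L2 lee_fin.
exact: proj_residual_scale hip hC oe key u.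
Qed.

End operator_sieve.

(** * Eigenvalues of the complexified operator *)

Section spectrum.
Context (R : realType) (d1 d2 : measure_display) (Omega : measurableType d1)
  (S : measurableType d2) (P : probability Omega R) (Q : probability S R)
  (X : nat -> Omega -> S) (m : S -> S -> R).
Hypothesis mX : forall t, measurable_fun [set: Omega] (X t).
Hypothesis law : forall t B, measurable B -> P (X t @^-1` B) = Q B.
Hypothesis hM : Mop_bounded P Q X m.
Local Notation T := (Mop P X m).
Local Notation ipQ := (@ipL R d2 S Q).
Local Notation nrm := (snorm ipQ).
Local Notation TH := (MopH hM).

Lemma ae_eigen (l : R) (u : L2T Q) : nrm (TH u - l *: u) = 0 ->
  {ae Q, forall x, T (L2fun u) x = l * L2fun u x}.
Proof.
move=> /snorm_ae0; apply: filterS => x.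
by rewrite L2funB L2funZ => /eqP; rewrite subr_eq0 => /eqP.
Qed.

(** The imaginary part of the complexified image is the operator applied to 0, which vanishes only
    almost everywhere. *)
Lemma eigenfunction_real (l : R) (f : S -> R) : L2 Q f ->
  ~ {ae Q, forall x, f x = 0} -> {ae Q, forall x, T f x = l * f x} ->
  eigenfunction Q T (Complex l 0) (fun x => Complex (f x) 0).
Proof.
move=> hf f0 hl; split.
- by split=> //=; exact: L2_cst.
- by move=> h; apply: f0; apply: filterS h => x [].
apply: filterS2 hl (Mop0 mX law hM) => x h1 h2.
rewrite /complexify /= h1 h2 /GRing.mul /=.
by rewrite !mulr0 mul0r subr0 addr0.
Qed.

(** At the right-hand side 0, the uniqueness clause of the resolvent would identify an eigenfunction
    with 0. *)
Lemma eigenvalue_spectrum (l : R[i]) : Defs.eigenvalue Q T l -> spectrum Q T l.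
Proof.
move=> [h [hL h0 he]] [C /(_ (fun=> 0))].
have L0 : L2C Q (fun=> (0 : R[i])) by split; exact: L2_cst.
move=> /(_ L0) [g [_ _ _ gu]]; apply: h0.
have e1 : {ae Q, forall x, h x = g x}.
  by apply: gu hL _; apply: filterS he => x ->; rewrite subrr.
have e2 : {ae Q, forall x, (0 : R[i]) = g x}.
  apply: gu L0 _; apply: filterS (Mop0 mX law hM) => x hx.
  by rewrite mulr0 subr0 /complexify /= hx.
by apply: filterS2 e1 e2 => x -> <-.
Qed.

Lemma normc_real (x : R) : ComplexField.Normc.normc (Complex x 0) = `|x|.
Proof. by rewrite /= expr0n addr0 sqrtr_sqr. Qed.

(** Maximality of [rho] gives l <= rho, so [l] lies in the spectrum at distance less than [e] from
    [rho], and isolation identifies the two. *)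
Lemma no_other_top_eigenvalue (rho e : R) : 0 < e -> e < rho ->
  largest_eigenvalue Q T rho ->
  (forall z, spectrum Q T z -> ComplexField.Normc.normc (z - Complex rho 0) < e ->
     z = Complex rho 0) ->
  forall (l : R) u, rho - e / 2 <= l -> nrm u != 0 -> nrm (TH u - l *: u) = 0 -> l = rho.
Proof.
move=> e0 erho [_ hlarge] hiso l u hl u0 hu.
have eig : Defs.eigenvalue Q T (Complex l 0).
  exists (fun x => Complex (L2fun u x) 0); apply: eigenfunction_real.
  - exact: L2fun_L2.
  - by move=> h; move/negP: u0; apply; apply/eqP/snorm_ae0.
  - exact: ae_eigen.
have := hlarge _ eig; rewrite normc_real => h1.
have h2 : l <= rho := le_trans (ler_norm _) h1.
have : Complex l 0 = Complex rho 0.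
  apply: hiso; first exact: eigenvalue_spectrum.
  rewrite (_ : Complex l 0 - Complex rho 0 = Complex (l - rho) 0); last first.
    by rewrite /GRing.add /GRing.opp /= subr0.
  by rewrite normc_real ler0_norm ?subr_le0 //; lra.
by case.
Qed.

Lemma simple_real (rho : R) (phi u : L2T Q) : simple_eigenvalue Q T (Complex rho 0) ->
  nrm phi = 1 -> nrm (TH phi - rho *: phi) = 0 -> nrm (TH u - rho *: u) = 0 ->
  exists c, nrm (u - c *: phi) = 0.
Proof.
move=> [_ hs] phi1 hphi hu.
have [u0|u0] := eqVneq (nrm u) 0; first by exists 0; rewrite scale0r subr0.
have ef v : nrm v != 0 -> nrm (TH v - rho *: v) = 0 ->
    eigenfunction Q T (Complex rho 0) (fun x => Complex (L2fun v x) 0).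
  move=> v0 hv; apply: eigenfunction_real.
  - exact: L2fun_L2.
  - by move=> h; move/negP: v0; apply; apply/eqP/snorm_ae0.
  - exact: ae_eigen.
have [|c hc] := hs _ _ (ef phi _ hphi) (ef u u0 hu); first by rewrite phi1 oner_neq0.
exists (complex.Re c); apply/snorm_ae0; apply: filterS hc => x.
case: c => a b hx; have e : L2fun u x = a * L2fun phi x - b * 0 by case: hx.
by rewrite L2funB L2funZ e mulr0 subr0 subrr.
Qed.

End spectrum.

(** * Mean ergodic theorem *)

Section ergodic_theorem.
Context (R : realType) (d : measure_display) (T : measurableType d) (P : probability T R)
  (theta : T -> T).
Hypothesis mtheta : measurable_fun [set: T] theta.
Hypothesis inv : forall B, measurable B -> P (theta @^-1` B) = P B.
Hypothesis erg : forall A, measurable A -> theta @^-1` A = A -> P A = 0%E \/ P A = 1%E.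
Implicit Types f : T -> R.

Fixpoint birkhoff_sum f (n : nat) (x : T) : R :=
  if n is n'.+1 then f x + birkhoff_sum f n' (theta x) else 0.

(* the maximum of 0 and the first n Birkhoff sums *)
Fixpoint birkhoff_max f (n : nat) (x : T) : R :=
  if n is n'.+1 then Num.max 0 (f x + birkhoff_max f n' (theta x)) else 0.

Lemma birkhoff_sumE f n x : birkhoff_sum f n x = \sum_(t < n) f (iter t theta x).
Proof.
elim: n x => [|n IH] x /=; first by rewrite big_ord0.
by rewrite big_ord_recl IH; congr (_ + _); apply: eq_bigr => i _; rewrite -iterSr.
Qed.

Lemma birkhoff_max_ge0 f n x : 0 <= birkhoff_max f n x.
Proof. by case: n => //= n; rewrite le_max lexx. Qed.

Lemma birkhoff_max_nd f n x : birkhoff_max f n x <= birkhoff_max f n.+1 x.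
Proof.
elim: n x => [|n IH] x; first exact: birkhoff_max_ge0.
rewrite [leLHS]/= [leRHS]/= ge_max le_max lexx /= le_max; apply/orP; right.
by rewrite lerD2l IH.
Qed.

Lemma birkhoff_sum_le_max f n x : birkhoff_sum f n x <= birkhoff_max f n x.
Proof.
elim: n x => [|n IH] x //=; rewrite le_max; apply/orP; right.
by rewrite lerD2l.
Qed.

Lemma fm_theta f : finite_mean P f -> finite_mean P (fun x => f (theta x)) /\
  Ex P (fun x => f (theta x)) = Ex P f.
Proof.
move=> hf; have mf := fm_measurable hf; split; first exact/(law_fm mtheta inv mf).
by rewrite (law_Ex mtheta inv mf hf).
Qed.

Lemma fm_birkhoff_max f n : finite_mean P f -> finite_mean P (birkhoff_max f n).
Proof.
move=> hf; elim: n => [|n IH] /=; first exact: fm_cst.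
have [h _] := fm_theta IH; have hs := fmD hf h.
apply: (@fm_le _ _ _ _ _ (fun x => `|f x + birkhoff_max f n (theta x)|)).
- by apply: measurable_maxr => //; exact: fm_measurable hs.
- move=> x; rewrite ger0_norm ?le_max ?lexx //.
  by rewrite ge_max normr_ge0 ler_norm.
- exact: fm_abs.
Qed.

(** Garsia's argument. Let M be the maximum over n + 1 steps. On [A] the maximum is not attained by
    0, so f >= M - M o theta; off [A], M = 0 and M - M o theta <= 0. Integrating, the two terms in M
    cancel by invariance. *)
Lemma maximal_ergodic f n : finite_mean P f ->
  let A := [set x | 0 < birkhoff_max f n.+1 x] in
  measurable A /\ 0 <= Ex P (fun x => \1_A x * f x).
Proof.
move=> hf A; have hM := fm_birkhoff_max n.+1 hf.
have mA : measurable A.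
  rewrite (_ : A = [set: T] `&` birkhoff_max f n.+1 @^-1` [set` `]0, +oo[]).
    by apply: (fm_measurable hM).
  by rewrite setTI; apply/seteqP; split => x /=; rewrite in_itv /= andbT.
split=> //; have [hMt EM] := fm_theta hM.
apply: (@le_trans _ _ (Ex P (fun x => birkhoff_max f n.+1 x - birkhoff_max f n.+1 (theta x)))).
  by rewrite ExB // EM subrr.
apply: Ex_le.
- exact: fmB.
- apply: (@fm_le _ _ _ _ _ (fun x => `|f x|)); last exact: fm_abs.
    by apply: measurable_funM; [exact: measurable_indic|exact: fm_measurable hf].
  move=> x; rewrite normrM indicE; case: (x \in A); rewrite ?normr1 ?mul1r //.
  by rewrite normr0 mul0r.
move=> x; rewrite indicE; case: (boolP (x \in A)) => [|xA].
  rewrite inE mul1r => xA'; have xA : 0 < birkhoff_max f n.+1 x by []; rewrite lerBlDr.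
  have nd := birkhoff_max_nd f n (theta x).
  move: xA; rewrite [birkhoff_max f n.+1 x]/= /Num.max; case: ifP => [_ _|_]; last by rewrite ltxx.
  by rewrite lerD2l.
move: xA; rewrite notin_setE /A /= => /negP; rewrite -leNgt => xA.
rewrite mul0r; have := birkhoff_max_ge0 f n.+1 (theta x); rewrite [birkhoff_max _ _ (theta _)]/=.
by move=> h; apply: le_trans (lerB xA h) _; rewrite subrr.
Qed.

(** The sets of the maximal inequality increase to almost the whole space, and dominated convergence
    removes the indicator. *)
Lemma unbounded_sums_Ex_ge0 f : finite_mean P f ->
  {ae P, forall x, exists n, 0 < birkhoff_sum f n x} -> 0 <= Ex P f.
Proof.
move=> hf hae; pose A n := [set x | 0 < birkhoff_max f n.+1 x].
have cv : Ex P (fun x => \1_(A n) x * f x) @[n --> \oo] --> Ex P f.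
  apply: (@Ex_dominated_cvg _ _ _ P _ _ (fun x => `|f x|)).
  - move=> n; apply: measurable_funM; last exact: fm_measurable hf.
    by apply: measurable_indic; have [] := maximal_ergodic n hf.
  - exact: fm_measurable hf.
  - apply: filterS hae => x [n0 hn0].
    apply: cvg_near_cst; exists n0 => // n /= hn.
    rewrite indicE mem_set ?mul1r // /A /=.
    apply: lt_le_trans (le_trans (birkhoff_sum_le_max f n0 x) _) => //.
    apply: (@homo_leq _ (fun m => birkhoff_max f m x) <=%O) (leqW hn) => //.
      by move=> ? ? ? ; exact: le_trans.
    by move=> m; exact: birkhoff_max_nd.
  - exact: fm_abs.
  - move=> n; apply: nearW => x; rewrite normrM indicE; case: (x \in _).
      by rewrite normr1 mul1r.
    by rewrite normr0 mul0r.
rewrite -(cvg_lim _ cv) //; apply: limr_ge; first exact: cvgP cv.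
by apply: nearW => n; have [] := maximal_ergodic n hf.
Qed.

(** The set where the sums are unbounded above is exactly invariant, because a shift changes them by
    the single value [f x]. It has probability 0 or 1, and probability 1 would force a nonnegative
    mean. *)
Lemma birkhoff_sum_bounded_above f : finite_mean P f -> Ex P f < 0 ->
  {ae P, forall x, exists B, forall n, birkhoff_sum f n x <= B}.
Proof.
move=> hf f0; have mf := fm_measurable hf.
pose A := [set x | forall K : nat, exists n, K%:R < birkhoff_sum f n x].
have mS n : measurable_fun [set: T] (birkhoff_sum f n).
  elim: n => [|n IH] /=; first exact: measurable_cst.
  by apply: measurable_funD => //; exact: measurableT_comp.
have mA : measurable A.
  rewrite (_ : A = \bigcap_K \bigcup_n [set x | (K%:R : R) < birkhoff_sum f n x]).
    apply: bigcapT_measurable => K; apply: bigcupT_measurable => n.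
    rewrite (_ : [set _ | _] = [set: T] `&` birkhoff_sum f n @^-1` [set` `]K%:R, +oo[]).
      exact: mS.
    by rewrite setTI; apply/seteqP; split => x /=; rewrite in_itv /= andbT.
  apply/seteqP; split => x.
    by move=> h K _; have [n hn] := h K; exists n.
  by move=> h K; have [n _ hn] := h K I; exists n.
have invA : theta @^-1` A = A.
  apply/seteqP; split => x h K /=.
    have [n hn] := h (K + Num.bound `|f x|)%N; exists n.+1 => /=.
    have := archi_boundP (normr_ge0 (f x)); have := ler_norm (- f x); rewrite normrN.
    by move: hn; rewrite natrD; lra.
  have [n hn] := h (K + Num.bound `|f x|)%N.
  have fb := archi_boundP (normr_ge0 (f x)); have fn := ler_norm (f x).
  case: n hn => [|n] /=; first by rewrite ltNge ler0n.
  by move=> hn; exists n; move: hn; rewrite natrD; lra.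
have [A0|A1] := erg mA invA.
  exists A; split => // x /= nb; apply: contrapT => /existsNP [K hK]; apply: nb.
  exists K%:R => n; rewrite leNgt; apply/negP => h; apply: hK; exists n => //.
exfalso; move: f0; rewrite ltNge => /negP; apply.
apply: unbounded_sums_Ex_ge0 => //; exists (~` A); split.
- exact: measurableC.
- by rewrite probability_setC // A1 subee.
- move=> x /= h hA; apply: h; have [n hn] := hA 0%N; by exists n.
Qed.

(** After subtracting E f + e the mean is -e, so the centred sums are bounded above. *)
Lemma birkhoff_upper f (e : R) : finite_mean P f -> 0 < e ->
  {ae P, forall x, exists B, forall n, birkhoff_sum f n x <= (Ex P f + e) *+ n + B}.
Proof.
move=> hf e0.
have hg : finite_mean P (fun x => f x - (Ex P f + e)) by apply: fmB => //; exact: fm_cst.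
have Eg : Ex P (fun x => f x - (Ex P f + e)) < 0.
  by rewrite ExB ?Ex_cst //; [lra|exact: fm_cst].
apply: filterS (birkhoff_sum_bounded_above hg Eg) => x [B hB]; exists B => n.
have := hB n; rewrite !birkhoff_sumE sumrB sumr_const card_ord; lra.
Qed.

(** Upper bounds for f and for -f enclose the sum up to a random constant, which division by n
    removes. The convergence is almost sure. *)
Theorem mean_ergodic f (e : R) : finite_mean P f -> 0 < e ->
  {ae P, forall x, \forall n \near \oo,
     `|n%:R^-1 * birkhoff_sum f n x - Ex P f| <= e}.
Proof.
move=> hf e0; have e2 : 0 < e / 2 by rewrite divr_gt0.
have hN : finite_mean P (fun x => - f x).
  by apply: fm_eq (fmZ (-1) hf) => x; rewrite mulN1r.
have EN : Ex P (fun x => - f x) = - Ex P f.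
  by rewrite -mulN1r -ExZ //; apply: Ex_eq => x; rewrite mulN1r.
apply: filterS2 (birkhoff_upper hf e2) (birkhoff_upper hN e2) => x [B hB] [B' hB'].
pose K := `|B| + `|B'|; have K0 : 0 <= K by rewrite addr_ge0.
exists (Num.bound (K / (e / 2))).+1 => // n /= hn.
have n0 : (0 : R) < n%:R by rewrite ltr0n (leq_ltn_trans _ hn).
have Kn : K <= e / 2 * n%:R.
  rewrite mulrC -ler_pdivrMr //; apply: ltW.
  apply: lt_le_trans (archi_boundP _) _; first by rewrite divr_ge0 // ltW.
  by rewrite ler_nat ltnW.
have h1 := hB n; have h2 := hB' n; rewrite EN in h2.
have sN : birkhoff_sum (fun x => - f x) n x = - birkhoff_sum f n x.
  by rewrite !birkhoff_sumE sumrN.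
rewrite sN in h2.
have b1 : B <= K by rewrite /K; have := ler_norm B; have := normr_ge0 B'; lra.
have b2 : B' <= K by rewrite /K; have := ler_norm B'; have := normr_ge0 B; lra.
rewrite -(mulr_natr (Ex P f + _)) in h1; rewrite -(mulr_natr (- Ex P f + _)) in h2.
rewrite ler_distl; apply/andP; split.
  by rewrite mulrC ler_pdivlMr //; lra.
by rewrite mulrC ler_pdivrMr //; lra.
Qed.

End ergodic_theorem.

(** * Ergodic averages of the process *)

Section stationary_process.
Context (R : realType) (d1 d2 : measure_display) (Omega : measurableType d1)
  (S : measurableType d2) (P : probability Omega R) (X : nat -> Omega -> S).
Hypothesis mX : forall t, measurable_fun [set: Omega] (X t).
Hypothesis hstat : strictly_stationary P X.

(** No shift acts on [Omega], so the ergodic theorem is applied to the shift of the path space under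
    the law of the process and then pulled back. *)
Let path := g_sigma_algebraType (@pathsp_cylinder d2 S).

Let measurable_coord t : measurable_fun [set: path] (fun x : path => x t).
Proof.
by move=> _ B mB; rewrite setTI; apply: sub_sigma_algebra; exists t, B.
Qed.

Let measurable_to_path d (T : measurableType d) (f : T -> path) :
  (forall t, measurable_fun [set: T] (fun w => f w t)) -> measurable_fun [set: T] f.
Proof.
move=> hf; apply: (@measurability _ _ T path setT f (@pathsp_cylinder d2 S)) => //.
move=> _ [_ [t [B mB ->]] <-].
rewrite (_ : f @^-1` _ = (fun w => f w t) @^-1` B) //.
exact: hf.
Qed.

Let xi (w : Omega) : path := fun t => X t w.
Let mxi : measurable_fun [set: Omega] xi.
Proof. exact: measurable_to_path. Qed.

Let xif : {mfun Omega >-> path} := HB.pack xi (isMeasurableFun.Build _ _ _ _ xi mxi).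
Let nu : probability path R := distribution P xif.
Let theta (x : path) : path := fun t => x t.+1.
Let mtheta : measurable_fun [set: path] theta.
Proof. by apply: measurable_to_path => t; exact: measurable_coord. Qed.

Let nuE B : nu B = P (xi @^-1` B). Proof. by []. Qed.

Lemma stationary_pair (t : nat) (C : set (S * S)) : measurable C ->
  P ((fun w => (X t w, X t.+1 w)) @^-1` C) = P ((fun w => (X 0%N w, X 1%N w)) @^-1` C).
Proof.
move=> mC; pose A : set path := (fun x : path => (x 0%N, x 1%N)) @^-1` C.
have mA : path_event A.
  have : measurable_fun [set: path] (fun x : path => (x 0%N, x 1%N)).
    by apply: measurable_fun_pair; exact: measurable_coord.
  by move=> /(_ measurableT C mC); rewrite setTI.
by have := hstat t mA; rewrite /A /preimage /= addn0 addn1.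
Qed.

Lemma stationary_marginal (t : nat) (B : set S) : measurable B ->
  P (X t @^-1` B) = P (X 0%N @^-1` B).
Proof.
move=> mB; pose A : set path := (fun x : path => x 0%N) @^-1` B.
have mA : path_event A.
  by have := @measurable_coord 0%N measurableT B mB; rewrite setTI.
by have := hstat t mA; rewrite /A /preimage /= addn0.
Qed.

Hypothesis herg : ergodic P X.

Lemma pair_ergodic_average (f : S -> S -> R) (e : R) :
  measurable_fun [set: S * S] (fun z => f z.1 z.2) ->
  finite_mean P (fun w => f (X 0%N w) (X 1%N w)) -> 0 < e ->
  {ae P, forall w, \forall n \near \oo,
    `|n%:R^-1 * \sum_(t < n) f (X t w) (X t.+1 w) - Ex P (fun w => f (X 0%N w) (X 1%N w))| <= e}.
Proof.
move=> mf hf e0; pose F (x : path) := f (x 0%N) (x 1%N).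
have mF : measurable_fun [set: path] F.
  have mp : measurable_fun [set: path] (fun x : path => (x 0%N, x 1%N)).
    by apply: measurable_fun_pair; exact: measurable_coord.
  exact: (measurableT_comp mf mp).
have lawxi B : measurable B -> P (xi @^-1` B) = nu B by [].
have hF : finite_mean nu F by exact/(law_fm mxi lawxi mF).
have inv B : measurable B -> nu (theta @^-1` B) = nu B.
  by move=> mB; rewrite !nuE; have := hstat 1%N mB.
have erg A : measurable A -> theta @^-1` A = A -> nu A = 0%E \/ nu A = 1%E.
  by move=> mA hA; rewrite nuE; exact: (herg mA hA).
have := law_ae mxi lawxi (mean_ergodic mtheta inv erg hF e0).
apply: filterS => w; apply: filterS => n.
rewrite birkhoff_sumE (law_Ex mxi lawxi mF hF).
have it t : iter t theta (xi w) = fun s => X (s + t)%N w.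
  elim: t => [|t IH]; first by apply/funext => s; rewrite addn0.
  by rewrite iterS IH; apply/funext => s; rewrite /theta addSnnS.
by under eq_bigr do rewrite it /F add0n add1n.
Qed.

End stationary_process.

(** * Stochastic orders and Slutsky's lemma *)

Section small_probability.
Context (R : realType) (d : measure_display) (Omega : measurableType d) (P : probability Omega R).

(** Outer probability, since the events bounded below need not be measurable. *)
Definition prob_le (E : set Omega) (eps : R) : Prop :=
  exists A, [/\ measurable A, E `<=` A & (P A <= eps%:E)%E].

(** Unlike [little_op], the measurable cover may depend on [eps] and is required only eventually,
    which makes unions and products easy to handle. *)
Definition small (E : nat -> set Omega) : Prop :=
  forall eps : R, 0 < eps -> \forall n \near \oo, prob_le (E n) eps.

Definition op (Y : nat -> Omega -> R) : Prop :=
  forall e : R, 0 < e -> small (fun n => [set w | e <= `|Y n w|]).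

Definition Op (Y : nat -> Omega -> R) : Prop :=
  forall eps : R, 0 < eps -> exists2 C : R, 0 < C &
    \forall n \near \oo, prob_le [set w | C <= `|Y n w|] eps.

Lemma prob_leS E E' eps : E `<=` E' -> prob_le E' eps -> prob_le E eps.
Proof. by move=> EE [A [mA EA PA]]; exists A; split => //; exact: subset_trans EA. Qed.

Lemma prob_leU E E' e e' : prob_le E e -> prob_le E' e' -> prob_le (E `|` E') (e + e').
Proof.
move=> [A [mA EA PA]] [A' [mA' EA' PA']]; exists (A `|` A'); split.
- exact: measurableU.
- exact: setUSS.
- apply: le_trans (measureU2 _ mA mA') _; rewrite EFinD.
  exact: leeD.
Qed.

Lemma small_sub E E' : (forall n, E n `<=` E' n) -> small E' -> small E.
Proof. by move=> EE h eps e0; apply: filterS (h eps e0) => n; exact: prob_leS. Qed.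

Lemma small_near_sub E E' : (\forall n \near \oo, E n `<=` E' n) -> small E' -> small E.
Proof.
by move=> EE h eps e0; apply: filterS2 EE (h eps e0) => n; exact: prob_leS.
Qed.

Lemma smallU E E' : small E -> small E' -> small (fun n => E n `|` E' n).
Proof.
move=> h h' eps e0; have e2 : 0 < eps / 2 by rewrite divr_gt0.
apply: filterS2 (h _ e2) (h' _ e2) => n p p'.
by rewrite (splitr eps); exact: prob_leU.
Qed.

(** Deterministic bounds are available only on good events; domination may fail on events of
    vanishing outer probability. *)
Lemma op_dom Y Z : op Z -> small (fun n => [set w | ~ `|Y n w| <= `|Z n w|]) -> op Y.
Proof.
move=> hZ hs e e0; apply: small_sub (smallU (hZ e e0) hs) => n w /= hY.
have [h|h] := pselect (`|Y n w| <= `|Z n w|); last by right.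
by left; exact: le_trans h.
Qed.

Lemma op_le Y Z : op Z -> (forall n w, `|Y n w| <= `|Z n w|) -> op Y.
Proof.
move=> hZ hle; apply: op_dom hZ _ => eps e0; apply: nearW => n.
exists set0; split => //; first by move=> w /=; rewrite hle.
by rewrite measure0 lee_fin ltW.
Qed.

Lemma op_eq Y Z : op Z -> (forall n w, Y n w = Z n w) -> op Y.
Proof. by move=> hZ e; apply: op_le hZ _ => n w; rewrite e. Qed.

Lemma opD Y Z : op Y -> op Z -> op (fun n w => Y n w + Z n w).
Proof.
move=> hY hZ e e0; have e2 : 0 < e / 2 by rewrite divr_gt0.
apply: small_sub (smallU (hY _ e2) (hZ _ e2)) => n w /= h.
have [h1|h1] := leP (e / 2) `|Y n w|; first by left.
have [h2|h2] := leP (e / 2) `|Z n w|; first by right.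
by have := ler_normD (Y n w) (Z n w); lra.
Qed.

Lemma opZ (a : R) Y : op Y -> op (fun n w => a * Y n w).
Proof.
move=> hY e e0; have a1 : 0 < `|a| + 1 by rewrite ltr_wpDl.
apply: small_sub (hY _ (divr_gt0 e0 a1)) => n w /= h.
rewrite ler_pdivrMr //; apply: le_trans h _; rewrite normrM mulrC ler_wpM2l //.
by rewrite lerDl.
Qed.

Lemma opB Y Z : op Y -> op Z -> op (fun n w => Y n w - Z n w).
Proof.
move=> hY hZ; apply: op_eq (opD hY (opZ (-1) hZ)) _ => n w.
by rewrite mulN1r.
Qed.

Lemma op_sum k (Y : 'I_k -> nat -> Omega -> R) : (forall j, op (Y j)) ->
  op (fun n w => \sum_j Y j n w).
Proof.
elim: k Y => [|k IH] Y hY.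
  move=> e e0 eps ep; apply: nearW => n; exists set0; split => //.
    by move=> w /=; rewrite big_ord0 normr0 leNgt e0.
  by rewrite measure0 lee_fin ltW.
apply: op_eq (opD (IH (fun j => Y (widen_ord (leqnSn k) j)) _) (hY ord_max)) _ => //.
by move=> n w; rewrite big_ord_recr.
Qed.

Lemma op_cst (a : nat -> R) : a n @[n --> \oo] --> 0 -> op (fun n _ => a n).
Proof.
move=> ha e e0 eps ep.
have /cvgrPdist_lt /(_ e e0) := ha; apply: filterS => n h.
exists set0; split => //; last by rewrite measure0 lee_fin ltW.
by move=> w /=; rewrite leNgt; move: h; rewrite sub0r normrN => ->.
Qed.

Lemma op_Op Y : op Y -> Op Y.
Proof. by move=> h eps e0; exists 1 => //; exact: h. Qed.

Lemma Op_op_mul Y Z : Op Y -> op Z -> op (fun n w => Y n w * Z n w).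
Proof.
move=> hY hZ e e0 eps ep; have e2 : 0 < eps / 2 by rewrite divr_gt0.
have [C C0 hC] := hY _ e2; have eC : 0 < e / C by rewrite divr_gt0.
apply: filterS2 hC (hZ _ eC _ e2) => n p q.
rewrite (splitr eps); apply: prob_leS (prob_leU p q) => w /= h.
have [h1|h1] := leP C `|Y n w|; first by left.
right; rewrite ler_pdivrMr // mulrC; apply: le_trans h _.
by rewrite normrM ler_wpM2r // ltW.
Qed.

Lemma op_mul Y Z : op Y -> op Z -> op (fun n w => Y n w * Z n w).
Proof. by move=> /op_Op; exact: Op_op_mul. Qed.

Lemma OpD Y Z : Op Y -> Op Z -> Op (fun n w => Y n w + Z n w).
Proof.
move=> hY hZ eps ep; have e2 : 0 < eps / 2 by rewrite divr_gt0.
have [C C0 hC] := hY _ e2; have [D D0 hD] := hZ _ e2.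
exists (C + D); first by rewrite addr_gt0.
apply: filterS2 hC hD => n p q.
rewrite (splitr eps); apply: prob_leS (prob_leU p q) => w /= h.
have [h1|h1] := leP C `|Y n w|; first by left.
right; have := ler_normD (Y n w) (Z n w); lra.
Qed.

Lemma Op_le Y Z : Op Z -> (forall n w, `|Y n w| <= `|Z n w|) -> Op Y.
Proof.
move=> hZ hle eps ep; have [C C0 hC] := hZ _ ep; exists C => //.
by apply: filterS hC => n; apply: prob_leS => w /= h; exact: le_trans h _.
Qed.

Lemma Op_sum k (Y : 'I_k -> nat -> Omega -> R) : (forall j, Op (Y j)) ->
  Op (fun n w => \sum_j Y j n w).
Proof.
elim: k Y => [|k IH] Y hY.
  apply: (@Op_le _ (fun _ _ => 0)).
    by apply: op_Op; apply: op_cst; exact: cvg_cst.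
  by move=> n w; rewrite big_ord0.
apply: Op_le (OpD (IH (fun j => Y (widen_ord (leqnSn k) j)) _) (hY ord_max)) _ => //.
by move=> n w; rewrite big_ord_recr.
Qed.

Lemma little_op_op Y (a : nat -> R) : (\forall n \near \oo, 0 < a n) ->
  little_op P Y a -> op (fun n w => Y n w / a n).
Proof.
move=> ha hY e e0 eps ep; have [A [mA hA PA]] := hY e e0.
have PA' : fine (P (A n)) @[n --> \oo] --> (0 : R) by apply: fine_cvg.
have /cvgrPdist_lt /(_ _ ep) hP := PA'.
apply: filterS2 ha hP => n an0 h; exists (A n); split => //.
  move=> w /= hw; apply: hA => /=; move: hw.
  by rewrite normrM normfV (gtr0_norm an0) ler_pdivlMr.
rewrite -(@fineK _ (P (A n))) ?fin_num_measure // lee_fin.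
by move: h; rewrite sub0r normrN => /ltW; apply: le_trans; exact: ler_norm.
Qed.

Lemma little_op1 Y : little_op P Y (fun=> 1) -> op Y.
Proof.
move=> h; apply: op_eq (little_op_op _ h) _; first exact: nearW.
by move=> n w; rewrite divr1.
Qed.

Lemma prob_le_markov (f : Omega -> R) (e eps : R) : finite_mean P f -> (forall w, 0 <= f w) ->
  0 < e -> Ex P f <= eps * e -> prob_le [set w | e <= f w] eps.
Proof.
move=> hf f0 e0 hE; have [mA PA] := markov_le hf f0 e0.
exists [set w | e <= f w]; split => //; apply: le_trans PA _.
by rewrite lee_fin ler_pdivrMr.
Qed.

Lemma op_L1 Y (Z : nat -> Omega -> R) : (forall n, finite_mean P (Z n)) ->
  (forall n w, `|Y n w| <= Z n w) ->
  Ex P (Z n) @[n --> \oo] --> 0 -> op Y.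
Proof.
move=> hZ YZ EZ e e0 eps ep.
have Z0 n w : 0 <= Z n w by exact: le_trans (YZ n w).
have /cvgrPdist_lt /(_ _ (mulr_gt0 ep e0)) := EZ; apply: filterS => n h.
apply: (@prob_leS _ [set w | e <= Z n w]) => [w /= hw|]; first exact: le_trans (YZ n w).
apply: prob_le_markov => //; move: h; rewrite sub0r normrN => /ltW.
by apply: le_trans; exact: ler_norm.
Qed.

Lemma Op_L1 Y (Z : nat -> Omega -> R) (C : R) : (forall n, finite_mean P (Z n)) ->
  (forall n w, `|Y n w| <= Z n w) ->
  (\forall n \near \oo, Ex P (Z n) <= C) -> Op Y.
Proof.
move=> hZ YZ EZ eps ep.
have Z0 n w : 0 <= Z n w by exact: le_trans (YZ n w).
have C1 : 0 < `|C| + 1 by rewrite ltr_wpDl.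
exists ((`|C| + 1) / eps); first by rewrite divr_gt0.
apply: filterS EZ => n h.
apply: (@prob_leS _ [set w | (`|C| + 1) / eps <= Z n w]) => [w /= hw|].
  exact: le_trans (YZ n w).
apply: prob_le_markov => //; first by rewrite divr_gt0.
rewrite mulrC divfK ?gt_eqF //; apply: le_trans h (le_trans (ler_norm C) _).
by rewrite lerDl.
Qed.

Lemma op_ae (Y : nat -> Omega -> R) : (forall n, measurable_fun [set: Omega] (Y n)) ->
  (forall e : R, 0 < e -> {ae P, forall w, \forall n \near \oo, `|Y n w| <= e}) -> op Y.
Proof.
move=> mY hae e e0; have e2 : 0 < e / 2 by rewrite divr_gt0.
pose A n := [set w | e <= `|Y n w|].
have mA n : measurable (A n).
  rewrite (_ : A n = [set: Omega] `&` (fun w => `|Y n w|) @^-1` [set` `[e, +oo[]).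
    by apply: measurableT_comp.
  by rewrite setTI; apply/seteqP; split => x /=; rewrite in_itv /= andbT.
have cv : Ex P (\1_(A n) : Omega -> R) @[n --> \oo] --> Ex P (fun=> 0).
  apply: (@Ex_dominated_cvg _ _ _ P _ _ (fun=> 1)).
  - by move=> n; exact: measurable_indic.
  - exact: measurable_cst.
  - apply: filterS (hae _ e2) => w hw; apply: cvg_near_cst.
    apply: filterS hw => n hn; rewrite indicE memNset // /A /= => h.
    by have := le_trans h hn; lra.
  - exact: fm_cst.
  - move=> n; apply: nearW => w.
    by rewrite indicE ger0_norm // -[leRHS]/(1%:R) ler_nat leq_b1.
rewrite Ex_cst in cv; move=> eps ep.
have /cvgrPdist_lt /(_ _ ep) := cv; apply: filterS => n h.
exists (A n); split => //; have [_ <-] := fm_indic P (mA n).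
rewrite lee_fin; move: h; rewrite sub0r normrN => /ltW.
by apply: le_trans; exact: ler_norm.
Qed.

End small_probability.

(** Only [x] is confined to the segment; [y] may leave it, as does one of the two variables in
    Slutsky's lemma. *)
Lemma continuous_unif_segment (R : realType) (f : R -> R) (K eps : R) :
  continuous f -> 0 < eps -> exists2 delta : R, 0 < delta &
  forall x y, `|x| <= K -> `|x - y| <= delta -> `|f x - f y| <= eps.
Proof.
move=> cf e0; apply: contrapT => hno.
have bad (j : nat) : exists xy : R * R, [/\ `|xy.1| <= K, `|xy.1 - xy.2| <= j.+1%:R^-1 &
    eps < `|f xy.1 - f xy.2|].
  apply: contrapT => hj; apply: hno; exists j.+1%:R^-1; first by rewrite invr_gt0.
  move=> x y xK xy; rewrite leNgt; apply/negP => h; apply: hj; by exists (x, y).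
pose F j := projT1 (cid (bad j)).
have hF j : [/\ `|(F j).1| <= K, `|(F j).1 - (F j).2| <= j.+1%:R^-1 &
    eps < `|f (F j).1 - f (F j).2|] by rewrite /F; case: cid.
have [U [UU oU]] := ultraFilterLemma eventually_filter.
have [l _ hl] := @ultra_bounded_cvg R U (fun j => (F j).1) (- K) K UU
  (fun j => let: And3 h _ _ := hF j in etrans (esym (ler_norml _ _)) h).
have /cvgrPdist_le /(_ _ (divr_gt0 e0 (ltr0Sn R 1))) := cf l.
move=> /nbhs_ballP [r r0 hr].
have r4 : 0 < r / 4 by rewrite divr_gt0.
have Ur : U [set j : nat | (j.+1%:R^-1 : R) < r / 4].
  by apply: oU; exact: near_infty_natSinv_lt (PosNum r4).
have [j [/= h1 h2]] := filter_ex (filterI (hl _ r4) Ur).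
have [_ h3 h4] := hF j.
have b1 : `|f l - f (F j).1| <= eps / 2.
  by apply: hr; rewrite /ball /= distrC; apply: le_lt_trans h1 _; lra.
have b2 : `|f l - f (F j).2| <= eps / 2.
  apply: hr; rewrite /ball /=; have := ler_distD (F j).1 l (F j).2.
  rewrite (distrC l (F j).1) => h5; have h6 := le_lt_trans h3 h2; by move: h1 h5 h6 r4; lra.
move: h4; rewrite ltNge => /negP; apply.
rewrite -(subrKA (f l)); apply: le_trans (ler_normD _ _) _.
by rewrite (distrC _ (f l)); lra.
Qed.

Section slutsky.
Context (R : realType) (d : measure_display) (Omega : measurableType d) (P : probability Omega R).

Lemma bounded_fm (dT : measure_display) (T : measurableType dT) (mu : probability T R)
  (g : T -> R) (C : R) : measurable_fun [set: T] g -> (forall x, `|g x| <= C) -> finite_mean mu g.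
Proof. by move=> mg hC; apply: fm_le mg hC _; exact: fm_cst. Qed.

Context (dL : measure_display) (L : measurableType dL) (mu : probability L R).

Lemma cvg_in_dist_comp (E F : topologicalType) (Y : nat -> Omega -> E) (Z : L -> E) (h : E -> F) :
  continuous h -> cvg_in_dist P mu Y Z ->
  cvg_in_dist P mu (fun n w => h (Y n w)) (fun z => h (Z z)).
Proof.
move=> ch hY f cf [C hC]; apply: (hY (fun x => f (h x))); last by exists C => x.
by move=> x; apply: continuous_comp; [exact: ch|exact: cf].
Qed.

(* continuous cutoff: 0 on [-K, K], 1 outside [-K - 1, K + 1] *)
Definition cutoff (K x : R) : R := Num.min (Num.max (`|x| - K) 0) 1.

Lemma cutoff_itv K x : 0 <= cutoff K x <= 1.
Proof. by rewrite /cutoff le_min ge_min le_max !lexx !orbT ler01. Qed.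

Lemma continuous_cutoff K : continuous (cutoff K).
Proof.
apply: min_fun_continuous; last exact: cst_continuous.
apply: max_fun_continuous; last exact: cst_continuous.
by move=> x; apply: cvgB; [exact: norm_continuous|exact: cvg_cst].
Qed.

(** Tightness of the limit makes its expected [cutoff] small at some level N. Convergence carries
    this over to large n, and Markov's inequality applies because [cutoff] equals 1 beyond N + 1. *)
Lemma cvg_in_dist_Op (W : nat -> Omega -> R) (Z : L -> R) :
  (forall n, measurable_fun [set: Omega] (W n)) -> measurable_fun [set: L] Z ->
  cvg_in_dist P mu W Z -> Op P W.
Proof.
move=> mW mZ hW eps ep; have e2 : 0 < eps / 2 by rewrite divr_gt0.
have mc K : measurable_fun [set: R] (cutoff K).
  by apply: continuous_measurable_fun; exact: continuous_cutoff.
have cb K x : `|cutoff K x| <= 1.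
  by have /andP[h1 h2] := cutoff_itv K x; rewrite ger0_norm.
have cv : Ex mu (fun z => cutoff n%:R (Z z)) @[n --> \oo] --> Ex mu (fun=> 0).
  apply: (@Ex_dominated_cvg _ _ _ mu _ _ (fun=> 1)).
  - by move=> n; exact: measurableT_comp.
  - exact: measurable_cst.
  - apply: nearW => z; apply: cvg_near_cst.
    exists (Num.bound `|Z z|) => // n /= hn.
    rewrite /cutoff max_r ?min_l // subr_le0 ltW //.
    by apply: lt_le_trans (archi_boundP (normr_ge0 _)) _; rewrite ler_nat.
  - exact: fm_cst.
  - by move=> n; apply: nearW => z; exact: cb.
rewrite Ex_cst in cv.
have /cvgrPdist_lt /(_ _ e2) [N _ /(_ N (leqnn N)) hN] := cv.
have hlim : Ex P (fun w => cutoff N%:R (W n w)) @[n --> \oo] -->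
    Ex mu (fun z => cutoff N%:R (Z z)).
  by apply: hW; [exact: continuous_cutoff|exists 1].
exists (N%:R + 1); first by rewrite ltr_wpDl.
have /cvgrPdist_lt /(_ _ e2) := hlim; apply: filterS => n h.
apply: (@prob_leS _ _ _ _ _ [set w | 1 <= cutoff N%:R (W n w)]).
  move=> w /= hw; rewrite /cutoff le_min lexx andbT le_max; apply/orP; left; lra.
apply: prob_le_markov => //.
- by apply: (@bounded_fm _ _ _ _ 1) => //; exact: measurableT_comp.
- by move=> w; have /andP[] := cutoff_itv N%:R (W n w).
- rewrite mulr1; move: hN h; rewrite sub0r normrN => h1 h2.
  have := ler_norm (Ex mu (fun z => cutoff N%:R (Z z))).
  have := ler_normB (Ex mu (fun z => cutoff N%:R (Z z)) - Ex P (fun w => cutoff N%:R (W n w))) 0.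
  have := ler_norm (- (Ex mu (fun z => cutoff N%:R (Z z)) - Ex P (fun w => cutoff N%:R (W n w)))).
  by rewrite normrN subr0 normr0; lra.
Qed.

(** Off two events of small outer probability, [W n] is bounded and [U n] is close to it, so uniform
    continuity compares the values of f; on those events the difference is at most 2C. *)
Lemma slutsky (U W : nat -> Omega -> R) (Z : L -> R) :
  (forall n, measurable_fun [set: Omega] (U n)) ->
  (forall n, measurable_fun [set: Omega] (W n)) -> measurable_fun [set: L] Z ->
  cvg_in_dist P mu W Z -> op P (fun n w => U n w - W n w) -> cvg_in_dist P mu U Z.
Proof.
move=> mU mW mZ hW hUW f cf [C hC].
have C0 : 0 <= C := le_trans (normr_ge0 _) (hC 0).
have mf : measurable_fun [set: R] f by exact: continuous_measurable_fun.
have hWf : Ex P (fun w => f (W n w)) @[n --> \oo] --> Ex mu (fun z => f (Z z)).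
  by apply: hW => //; exists C.
suff hd : Ex P (fun w => f (U n w)) - Ex P (fun w => f (W n w)) @[n --> \oo] --> 0.
  rewrite (_ : (fun n => _) = (fun n => (Ex P (fun w => f (U n w)) - Ex P (fun w => f (W n w)))
    + Ex P (fun w => f (W n w)))); last by apply/funext => n; rewrite subrK.
  rewrite -[X in _ --> X]add0r; exact: cvgD hd hWf.
have fmf (V : Omega -> R) : measurable_fun [set: Omega] V -> finite_mean P (fun w => f (V w)).
  by move=> mV; apply: (@bounded_fm _ _ _ _ C) => //; exact: measurableT_comp.
apply/cvgrPdist_le => eps ep.
(* The final bound is e' + 2C (e' + e') = (1 + 4C) e'. *)
pose e' := eps / (1 + 4 * C).
have c4 : 0 < 1 + 4 * C by rewrite ltr_wpDr // mulr_ge0.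
have ep' : 0 < e' by rewrite divr_gt0.
have [K K0 hK] := cvg_in_dist_Op mW mZ hW ep'.
have [delta d0 hdelta] := continuous_unif_segment K cf ep'.
apply: filterS2 hK (hUW delta d0 e' ep') => n [A [mA hA PA]] [B [mB hB PB]].
rewrite sub0r normrN -ExB; [|exact: fmf|exact: fmf].
have hfb : finite_mean P (fun w => f (U n w) - f (W n w)) by apply: fmB; exact: fmf.
apply: le_trans (Ex_abs hfb) _.
have [iA EA] := fm_indic P mA; have [iB EB] := fm_indic P mB.
have hbound w : `|f (U n w) - f (W n w)| <= e' + (2 * C) * (\1_A w + \1_B w).
  have i0 (D : set Omega) : 0 <= (\1_D w : R) by rewrite indicE.
  have [wA|wA] := pselect (A w).
    have : (\1_A w : R) = 1 by rewrite indicE mem_set.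
    move=> ->; have := ler_normB (f (U n w)) (f (W n w)); have := hC (U n w); have := hC (W n w).
    by have := mulr_ge0 (mulr_ge0 (ler0n R 2) C0) (i0 B); lra.
  have [wB|wB] := pselect (B w).
    have : (\1_B w : R) = 1 by rewrite indicE mem_set.
    move=> ->; have := ler_normB (f (U n w)) (f (W n w)); have := hC (U n w); have := hC (W n w).
    by have := mulr_ge0 (mulr_ge0 (ler0n R 2) C0) (i0 A); lra.
  apply: (@le_trans _ _ e'); last by rewrite lerDl !mulr_ge0 ?addr_ge0.
  rewrite distrC; apply: hdelta.
    by rewrite leNgt; apply/negP => h; apply: wA; apply: hA; exact: ltW.
  by rewrite distrC leNgt; apply/negP => h; apply: wB; apply: hB; exact: ltW.
have hiAB := fmD iA iB; have hr := fmD (fm_cst P e') (fmZ (2 * C) hiAB).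
apply: le_trans (Ex_le (fm_abs hfb) hr hbound) _.
rewrite (ExD (fm_cst P e') (fmZ (2 * C) hiAB)) Ex_cst ExZ // ExD //.
rewrite -!EA in PA; rewrite -!EB in PB; rewrite !lee_fin in PA PB.
have h : 2 * C * (Ex P \1_A + Ex P \1_B) <= 2 * C * (e' + e').
  by rewrite ler_wpM2l ?mulr_ge0 // lerD.
have -> : eps = (1 + 4 * C) * e' by rewrite /e' mulrC divfK // gt_eqF.
lra.
Qed.

End slutsky.

(** * Uniform linearization in the parameter *)

Section parametric_calculus.
Context (R : realType) (p : nat).
Implicit Types (h a q : 'rV[R]_p) (f : 'rV[R]_p -> R).

Lemma coord_le_norm h j : `|h 0 j| <= `|h|.
Proof.
rewrite [leRHS]/Num.Def.normr /= mx_normrE.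
exact: (le_bigmax _ (fun ij : 'I_1 * 'I_p => `|h ij.1 ij.2|) (0, j)).
Qed.

Lemma norm_lt_coord h (e : R) : 0 < e -> (forall j, `|h 0 j| < e) -> `|h| < e.
Proof.
move=> e0 he; rewrite [ltLHS]/Num.Def.normr /= mx_normrE.
by apply: bigmax_lt => // -[i j] _ /=; rewrite ord1.
Qed.

Lemma diff_gradient f a h : differentiable (f : 'rV[R]_p -> R^o) a ->
  'd (f : 'rV[R]_p -> R^o) a h = \sum_j gradient f a 0 j * h 0 j.
Proof.
move=> df; rewrite [in LHS](row_sum_delta h) linear_sum; apply: eq_bigr => j _.
by rewrite linearZ /gradient mxE mulrC.
Qed.

(** The norm of [h] is the maximum norm while that of the gradient is Euclidean; the factor [p]
    comes from summing coordinatewise bounds. *)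
Lemma gradient_dot_le f a h (K : R) : enorm (gradient f a) <= K ->
  `|\sum_j gradient f a 0 j * h 0 j| <= p%:R * K * `|h|.
Proof.
move=> hK; apply: le_trans (ler_norm_sum _ _ _) _.
have -> : p%:R * K * `|h| = \sum_(j < p) K * `|h|.
  by rewrite sumr_const card_ord -[RHS]mulr_natl mulrA.
apply: ler_sum => j _; rewrite normrM; apply: ler_pM => //; last exact: coord_le_norm.
apply: le_trans hK; exact: abs_le_enorm.
Qed.

Lemma mean_value_le f a (r K : R) h : (forall c, `|c - a| < r ->
    differentiable (f : 'rV[R]_p -> R^o) c /\ enorm (gradient f c) <= K) ->
  `|h| < r -> `|f (a + h) - f a| <= p%:R * K * `|h|.
Proof.
move=> hf hr; pose g (t : R) : R^o := f (a + t *: h).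
have dg (t : R) : 0 <= t <= 1 ->
    is_derive t 1 g ('d (f : 'rV[R]_p -> R^o) (a + t *: h) h) /\
    `|'d (f : 'rV[R]_p -> R^o) (a + t *: h) h| <= p%:R * K * `|h|.
  move=> /andP[t0 t1]; have [|df gK] := hf (a + t *: h).
    rewrite addrC addKr normrZ ger0_norm //; apply: le_lt_trans hr.
    by rewrite ler_piMl.
  split; last by rewrite diff_gradient //; exact: gradient_dot_le.
  have E : (fun s : R => s^-1 *: ((g \o shift t) (s *: (1:R)) - g t)) =
      (fun s : R => s^-1 *: (((f : 'rV[R]_p -> R^o) \o shift (a + t *: h)) (s *: h) -
        f (a + t *: h))).
    apply/funext => s; rewrite /g /= /shift /=; congr (_ *: (f _ - _)).
    by rewrite scalerDl /GRing.scale /= mulr1; rewrite addrCA.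
  split; first by rewrite /derivable E; exact: (@diff_derivable _ _ _ _ _ h df).
  by rewrite /derive E -(deriveE h df).
have [||c cI hc] := @MVT R g (fun t => 'd (f : 'rV[R]_p -> R^o) (a + t *: h) h) 0 1 ltr01.
- by move=> t; rewrite in_itv /= => /andP[t0 t1]; apply: (dg t _).1; rewrite !ltW.
- apply: continuous_in_subspaceT => t /[!inE] /=; rewrite in_itv /= => /dg [[dgt _] _].
  by apply: differentiable_continuous; apply/derivable1_diffP.
- move: cI; rewrite in_itv /= => /andP[c0 c1].
  have <- : g 1 - g 0 = f (a + h) - f a by rewrite /g scale1r scale0r addr0.
  by rewrite hc subr0 mulr1; apply: (dg c _).2; rewrite !ltW.
Qed.

Lemma gradient_expansion f a (e : R) : differentiable (f : 'rV[R]_p -> R^o) a -> 0 < e ->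
  exists2 r : R, 0 < r & forall h, `|h| < r ->
  `|f (a + h) - f a - \sum_j gradient f a 0 j * h 0 j| <= e * `|h|.
Proof.
move=> df e0; have /diff_locallyP [_ /eqaddoP /(_ _ e0) /nbhs_ballP [r /= r0 hr]] := df.
exists r => // h hh.
have := hr h; rewrite -ball_normE /ball_ /= sub0r normrN => /(_ hh).
by rewrite !fctE /= /shift /= diff_gradient // (addrC h) opprD addrA.
Qed.
End parametric_calculus.

Section ratio_sup.
Context (R : realType) (p : nat).
Context (d : measure_display) (T : measurableType d).
Implicit Types (h : 'rV[R]_p) (g : T -> 'rV[R]_p -> R).

(** An enumeration of the rational rows, with 0 at indices that encode none. *)
Definition rat_row (i : nat) : 'rV[R]_p :=
  if unpickle i is Some q then map_mx ratr (q : 'rV[rat]_p) else 0.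

Lemma rat_row_dense h (e : R) : 0 < e -> exists i, `|h - rat_row i| < e.
Proof.
move=> e0.
have hq j : exists q : rat, `|h 0 j - ratr q| < e.
  have [|q] := @rat_in_itvoo R (h 0 j - e) (h 0 j + e); first by lra.
  by rewrite in_itv /= => /andP[q1 q2]; exists q; rewrite ltr_distlC; apply/andP; lra.
pose q : 'rV[rat]_p := \row_j projT1 (cid (hq j)).
exists (pickle q); rewrite /rat_row pickleK; apply: norm_lt_coord => // j.
by rewrite !mxE; case: cid.
Qed.

(* a supremum over rational increments only, so that it is measurable in [z];
   continuity in [h] makes it the supremum over all increments *)
Definition ratio_seq g (r : R) (z : T) (i : nat) : R :=
  if `|rat_row i| < r then `|g z (rat_row i)| / `|rat_row i| else 0.

Definition ratio_sup g (r : R) (z : T) : R := fine (esups (fun i => (ratio_seq g r z i)%:E) 0%N).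

Lemma measurable_ratio_sup g r : (forall h, measurable_fun [set: T] (g ^~ h)) ->
  measurable_fun [set: T] (ratio_sup g r).
Proof.
move=> mg; apply: measurableT_comp => //; apply: (@measurable_fun_esups _ _ _ _
  (fun i z => (ratio_seq g r z i)%:E)) => i.
apply: measurableT_comp => //; rewrite /ratio_seq; case: (`|rat_row i| < r) => //.
by apply: measurable_funM => //; apply: measurableT_comp.
Qed.

Lemma ratio_seq_ge0 g r z i : 0 <= ratio_seq g r z i.
Proof. by rewrite /ratio_seq; case: ifP => // _; rewrite divr_ge0. Qed.

Lemma ratio_sup_ge0 g r z : 0 <= ratio_sup g r z.
Proof.
apply: fine_ge0; apply: (@le_trans _ _ (ratio_seq g r z 0%N)%:E).
  by rewrite lee_fin; exact: ratio_seq_ge0.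
by apply: ereal_sup_ubound; exists 0%N.
Qed.

Lemma ratio_supE g r z (K : R) : 0 <= K -> (forall h, `|h| < r -> `|g z h| <= K * `|h|) ->
  (forall i, ratio_seq g r z i <= ratio_sup g r z) /\ ratio_sup g r z <= K.
Proof.
move=> K0 hg.
have hK i : ratio_seq g r z i <= K.
  rewrite /ratio_seq; case: ifP => // hi.
  have [->|n0] := eqVneq `|rat_row i| 0; first by rewrite invr0 mulr0.
  by rewrite ler_pdivrMr ?hg // lt0r n0 /=.
have hs : (esups (fun i => (ratio_seq g r z i)%:E) 0%N <= K%:E)%E.
  by apply: ge_ereal_sup => _ /= [i _ <-]; rewrite lee_fin.
have h0 : (0 <= esups (fun i => (ratio_seq g r z i)%:E) 0%N)%E.
  apply: (@le_trans _ _ (ratio_seq g r z 0%N)%:E); first by rewrite lee_fin; exact: ratio_seq_ge0.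
  by apply: ereal_sup_ubound; exists 0%N.
have fin : esups (fun i => (ratio_seq g r z i)%:E) 0%N \is a fin_num.
  by rewrite ge0_fin_numE //; apply: le_lt_trans hs _; rewrite ltry.
split=> [i|]; rewrite -lee_fin /ratio_sup fineK //.
by apply: ereal_sup_ubound; exists i.
Qed.

(** Density of the rational rows and continuity at [h] extend the bound from countably many
    increments to all of them. *)
Lemma ratio_supP g r z (K : R) h : 0 <= K -> (forall h, `|h| < r -> `|g z h| <= K * `|h|) ->
  {for h, continuous (g z)} -> `|h| < r -> `|g z h| <= ratio_sup g r z * `|h|.
Proof.
move=> K0 hg cg hr; have [hs _] := ratio_supE K0 hg.
have S0 := ratio_sup_ge0 g r z.
set S := ratio_sup g r z in hs S0 *.
apply/ler_addgt0Pr => e e0.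
have e2 : 0 < e / 2 by rewrite divr_gt0.
have /cvgrPdist_lt /(_ _ e2) /nbhs_ballP [r1 /= r10 hr1] := cg.
(* The last bound gives S |h - q| <= e / 2 for the rational row q chosen below; adding 1 avoids a
   division by zero. *)
have r2 : 0 < Num.min (Num.min r1 (r - `|h|)) (e / 2 / (S + 1)).
  by rewrite !lt_min r10 subr_gt0 hr divr_gt0 //= ltr_wpDl.
have [i +] := rat_row_dense h r2; rewrite !lt_min => /andP[/andP[h1 h2] h3].
have h4 : `|rat_row i| <= `|h| + `|h - rat_row i|.
  by have := ler_normB h (h - rat_row i); rewrite subKr.
have hi : `|rat_row i| < r by lra.
have h5 : `|g z (rat_row i)| <= S * `|rat_row i|.
  have := hs i; rewrite /ratio_seq hi.
  have [n0|n0] := eqVneq `|rat_row i| 0.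
    by move=> _; rewrite n0 mulr0 -(mulr0 K) -n0; exact: hg.
  by rewrite ler_pdivrMr // lt0r n0 /=.
have h6 : `|g z h - g z (rat_row i)| < e / 2.
  by apply: hr1; rewrite -ball_normE /ball_ /=.
have h7 : S * `|rat_row i| <= S * `|h| + e / 2.
  apply: le_trans (ler_wpM2l S0 h4) _; rewrite mulrDr lerD2l.
  move: h3; rewrite ltr_pdivlMr ?ltr_wpDl // => h3.
  by have := normr_ge0 (h - rat_row i); nra.
have := ler_normD (g z h - g z (rat_row i)) (g z (rat_row i)); rewrite subrK; lra.
Qed.

End ratio_sup.

Section local_linearization.
Context (R : realType) (p : nat).
Context (d : measure_display) (T : measurableType d).
Implicit Types (f : T -> 'rV[R]_p -> R) (D : set T) (a : 'rV[R]_p).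

(** [L] is a Lipschitz constant at [a], [dD] a version of the gradient, and [osc i] the relative
    linearization error on the ball of radius r / (i + 1). All are measurable on the whole space,
    while their properties are claimed on [D] only, the possibly nonmeasurable set where the family
    is regular. Domination of [osc] together with its pointwise limit is what the averages need. *)
Record local_linearization f D a (mb : T -> R) (r : R) (L : T -> R)
    (dD : 'I_p -> T -> R) (osc : nat -> T -> R) : Prop := LocalLinearization {
  ll_r : 0 < r;
  ll_mL : measurable_fun [set: T] L;
  ll_mD : forall j, measurable_fun [set: T] (dD j);
  ll_mosc : forall i, measurable_fun [set: T] (osc i);
  ll_L0 : forall z, 0 <= L z;
  ll_osc0 : forall i z, 0 <= osc i z;
  ll_D : forall z, D z -> forall j, dD j z = gradient (f z) a 0 j;
  ll_Lmb : forall z, D z -> L z <= p%:R * mb z;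
  ll_lip : forall z, D z -> forall h, `|h| < r -> `|f z (a + h) - f z a| <= L z * `|h|;
  ll_oscmb : forall i z, D z -> osc i z <= 2 * p%:R * mb z;
  ll_osc : forall i z, D z -> forall h, `|h| < r / i.+1%:R ->
    `|f z (a + h) - f z a - \sum_j dD j z * h 0 j| <= osc i z * `|h|;
  ll_osc_cvg : forall z, D z -> osc i z @[i --> \oo] --> 0 }.

(** Exhibits the partial derivatives as limits of countably many measurable quotients. *)
Lemma gradient_quotient (f : 'rV[R]_p -> R) a : differentiable (f : 'rV[R]_p -> R^o) a -> forall j,
  n.+1%:R * (f (a + n.+1%:R^-1 *: delta_mx 0 j) - f a) @[n --> \oo] --> gradient f a 0 j.
Proof.
move=> df j; apply/cvgrPdist_le => e e0.
set dl : 'rV[R]_p := delta_mx 0 j.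
have c0 : 0 < `|dl| + 1 by rewrite ltr_wpDl.
have [r r0 hr] := gradient_expansion df (divr_gt0 e0 c0).
have : \forall n \near \oo, (n.+1%:R^-1 : R) < r / (`|dl| + 1).
  exact: near_infty_natSinv_lt (PosNum (divr_gt0 r0 c0)).
apply: filterS => n hn.
have n0 : 0 < n.+1%:R :> R by [].
have hh : `|n.+1%:R^-1 *: dl| = n.+1%:R^-1 * `|dl| by rewrite normrZ ger0_norm.
have /hr : `|n.+1%:R^-1 *: dl| < r.
  rewrite hh; move: hn; rewrite ltr_pdivlMr // mulrDr mulr1; apply: le_lt_trans.
  by rewrite lerDl invr_ge0 ltW.
have -> : \sum_i gradient f a 0 i * (n.+1%:R^-1 *: dl) 0 i = n.+1%:R^-1 * gradient f a 0 j.
  rewrite (bigD1 j) //= big1 ?addr0 => [|i ij]; first by rewrite !mxE !eqxx mulr1 mulrC.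
  by rewrite !mxE (negbTE ij) andbF !mulr0.
rewrite hh => h.
have -> : gradient f a 0 j - n.+1%:R * (f (a + n.+1%:R^-1 *: dl) - f a) =
    - (n.+1%:R * (f (a + n.+1%:R^-1 *: dl) - f a - n.+1%:R^-1 * gradient f a 0 j)).
  by rewrite [in RHS]mulrBr mulrA divff ?gt_eqF // mul1r opprB.
rewrite normrN normrM (ger0_norm (ltW n0)) -ler_pdivlMl //.
apply: le_trans h _; rewrite mulrCA ler_wpM2l ?invr_ge0 ?(ltW n0) //.
by rewrite mulrAC ler_pdivrMr // ler_wpM2l ?(ltW e0) // lerDl.
Qed.

(** The mean value inequality on a ball inside [N] gives the Lipschitz and error bounds,
    differentiability at [a] alone gives the vanishing error, and the rational suprema make both
    measurable. *)
Lemma local_linearizationP f D a (N : set 'rV[R]_p) (mb : T -> R) :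
  (forall h, measurable_fun [set: T] (f ^~ h)) -> open_nbhs a N ->
  (forall z, D z -> continuously_differentiable_on (f z) N) ->
  (forall z, D z -> forall c, N c -> enorm (gradient (f z) c) <= mb z) ->
  exists r L dD osc, local_linearization f D a mb r L dD osc.
Proof.
move=> mf Na cN hmb.
have aN : N a by exact: nbhs_singleton (open_nbhs_nbhs Na).
have /nbhs_ballP [r /= r0 hr] := open_nbhs_nbhs Na.
have ballN (h : 'rV[R]_p) : `|h| < r -> N (a + h).
  by move=> hh; apply: hr; rewrite -ball_normE /ball_ /= opprD addNKr normrN.
have mb0 z : D z -> 0 <= mb z by move=> Dz; apply: le_trans (hmb z Dz a aN); exact: enorm_ge0.
pose dq (j : 'I_p) n z := n.+1%:R * (f z (a + n.+1%:R^-1 *: delta_mx 0 j) - f z a).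
(* The limit superior is defined and measurable off [D] as well; on [D] it is the partial
   derivative. *)
pose dD (j : 'I_p) z := fine (limn_esup (fun n => (dq j n z)%:E)).
pose g1 z (h : 'rV[R]_p) := f z (a + h) - f z a.
pose g2 z (h : 'rV[R]_p) := g1 z h - \sum_j dD j z * h 0 j.
pose L := ratio_sup g1 r; pose osc (i : nat) := ratio_sup g2 (r / i.+1%:R).
have mdD j : measurable_fun [set: T] (dD j).
  apply: measurableT_comp => //.
  apply: (@measurable_fun_limn_esup _ _ _ _ (fun n z => (dq j n z)%:E)) => n.
  apply: measurableT_comp => //; apply: measurable_funM; first exact: measurable_cst.
  exact: measurable_funB.
have mg1 h : measurable_fun [set: T] (g1 ^~ h) by exact: measurable_funB.
have dDE z j : D z -> dD j z = gradient (f z) a 0 j.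
  move=> Dz; have [df _] := cN z Dz a aN; have hq := @gradient_quotient _ _ df j.
  have hE : (dq j n z)%:E @[n --> \oo] --> (gradient (f z) a 0 j)%:E.
    by apply: cvg_comp hq _; exact: cvg_refl.
  by rewrite /dD (cvg_limn_einf_sup hE).2.
have lip z h : D z -> `|h| < r -> `|g1 z h| <= p%:R * mb z * `|h|.
  move=> Dz hh; apply: (mean_value_le (r := r)) => // c hc.
  have Nc : N c by rewrite -(subrK a c) addrC; exact: ballN.
  by split; [exact: (cN z Dz c Nc).1|exact: hmb].
have lip2 z h : D z -> `|h| < r -> `|g2 z h| <= 2 * p%:R * mb z * `|h|.
  move=> Dz hh; have := lip z h Dz hh; have := gradient_dot_le h (hmb z Dz a aN).
  have := ler_normB (g1 z h) (\sum_j gradient (f z) a 0 j * h 0 j).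
  have -> : g1 z h - \sum_j gradient (f z) a 0 j * h 0 j = g2 z h.
    by congr (_ - _); apply: eq_bigr => j _; rewrite dDE.
  lra.
have cg1 z h : D z -> `|h| < r -> {for h, continuous (g1 z)}.
  move=> Dz hh; have [df _] := cN z Dz (a + h) (ballN h hh).
  have h1 : f z (a + x) @[x --> h] --> f z (a + h).
    apply: (@continuous_comp _ _ _ (fun x => a + x) (f z)).
      have h2 : (a : 'rV[R]_p) + x @[x --> h] --> a + h.
        by apply: (@cvgD R 'rV[R]_p 'rV[R]_p (nbhs h) _ (fun=> a) id a h); [exact: cvg_cst|exact: cvg_id].
      exact: h2.
    exact: differentiable_continuous df.
  exact: cvgB h1 (cvg_cst _).
have cg2 z h : D z -> `|h| < r -> {for h, continuous (g2 z)}.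
  move=> Dz hh.
  have h1 : \sum_j dD j z * x 0 j @[x --> h] --> \sum_j dD j z * h 0 j.
    apply: cvg_big => [|j _]; first exact: add_continuous.
    by apply: cvgM; [exact: cvg_cst|exact: coord_continuous].
  exact: cvgB (cg1 z h Dz hh) h1.
have ri i h : `|h| < r / i.+1%:R -> `|h| < r.
  move=> hh; apply: lt_le_trans hh _; rewrite ler_pdivrMr // ler_pMr // ler1n //.
have pm0 z : D z -> 0 <= p%:R * mb z by move=> Dz; rewrite mulr_ge0 ?mb0.
have pm20 z : D z -> 0 <= 2 * p%:R * mb z by move=> Dz; rewrite -mulrA mulr_ge0 ?pm0.
exists r, L, dD, osc; split => //.
- exact: measurable_ratio_sup.
- move=> i; apply: measurable_ratio_sup => h; apply: measurable_funB; first exact: mg1.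
  by apply: measurable_sum => j; apply: measurable_funM.
- exact: ratio_sup_ge0.
- by move=> i z; exact: ratio_sup_ge0.
- by move=> z Dz j; exact: dDE.
- by move=> z Dz; apply: (ratio_supE _ _).2 => [|h]; [exact: pm0|exact: lip].
- by move=> z Dz h hh; apply: (ratio_supP (pm0 z Dz)) => // [h'|]; [exact: lip|exact: cg1].
- move=> i z Dz; apply: (ratio_supE _ _).2 => [|h hh]; first exact: pm20.
  by apply: lip2 => //; exact: ri hh.
- move=> i z Dz h hh; apply: (ratio_supP (pm20 z Dz)) => // [h' hh'|].
    by apply: lip2 => //; exact: ri hh'.
  by apply: cg2 => //; exact: ri hh.
- move=> z Dz; apply/cvgrPdist_le => e e0.
  have [df _] := cN z Dz a aN; have [r1 r10 h1] := gradient_expansion df e0.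
  have : \forall n \near \oo, (n.+1%:R^-1 : R) < r1 / r.
    exact: near_infty_natSinv_lt (PosNum (divr_gt0 r10 r0)).
  apply: filterS => i; rewrite ltr_pdivlMr // mulrC => hi.
  rewrite sub0r normrN ger0_norm; last exact: ratio_sup_ge0.
  apply: (ratio_supE _ _).2 => [|h hh]; first exact: ltW.
  have -> : g2 z h = f z (a + h) - f z a - \sum_j gradient (f z) a 0 j * h 0 j.
    by congr (_ - _); apply: eq_bigr => j _; rewrite dDE.
  by apply: h1; exact: lt_trans hh hi.
Qed.

End local_linearization.

(** * Sample averages of a stationary process *)

Section stationary_averages.
Context (R : realType) (d1 d2 : measure_display) (Omega : measurableType d1)
  (S : measurableType d2) (P : probability Omega R) (X : nat -> Omega -> S).
Hypothesis mX : forall t, measurable_fun [set: Omega] (X t).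
Hypothesis hstat : strictly_stationary P X.
Implicit Types (Z L : S -> S -> R).

Definition at_pair Z t (w : Omega) : R := Z (X t w) (X t.+1 w).
Definition avg Z (n : nat) (w : Omega) : R := n%:R^-1 * \sum_(t < n) at_pair Z t w.
Definition measurable2 Z := measurable_fun [set: S * S] (fun z => Z z.1 z.2).

Let pair0 (w : Omega) : (S * S)%type := (X 0%N w, X 1%N w).
Let mpair0 : measurable_fun [set: Omega] pair0.
Proof. by apply: measurable_fun_pair. Qed.
Let pair0f : {mfun Omega >-> (S * S)%type} := HB.pack pair0 (isMeasurableFun.Build _ _ _ _ pair0 mpair0).
Let nu : probability (S * S)%type R := distribution P pair0f.
Let mpair t : measurable_fun [set: Omega] (fun w => (X t w, X t.+1 w)).
Proof. by apply: measurable_fun_pair. Qed.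
Let lawt t B : measurable B -> P ((fun w => (X t w, X t.+1 w)) @^-1` B) = nu B.
Proof. by move=> mB; rewrite stationary_pair. Qed.

Lemma at_pair_fm Z t : measurable2 Z -> finite_mean P (at_pair Z 0%N) -> finite_mean P (at_pair Z t).
Proof. by move=> mZ /(law_fm (mpair 0%N) (@lawt 0%N) mZ) /(law_fm (mpair t) (@lawt t) mZ). Qed.

Lemma at_pair_Ex Z t : measurable2 Z -> finite_mean P (at_pair Z 0%N) ->
  Ex P (at_pair Z t) = Ex P (at_pair Z 0%N).
Proof.
move=> mZ /(law_fm (mpair 0%N) (@lawt 0%N) mZ) hZ.
by rewrite -[LHS](law_Ex (mpair t) (@lawt t) mZ hZ) -[RHS](law_Ex (mpair 0%N) (@lawt 0%N) mZ hZ).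
Qed.

Lemma at_pair_measurable Z t : measurable2 Z -> measurable_fun [set: Omega] (at_pair Z t).
Proof. by move=> mZ; exact: (measurableT_comp mZ (mpair t)). Qed.

Lemma avg_fm Z n : measurable2 Z -> finite_mean P (at_pair Z 0%N) -> finite_mean P (avg Z n).
Proof. by move=> mZ hZ; apply: fmZ; apply: (@fm_sum _ _ _ P _ (at_pair Z)) => t; exact: at_pair_fm. Qed.

Lemma Ex_avg_le Z n : measurable2 Z -> finite_mean P (at_pair Z 0%N) ->
  (forall x y, 0 <= Z x y) -> Ex P (avg Z n) <= Ex P (at_pair Z 0%N).
Proof.
move=> mZ hZ Z0; have hZt t := at_pair_fm t mZ hZ.
rewrite ExZ; last by apply: (@fm_sum _ _ _ P _ (at_pair Z)).
rewrite (@Ex_sum _ _ _ P _ (at_pair Z)) //.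
rewrite (eq_bigr (fun=> Ex P (at_pair Z 0%N))); last by move=> t _; exact: at_pair_Ex.
rewrite sumr_const card_ord.
case: n => [|n]; first by rewrite mulr0n mulr0 Ex_ge0 // => w; exact: Z0.
by rewrite -[X in _ * X]mulr_natl mulrA mulVf ?mul1r.
Qed.

Lemma avg_ge0 Z n w : (forall x y, 0 <= Z x y) -> 0 <= avg Z n w.
Proof. by move=> Z0; rewrite mulr_ge0 ?invr_ge0 ?sumr_ge0 // => t _; exact: Z0. Qed.

Lemma avg_le Z L n w : (forall t, (t < n)%N -> at_pair Z t w <= at_pair L t w) ->
  avg Z n w <= avg L n w.
Proof.
by move=> h; rewrite ler_wpM2l ?invr_ge0 //; apply: ler_sum => t _; exact: h.
Qed.

Lemma avg_abs Z n w : `|avg Z n w| <= avg (fun x y => `|Z x y|) n w.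
Proof.
rewrite normrM ger0_norm ?invr_ge0 //; apply: ler_wpM2l; first by rewrite invr_ge0.
exact: ler_norm_sum.
Qed.

Lemma op_scaled_avg (c : nat -> R) (Z : nat -> S -> S -> R) : (forall n, 0 <= c n) ->
  (forall n, measurable2 (Z n)) -> (forall n, finite_mean P (at_pair (Z n) 0%N)) ->
  c n * Ex P (fun w => `|at_pair (Z n) 0%N w|) @[n --> \oo] --> 0 ->
  op P (fun n w => c n * avg (Z n) n w).
Proof.
move=> c0 mZ hZ cv.
pose aZ n x y := `|Z n x y|.
have maZ n : measurable2 (aZ n) by exact: (measurableT_comp _ (mZ n)).
have haZ n : finite_mean P (at_pair (aZ n) 0%N) by exact: (fm_abs (hZ n)).
apply: (@op_L1 _ _ _ P _ (fun n w => c n * avg (aZ n) n w)).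
- by move=> n; apply: fmZ; exact: avg_fm.
- by move=> n w; rewrite normrM ger0_norm // ler_wpM2l // avg_abs.
- apply: (@squeeze_cvgr _ _ _ _ (fun=> 0) (fun n => c n * Ex P (fun w => `|at_pair (Z n) 0%N w|)) _ _ _ (cvg_cst 0) cv).
  apply: nearW => n; rewrite ExZ; last exact: avg_fm.
  rewrite mulr_ge0 //=; last by apply: Ex_ge0 => // w; apply: avg_ge0 => x y; rewrite /aZ.
  by rewrite ler_wpM2l // (Ex_avg_le _ (maZ n) (haZ n)) // => x y; rewrite /aZ.
Qed.

Lemma Op_avg Z : measurable2 Z -> finite_mean P (at_pair Z 0%N) -> Op P (avg Z).
Proof.
move=> mZ hZ; pose aZ x y := `|Z x y|.
have maZ : measurable2 aZ by exact: (measurableT_comp _ mZ).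
have haZ : finite_mean P (at_pair aZ 0%N) by exact: (fm_abs hZ).
apply: (@Op_L1 _ _ _ P _ (avg aZ) (Ex P (at_pair aZ 0%N))).
- by move=> n; exact: avg_fm.
- by move=> n w; exact: avg_abs.
- by apply: nearW => n; apply: Ex_avg_le => // x y; rewrite /aZ.
Qed.

Lemma op_sqrt (Y : nat -> Omega -> R) : op P Y -> op P (fun n w => Num.sqrt (Y n w)).
Proof.
move=> hY e e0; apply: small_sub (hY (e ^+ 2) (exprn_gt0 _ e0)) => n w /=.
rewrite ger0_norm ?sqrtr_ge0 // => h.
have Y0 : 0 <= Y n w by rewrite leNgt; apply/negP => /ltW /ler0_sqrtr h0; move: h; rewrite h0 leNgt e0.
rewrite ger0_norm // -(sqr_sqrtr Y0) ler_sqr // ?nnegrE ?sqrtr_ge0 //; exact: ltW.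
Qed.

(* the maximum over t < n of |g| is bounded by the l^2 norm *)
Lemma avg_max_le L Z n w : (forall x y, 0 <= L x y) ->
  avg (fun x y => L x y * `|Z x y|) n w <=
  Num.sqrt (n%:R * avg (fun x y => Z x y ^+ 2) n w) * avg L n w.
Proof.
move=> L0; rewrite /avg mulrCA ler_wpM2l ?invr_ge0 // mulr_sumr.
apply: ler_sum => t _; rewrite /at_pair mulrC ler_wpM2r //.
have n0 : n%:R != 0 :> R by rewrite pnatr_eq0 -lt0n (leq_ltn_trans _ (ltn_ord t)).
rewrite mulrA divff // mul1r -sqrtr_sqr ler_wsqrtr // (bigD1 t) //= lerDl.
by rewrite sumr_ge0 // => i _; exact: sqr_ge0.
Qed.

(** The quantity under the root is the sum of the squares over the sample. For projection errors of
    order o(n^{-1/2}) its mean tends to 0, so the largest error along the sample does too. *)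
Lemma op_max (Z : nat -> S -> S -> R) :
  (forall n, measurable2 (Z n)) -> (forall n, finite_mean P (fun w => at_pair (Z n) 0%N w ^+ 2)) ->
  n%:R * Ex P (fun w => at_pair (Z n) 0%N w ^+ 2) @[n --> \oo] --> 0 ->
  op P (fun n w => Num.sqrt (n%:R * avg (fun x y => Z n x y ^+ 2) n w)).
Proof.
move=> mZ hZ cv; apply: op_sqrt.
apply: (@op_scaled_avg (fun n => n%:R) (fun n x y => Z n x y ^+ 2)) => //.
  by move=> n; apply: measurable_funX; exact: mZ.
rewrite (_ : (fun n => _) = fun n => n%:R * Ex P (fun w => at_pair (Z n) 0%N w ^+ 2)) //.
apply/funext => n; congr (_ * Ex P _); apply/funext => w.
by rewrite ger0_norm // sqr_ge0.
Qed.

(** Expanding the product leaves df g, f dg and df dg. In each the projection errors are taken out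
    as maxima over the sample, so the weight [L] is averaged only against 1, |f| or |g|, for which
    moments are available. *)
Lemma op_replacement L (f g : S -> R) (df dg : nat -> S -> R) :
  measurable2 L -> (forall x y, 0 <= L x y) -> measurable_fun [set: S] f -> measurable_fun [set: S] g ->
  (forall n, measurable_fun [set: S] (df n)) -> (forall n, measurable_fun [set: S] (dg n)) ->
  finite_mean P (at_pair L 0%N) ->
  finite_mean P (fun w => at_pair L 0%N w * `|f (X 0%N w)|) ->
  finite_mean P (fun w => at_pair L 0%N w * `|g (X 1%N w)|) ->
  (forall n, finite_mean P (fun w => df n (X 0%N w) ^+ 2)) ->
  (forall n, finite_mean P (fun w => dg n (X 1%N w) ^+ 2)) ->
  n%:R * Ex P (fun w => df n (X 0%N w) ^+ 2) @[n --> \oo] --> 0 ->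
  n%:R * Ex P (fun w => dg n (X 1%N w) ^+ 2) @[n --> \oo] --> 0 ->
  op P (fun n w => avg (fun x y => L x y *
     `|(f x + df n x) * (g y + dg n y) - f x * g y|) n w).
Proof.
move=> mL L0 mf mg mdf mdg hL hLf hLg hdf hdg cdf cdg.
have m1 (h : S -> R) : measurable_fun [set: S] h -> measurable2 (fun x _ => h x).
  by move=> mh; apply: measurableT_comp mh _; exact: measurable_fst.
have m2 (h : S -> R) : measurable_fun [set: S] h -> measurable2 (fun _ y => h y).
  by move=> mh; apply: measurableT_comp mh _; exact: measurable_snd.
pose Mf n w := Num.sqrt (n%:R * avg (fun x y => df n x ^+ 2) n w).
pose Mg n w := Num.sqrt (n%:R * avg (fun x y => dg n y ^+ 2) n w).
have oMf : op P Mf by apply: (@op_max (fun n x _ => df n x)) => // n; exact: m1.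
have oMg : op P Mg by apply: (@op_max (fun n _ y => dg n y)) => // n; exact: m2.
have OLf : Op P (avg (fun x y => L x y * `|f x|)).
  apply: Op_avg => //; apply: measurable_funM => //.
  by apply: measurableT_comp => //; exact: m1.
have OLg : Op P (avg (fun x y => L x y * `|g y|)).
  apply: Op_avg => //; apply: measurable_funM => //.
  by apply: measurableT_comp => //; exact: m2.
have OL : Op P (avg L) by exact: Op_avg.
have o1 := Op_op_mul OLg oMf; have o2 := Op_op_mul OLf oMg.
have o3 := Op_op_mul OL (op_mul oMf oMg).
apply: op_le (opD (opD o1 o2) o3) _ => n w.
have Mf0 : 0 <= Mf n w by exact: sqrtr_ge0.
have Mg0 : 0 <= Mg n w by exact: sqrtr_ge0.
have AL := avg_ge0 n w L0.
have ALf : 0 <= avg (fun x y => L x y * `|f x|) n w by apply: avg_ge0 => x y; rewrite mulr_ge0.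
have ALg : 0 <= avg (fun x y => L x y * `|g y|) n w by apply: avg_ge0 => x y; rewrite mulr_ge0.
rewrite ger0_norm; last by apply: avg_ge0 => x y; rewrite mulr_ge0.
rewrite ger0_norm; last by apply: addr_ge0; [apply: addr_ge0|]; apply: mulr_ge0 => //; exact: mulr_ge0.
have b1 := avg_max_le (fun x y => df n x) n w (L := fun x y => L x y * `|g y|) (fun x y => mulr_ge0 (L0 x y) (normr_ge0 _)).
have b2 := avg_max_le (fun x y => dg n y) n w (L := fun x y => L x y * `|f x|) (fun x y => mulr_ge0 (L0 x y) (normr_ge0 _)).
have b3 := avg_max_le (fun x y => dg n y) n w (L := fun x y => L x y * `|df n x|) (fun x y => mulr_ge0 (L0 x y) (normr_ge0 _)).
have b4 := avg_max_le (fun x y => df n x) n w L0.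
apply: (@le_trans _ _ (avg (fun x y => L x y * `|g y| * `|df n x|) n w +
    avg (fun x y => L x y * `|f x| * `|dg n y|) n w +
    avg (fun x y => L x y * `|df n x| * `|dg n y|) n w)).
  rewrite /avg -!mulrDr ler_wpM2l ?invr_ge0 // -!big_split /=; apply: ler_sum => t _.
  rewrite /at_pair; set l := L _ _; have l0 : 0 <= l by exact: L0.
  rewrite -!mulrA -!mulrDr ler_wpM2l // -!normrM.
  set a := f _; set a' := df n _; set c := g _; set c' := dg n _.
  rewrite (_ : _ - _ = (c * a' + a * c') + a' * c'); last by ring.
  by apply: le_trans (ler_normD _ _) _; rewrite lerD2r ler_normD.
apply: lerD; first by apply: lerD; rewrite mulrC.
rewrite [leRHS](_ : _ = Mg n w * (Mf n w * avg L n w)); last by ring.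
exact: le_trans b3 (ler_wpM2l Mg0 b4).
Qed.

End stationary_averages.

Section approximation.
Context (R : realType) (d : measure_display) (Omega : measurableType d) (P : probability Omega R).

(** The index [i] is fixed first, by Markov's inequality uniformly in n; only then does n grow,
    which removes the bad events of that [i]. *)
Lemma op_approx (Y B : nat -> Omega -> R) (Z : nat -> nat -> Omega -> R) (c : nat -> R) :
  Op P B -> (forall i n, finite_mean P (Z i n)) -> (forall i n w, 0 <= Z i n w) ->
  (forall i n, Ex P (Z i n) <= c i) -> c i @[i --> \oo] --> 0 ->
  (forall i, small P (fun n => [set w | ~ `|Y n w| <= `|B n w| * Z i n w])) -> op P Y.
Proof.
move=> hB hZ Z0 Zc c0 bad e e0 eps ep; have e3 : 0 < eps / 3 by rewrite divr_gt0.
have [C C0 hC] := hB _ e3; have eC : 0 < e / C by rewrite divr_gt0.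
have /cvgrPdist_lt /(_ _ (mulr_gt0 e3 eC)) [i _ /(_ i (leqnn i))] := c0.
rewrite sub0r normrN => hi.
apply: filterS2 hC (bad i _ e3) => n p1 p2.
have p3 : prob_le P [set w | e / C <= Z i n w] (eps / 3).
  apply: prob_le_markov => //; apply: le_trans (Zc i n) (le_trans (ler_norm _) _).
  exact: ltW.
have -> : eps = eps / 3 + eps / 3 + eps / 3 by lra.
apply: prob_leS (prob_leU (prob_leU p1 p2) p3) => w /= hw.
have [h1|h1] := leP C `|B n w|; first by left; left.
have [h2|h2] := pselect (`|Y n w| <= `|B n w| * Z i n w); last by left; right.
right; rewrite ler_pdivrMr // mulrC; apply: le_trans (le_trans hw h2) _.
by rewrite ler_wpM2r // ltW.
Qed.

Lemma Op_abs (Y : nat -> Omega -> R) : Op P Y -> Op P (fun n w => `|Y n w|).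
Proof. by move=> h; apply: Op_le h _ => n w; rewrite normr_id. Qed.

End approximation.

Lemma norm_le_sum (R : realType) p (h : 'rV[R]_p) : `|h| <= \sum_j `|h 0 j|.
Proof.
rewrite [leLHS]/Num.Def.normr /= mx_normrE.
apply: bigmax_le => [|[i j] _ /=]; first exact: sumr_ge0.
by rewrite ord1 (bigD1 j) //= lerDl sumr_ge0.
Qed.

Lemma invr_sqrt_cvg0 (R : realType) : (Num.sqrt n%:R)^-1 @[n --> \oo] --> (0 : R).
Proof.
apply/cvgrPdist_le => e e0.
have e2 : 0 < e ^+ 2 by rewrite exprn_gt0.
have : \forall n \near \oo, (n.+1%:R^-1 : R) < e ^+ 2 by exact: near_infty_natSinv_lt (PosNum e2).
move=> [N _ hN]; exists N.+1 => // -[|n] //= nN.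
rewrite sub0r normrN ger0_norm ?invr_ge0 ?sqrtr_ge0 //.
have := hN n nN => /= h; rewrite -sqrtrV ?ler0n // -(ger0_norm (ltW e0)) -sqrtr_sqr.
by rewrite ler_wsqrtr // ltW.
Qed.

(** * Linearization of the sample averages in the estimated parameter *)

Section score_expansion.
Context (R : realType) (d1 d2 : measure_display) (Omega : measurableType d1)
  (S : measurableType d2) (P : probability Omega R) (X : nat -> Omega -> S).
Hypothesis mX : forall t, measurable_fun [set: Omega] (X t).
Hypothesis hstat : strictly_stationary P X.
Hypothesis herg : ergodic P X.
Context (p : nat) (m : S -> S -> 'rV[R]_p -> R) (a0 : 'rV[R]_p) (XX : set S).
Hypothesis hXX : forall t w, XX (X t w).
Context (mb : S * S -> R) (r : R) (L : S * S -> R) (dD : 'I_p -> S * S -> R)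
  (osc : nat -> S * S -> R).
Hypothesis hll : local_linearization (fun z => m z.1 z.2) (XX `*` XX) a0 mb r L dD osc.
Context (ah : nat -> Omega -> 'rV[R]_p).
Hypothesis hah : forall j, Op P (fun n w => Num.sqrt n%:R * (ah n w - a0) 0 j).
Context (f g : S -> R) (df dg : nat -> S -> R).
Hypothesis mf : measurable_fun [set: S] f.
Hypothesis mg : measurable_fun [set: S] g.
Hypothesis mdf : forall n, measurable_fun [set: S] (df n).
Hypothesis mdg : forall n, measurable_fun [set: S] (dg n).
Local Notation LL := (fun x y => L (x, y)).
Local Notation at0 := (fun w => (X 0%N w, X 1%N w)).
Hypothesis hL : finite_mean P (fun w => L (at0 w)).
Hypothesis hLf : finite_mean P (fun w => L (at0 w) * `|f (X 0%N w)|).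
Hypothesis hLg : finite_mean P (fun w => L (at0 w) * `|g (X 1%N w)|).
Hypothesis hdf : forall n, finite_mean P (fun w => df n (X 0%N w) ^+ 2).
Hypothesis hdg : forall n, finite_mean P (fun w => dg n (X 1%N w) ^+ 2).
Hypothesis cdf : n%:R * Ex P (fun w => df n (X 0%N w) ^+ 2) @[n --> \oo] --> 0.
Hypothesis cdg : n%:R * Ex P (fun w => dg n (X 1%N w) ^+ 2) @[n --> \oo] --> 0.
Hypothesis hfgm : finite_mean P (fun w => `|f (X 0%N w) * g (X 1%N w)| * (2 * p%:R * mb (at0 w))).
Hypothesis hfgD : forall j, finite_mean P (fun w => f (X 0%N w) * g (X 1%N w) * dD j (at0 w)).

Let sq n : R := Num.sqrt n%:R.
Let Dl n w : 'rV[R]_p := ah n w - a0.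
Let B n w : R := \sum_j `|sq n * Dl n w 0 j|.

Let B_Op : Op P B.
Proof. by apply: Op_sum => j; exact: Op_abs. Qed.

Let sq_norm n w : sq n * `|Dl n w| <= `|B n w|.
Proof.
apply: le_trans (ler_norm _); apply: le_trans (ler_wpM2l (sqrtr_ge0 _) (norm_le_sum _)) _.
by rewrite mulr_sumr; apply: ler_sum => j _; rewrite normrM ger0_norm ?sqrtr_ge0.
Qed.

Let Dl_op : op P (fun n w => `|Dl n w|).
Proof.
have o := Op_op_mul B_Op (@op_cst _ _ _ P _ (@invr_sqrt_cvg0 R)).
apply: (op_dom o) => eps ep.
exists 1%N => // n /= n0; exists set0; split => //; last by rewrite measure0 lee_fin ltW.
have s0 : 0 < sq n by rewrite sqrtr_gt0 ltr0n.
by move=> w /=; rewrite normr_id normrM [X in _ * X]ger0_norm ?invr_ge0 ?sqrtr_ge0 // ler_pdivlMr // mulrC; apply; exact: sq_norm.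
Qed.

Let bad e : 0 < e -> small P (fun n => [set w | e <= `|Dl n w|]).
Proof. by move=> e0; apply: small_sub (Dl_op e0) => n w /=; rewrite normr_id. Qed.

Let mfst (h : S -> R) : measurable_fun [set: S] h -> measurable2 (fun x _ => h x).
Proof. by move=> mh; apply: (measurableT_comp mh); exact: measurable_fst. Qed.
Let msnd (h : S -> R) : measurable_fun [set: S] h -> measurable2 (fun _ y => h y).
Proof. by move=> mh; apply: (measurableT_comp mh); exact: measurable_snd. Qed.

Let mLL : measurable2 LL.
Proof. by rewrite /measurable2; under eq_fun do rewrite -surjective_pairing; exact: ll_mL hll. Qed.
Let mosc i : measurable2 (fun x y => osc i (x, y)).
Proof. by rewrite /measurable2; under eq_fun do rewrite -surjective_pairing; exact: (ll_mosc hll). Qed.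
Let mdD j : measurable2 (fun x y => dD j (x, y)).
Proof. by rewrite /measurable2; under eq_fun do rewrite -surjective_pairing; exact: (ll_mD hll). Qed.
Let XX2 t w : (XX `*` XX) (X t w, X t.+1 w).
Proof. by split; exact: hXX. Qed.
Let mfg : measurable2 (fun x y => f x * g y).
Proof. by apply: measurable_funM; [exact: mfst|exact: msnd]. Qed.

(** Replaces the perturbed functions by f and g. As soon as the estimator is within [r], the
    Lipschitz bound makes this at most [B], which is O_p(1), times the average treated by
    [op_replacement]. *)
Let remA : op P (fun n w => sq n * avg X (fun x y =>
  ((f x + df n x) * (g y + dg n y) - f x * g y) * (m x y (ah n w) - m x y a0)) n w).
Proof.
have L0 x y : 0 <= L (x, y) by exact: ll_L0 hll _.
have o := op_replacement mX hstat mLL L0 mf mg mdf mdg hL hLf hLg hdf hdg cdf cdg.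
apply: op_dom (Op_op_mul B_Op o) _.
apply: small_sub (bad (ll_r hll)) => n w /= h; rewrite leNgt; apply/negP => hr; apply: h.
rewrite [leLHS]normrM [leRHS]normrM [X in _ <= _ * X]ger0_norm; last by apply: avg_ge0 => x y; rewrite mulr_ge0.
rewrite (ger0_norm (sqrtr_ge0 _)).
apply: (@le_trans _ _ (sq n * (`|Dl n w| * avg X (fun x y => L (x, y) *
     `|(f x + df n x) * (g y + dg n y) - f x * g y|) n w))); last first.
  by rewrite mulrA ler_wpM2r // avg_ge0 // => x y; rewrite mulr_ge0.
rewrite ler_wpM2l ?sqrtr_ge0 //; apply: le_trans (avg_abs _ _ _ _) _.
rewrite [leRHS](_ : _ = avg X (fun x y => `|Dl n w| * (L (x, y) *
     `|(f x + df n x) * (g y + dg n y) - f x * g y|)) n w); last first.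
  by rewrite /avg mulrCA; congr (_ * _); rewrite mulr_sumr.
apply: avg_le => t _; rewrite /at_pair normrM mulrC mulrA ler_wpM2r //.
by have := ll_lip hll (XX2 t w) hr; rewrite /Dl subrKC /= mulrC.
Qed.

(** The linearization error is at most [B] times the average of |f g| [osc i] once the estimator is
    within r / (i + 1). The mean of that average tends to 0 in [i] by dominated convergence. *)
Let remB : op P (fun n w => sq n * avg X (fun x y => (f x * g y) *
  (m x y (ah n w) - m x y a0 - \sum_j dD j (x, y) * Dl n w 0 j)) n w).
Proof.
pose Z i x y := `|f x * g y| * osc i (x, y).
have mZ i : measurable2 (Z i) by apply: measurable_funM (mosc i); exact: (measurableT_comp _ mfg).
have osc0 i x y : 0 <= osc i (x, y) by exact: (ll_osc0 hll).
have Z0 i x y : 0 <= Z i x y by rewrite mulr_ge0.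
have Zle i w : Z i (X 0%N w) (X 1%N w) <= `|f (X 0%N w) * g (X 1%N w)| * (2 * p%:R * mb (at0 w)).
  by apply: ler_wpM2l => //; exact: (ll_oscmb hll _ (XX2 0 w)).
have hZ i : finite_mean P (at_pair X (Z i) 0%N).
  apply: fm_le hfgm; first exact: (at_pair_measurable mX).
  by move=> w; rewrite ger0_norm //; [exact: Zle|exact: Z0].
apply: (@op_approx _ _ _ P _ B (fun i n => avg X (Z i) n) (fun i => Ex P (at_pair X (Z i) 0%N))) => //.
- by move=> i n; exact: avg_fm.
- by move=> i n w; exact: avg_ge0.
- by move=> i n; exact: Ex_avg_le.
- rewrite -[X in _ --> X](_ : Ex P (fun=> 0) = 0); last by rewrite Ex_cst.
  apply: (Ex_dominated_cvg (g := fun w => `|f (X 0%N w) * g (X 1%N w)| * (2 * p%:R * mb (at0 w)))) => //.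
  + by move=> i; exact: at_pair_measurable.
  + apply: nearW => w; rewrite /at_pair /Z -[X in _ --> X](mulr0 `|f (X 0%N w) * g (X 1%N w)|).
    by apply: cvgM; [exact: cvg_cst|exact: (ll_osc_cvg hll (XX2 0 w))].
  + by move=> i; apply: nearW => w; rewrite ger0_norm //; [exact: Zle|exact: Z0].
- move=> i; have ri : 0 < r / i.+1%:R by rewrite divr_gt0 // (ll_r hll).
  apply: small_sub (bad ri) => n w /= h; rewrite leNgt; apply/negP => hr; apply: h.
  rewrite normrM (ger0_norm (sqrtr_ge0 _)).
  apply: (@le_trans _ _ (sq n * (`|Dl n w| * avg X (Z i) n w))); last first.
    by rewrite mulrA ler_wpM2r // avg_ge0.
  rewrite ler_wpM2l ?sqrtr_ge0 //; apply: le_trans (avg_abs _ _ _ _) _.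
  rewrite [leRHS](_ : _ = avg X (fun x y => `|Dl n w| * Z i x y) n w); last first.
    by rewrite /avg mulrCA; congr (_ * _); rewrite mulr_sumr.
  apply: avg_le => t _; rewrite /at_pair normrM mulrCA ler_wpM2l //.
  by have := ll_osc hll (XX2 t w) hr; rewrite /Dl subrKC /= mulrC.
Qed.

(** Besides the two remainders above, the averages of the derivative are replaced by their means:
    the ergodic theorem provides o_p(1), the scaled estimation error O_p(1). *)
Lemma score_expansion : op P (fun n w =>
  sq n * avg X (fun x y => (f x + df n x) * (g y + dg n y) * (m x y (ah n w) - m x y a0)) n w -
  \sum_j Ex P (fun w => f (X 0%N w) * g (X 1%N w) * dD j (at0 w)) * (sq n * (ah n w - a0) 0 j)).
Proof.
pose h j := Ex P (fun w => f (X 0%N w) * g (X 1%N w) * dD j (at0 w)).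
pose W j x y := f x * g y * dD j (x, y).
have mW j : measurable2 (W j) by exact: measurable_funM mfg (mdD j).
have remC : op P (fun n w => \sum_j (sq n * Dl n w 0 j) * (avg X (W j) n w - h j)).
  apply: op_sum => j; apply: Op_op_mul => //.
  apply: op_ae => [n|e e0].
    apply: measurable_funB => //; apply: measurable_funM => //.
    by apply: measurable_sum => t; exact: at_pair_measurable.
  exact: (@pair_ergodic_average _ _ _ _ _ P X mX hstat herg (W j) e (mW j) (hfgD j) e0).
apply: op_eq (opD (opD remA remB) remC) _ => n w.
have -> : \sum_j (sq n * Dl n w 0 j) * (avg X (W j) n w - h j) =
    sq n * avg X (fun x y => (f x * g y) * \sum_j dD j (x, y) * Dl n w 0 j) n w -
    \sum_j h j * (sq n * Dl n w 0 j).
  under eq_bigr do rewrite mulrBr.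
  rewrite sumrB; congr (_ - _); last by apply: eq_bigr => j _; rewrite mulrC.
  rewrite /avg mulrCA mulr_sumr.
  under [in RHS]eq_bigr do rewrite /at_pair mulr_sumr mulr_sumr.
  rewrite exchange_big mulr_sumr; apply: eq_bigr => j _.
  rewrite mulrCA mulr_sumr; congr (_ * _); apply: eq_bigr => t _.
  by rewrite /at_pair /W; ring.
rewrite addrA; congr (_ - _); rewrite -!mulrDr; congr (_ * _).
rewrite /avg -?mulrDr -!big_split /=; congr (_ * _); apply: eq_bigr => t _; rewrite /at_pair; ring.
Qed.

End score_expansion.

(** * Projection errors in bilinear averages *)

Section bilinear_averages.
Context (R : realType) (d1 d2 : measure_display) (Omega : measurableType d1)
  (S : measurableType d2) (P : probability Omega R) (Q : probability S R)
  (X : nat -> Omega -> S).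
Hypothesis mX : forall t, measurable_fun [set: Omega] (X t).
Hypothesis law : forall t B, measurable B -> P (X t @^-1` B) = Q B.
Hypothesis hstat : strictly_stationary P X.
Local Notation ipQ := (@ipL R d2 S Q).
Local Notation nrm := (snorm ipQ).
Let hip := semi_ip_L2 Q.

(** Replacing one argument at a time leaves forms with one small factor, and an L^1 bound by the
    product of the norms, multiplied by sqrt n, tends to 0. The abstract form covers both products
    at one time and products weighted by m at two times. *)
Lemma op_bilinear (Phi : L2T Q -> L2T Q -> S -> S -> R) (C : R)
  (U V : L2T Q) (u v : nat -> L2T Q) :
  (forall f g, measurable2 (Phi f g)) -> (forall f g, finite_mean P (at_pair X (Phi f g) 0%N)) ->
  (forall f g, Ex P (fun w => `|at_pair X (Phi f g) 0%N w|) <= C * nrm f * nrm g) ->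
  (forall f g f' g' x y, Phi f g x y - Phi f' g' x y = Phi (f - f') g x y + Phi f' (g - g') x y) ->
  Num.sqrt n%:R * nrm (u n - U) @[n --> \oo] --> 0 ->
  Num.sqrt n%:R * nrm (v n - V) @[n --> \oo] --> 0 ->
  op P (fun n w => Num.sqrt n%:R *
    avg X (fun x y => Phi (u n) (v n) x y - Phi U V x y) n w).
Proof.
move=> mPhi hPhi bPhi lPhi cu cv.
pose a n := Num.sqrt n%:R * nrm (u n - U); pose b n := Num.sqrt n%:R * nrm (v n - V).
have fmZ' n : finite_mean P (at_pair X (fun x y => Phi (u n) (v n) x y - Phi U V x y) 0%N).
  exact: (fmB (hPhi _ _) (hPhi _ _)).
apply: (op_scaled_avg mX hstat) => //.
  by move=> n; exact: measurable_funB (mPhi _ _) (mPhi _ _).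
have C0' f g : 0 <= C * nrm f * nrm g by apply: le_trans (bPhi f g); exact: Ex_ge0.
have cK : `|C| * (a n * (nrm V + b n) + nrm U * b n) @[n --> \oo] --> 0.
  have -> : (0 : R) = `|C| * (0 * (nrm V + 0) + nrm U * 0) by ring.
  apply: cvgM; first exact: cvg_cst.
  apply: cvgD; apply: cvgM => //; last exact: cvg_cst.
  by apply: cvgD => //; exact: cvg_cst.
apply: (@squeeze_cvgr _ _ _ _ (fun=> 0) _ _ _ _ (cvg_cst 0) cK).
exists 1%N => // n /= n0; rewrite mulr_ge0 ?sqrtr_ge0 //=; last exact: Ex_ge0.
have s1 : 1 <= Num.sqrt n%:R :> R by rewrite -[leLHS]sqrtr1 ler_wsqrtr // ler1n.
have s0 : 0 <= Num.sqrt n%:R :> R by exact: sqrtr_ge0.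
have nV : nrm (v n) <= nrm V + b n.
  have := snormD hip V (v n - V); rewrite addrC subrK => h; apply: le_trans h _.
  by rewrite lerD2l /b ler_peMl // snorm_ge0.
have CC f g : C * nrm f * nrm g <= `|C| * (nrm f * nrm g).
  by rewrite -mulrA ler_wpM2r ?ler_norm // mulr_ge0 // snorm_ge0.
have hE : Ex P (fun w => `|at_pair X (fun x y => Phi (u n) (v n) x y - Phi U V x y) 0%N w|) <=
    `|C| * (nrm (u n - U) * nrm (v n)) + `|C| * (nrm U * nrm (v n - V)).
  apply: le_trans (lerD (le_trans (bPhi _ _) (CC (u n - U) (v n)))
    (le_trans (bPhi _ _) (CC U (v n - V)))).
  rewrite -ExD; [|exact: fm_abs|exact: fm_abs].
  apply: Ex_le; [exact: fm_abs|by apply: fmD; exact: fm_abs|move=> w].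
  by rewrite /at_pair lPhi; exact: ler_normD.
apply: le_trans (ler_wpM2l s0 hE) _.
rewrite [leLHS](_ : _ = `|C| * (a n * nrm (v n) + nrm U * b n)); last by rewrite /a /b; ring.
rewrite ler_wpM2l // lerD2r ler_wpM2l //.
by rewrite mulr_ge0 ?sqrtr_ge0 ?snorm_ge0.
Qed.

Lemma scaled_sqr_cvg (U : L2T Q) (u : nat -> L2T Q) t :
  Num.sqrt n%:R * nrm (u n - U) @[n --> \oo] --> 0 ->
  (forall n, finite_mean P (fun w => L2fun (u n - U) (X t w) ^+ 2)) /\
  n%:R * Ex P (fun w => L2fun (u n - U) (X t w) ^+ 2) @[n --> \oo] --> 0.
Proof.
move=> cu.
have fmn n : finite_mean Q (fun x => L2fun (u n - U) x ^+ 2) by apply: L2_sqr; exact: L2fun_L2.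
have mn n : measurable_fun [set: S] (fun x => L2fun (u n - U) x ^+ 2).
  by apply: measurable_funX; exact: (L2_measurable (L2fun_L2 _)).
split=> [n|]; first exact/(law_fm (mX t) (@law t) (mn n)).
rewrite (_ : (fun n => _) = fun n => (Num.sqrt n%:R * nrm (u n - U)) ^+ 2).
  by rewrite -[X in _ --> X](expr0n R 2); apply: (@cvg_comp _ _ _ _ (fun x : R => x ^+ 2) _ _ _ cu); exact: exprn_continuous.
apply/funext => n; rewrite -(law_Ex (mX t) (@law t) (mn n) (fmn n)) Ex_sqr_L2.
by rewrite exprMn (sqr_sqrtr (ler0n R n)).
Qed.

Lemma op_bilinear_marginal (U V : L2T Q) (u v : nat -> L2T Q) :
  Num.sqrt n%:R * nrm (u n - U) @[n --> \oo] --> 0 ->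
  Num.sqrt n%:R * nrm (v n - V) @[n --> \oo] --> 0 ->
  op P (fun n w => Num.sqrt n%:R * avg X (fun x _ =>
    L2fun (u n) x * L2fun (v n) x - L2fun U x * L2fun V x) n w).
Proof.
move=> cu cv.
have mfun (f : L2T Q) : measurable_fun [set: S] (L2fun f) by exact: (L2_measurable (L2fun_L2 _)).
have mP (f g : L2T Q) : measurable_fun [set: S] (fun x => L2fun f x * L2fun g x).
  exact: measurable_funM.
have fP (f g : L2T Q) : finite_mean Q (fun x => L2fun f x * L2fun g x).
  by apply: L2_fmM; exact: L2fun_L2.
apply: (@op_bilinear (fun f g x _ => L2fun f x * L2fun g x) 1 U V u v) => //.
- by move=> f g; apply: (measurableT_comp (mP f g)); exact: measurable_fst.
- move=> f g; exact/(law_fm (mX 0%N) (@law 0%N) (mP f g)).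
- move=> f g; rewrite /at_pair.
  rewrite -(@law_Ex _ _ _ _ _ P Q _ (mX 0%N) (@law 0%N) (fun x => `|L2fun f x * L2fun g x|)).
  + have := L2_fmM_bound (L2fun_L2 f) (L2fun_L2 g); rewrite mul1r.
    by congr (_ <= _ * _); congr snorm; apply: val_inj.
  + exact: (measurableT_comp _ (mP f g)).
  + exact: (fm_abs (fP f g)).
- by move=> f g f' g' x _; rewrite !L2funB; ring.
Qed.

Context (m : S -> S -> R).
Hypothesis mm : measurable2 m.
Hypothesis mpos : {ae P, forall w, 0 < m (X 0%N w) (X 1%N w)}.
Hypothesis hM : Mop_bounded P Q X m.

(** The required L^1 bound is that of [Mop_pair], which holds for all square-integrable
    functions. *)
Lemma op_bilinear_pair (U V : L2T Q) (u v : nat -> L2T Q) :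
  Num.sqrt n%:R * nrm (u n - U) @[n --> \oo] --> 0 ->
  Num.sqrt n%:R * nrm (v n - V) @[n --> \oo] --> 0 ->
  op P (fun n w => Num.sqrt n%:R * avg X (fun x y =>
    L2fun (u n) x * m x y * L2fun (v n) y - L2fun U x * m x y * L2fun V y) n w).
Proof.
move=> cu cv; have [C C0 hC] := MopH_bounded_linear mX law hM.
have mfun (f : L2T Q) : measurable_fun [set: S] (L2fun f) by exact: (L2_measurable (L2fun_L2 _)).
have mm0 : measurable_fun [set: Omega] (fun w => m (X 0%N w) (X 1%N w)).
  by exact: (at_pair_measurable mX 0 mm).
have pr f g := Mop_pair mX law mm0 mpos hC (L2fun_L2 f) (L2fun_L2 g).
apply: (@op_bilinear (fun f g x y => L2fun f x * m x y * L2fun g y) C U V u v) => //.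
- move=> f g; apply: measurable_funM; first apply: measurable_funM => //.
  + by apply: (measurableT_comp (mfun f)); exact: measurable_fst.
  + by apply: (measurableT_comp (mfun g)); exact: measurable_snd.
- by move=> f g; have [h _ _] := pr f g.
- move=> f g; have [_ _ h] := pr f g; move: h.
  by congr (_ <= _ * _ * _); congr snorm; apply: val_inj.
- by move=> f g f' g' x y; rewrite !L2funB; ring.
Qed.

End bilinear_averages.

(** * Linearization of the sample eigenvalue *)

Lemma inv_sqrtmP (R : realType) k (G : 'M[R]_k) :
  (posdefmx (inv_sqrtm G) /\ inv_sqrtm G *m inv_sqrtm G = invmx G) \/ inv_sqrtm G = 0.
Proof. by rewrite /inv_sqrtm; case: xgetP => [s -> h|]; [left|right]. Qed.

Lemma op_near_eq (R : realType) d (Omega : measurableType d) (P : probability Omega R)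
  (Y Z : nat -> Omega -> R) : (\forall n \near \oo, forall w, Y n w = Z n w) -> op P Z -> op P Y.
Proof.
move=> YZ hZ e e0; apply: small_near_sub (hZ e e0).
by apply: filterS YZ => n h w /=; rewrite h.
Qed.

(** Writing sqrt n as the square of n^{1/4} spreads it over the two factors of the quadratic
    remainder. *)
Lemma sqrt_powR (R : realType) n : (0 < n)%N ->
  0 < (n%:R : R) `^ (- 4^-1) /\ Num.sqrt n%:R = ((n%:R : R) `^ (- 4^-1))^-1 ^+ 2.
Proof.
move=> n0; have n0' : 0 < n%:R :> R by rewrite ltr0n.
split; first exact: powR_gt0.
rewrite powRN invrK -powR_mulrn ?powR_ge0 // -powRrM -powR12_sqrt ?ler0n //.
by congr (_ `^ _); lra.
Qed.

Section linearization.
Context (R : realType) (d1 d2 : measure_display) (Omega : measurableType d1)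
  (S : measurableType d2) (P : probability Omega R) (Q : probability S R)
  (X : nat -> Omega -> S) (m : S -> S -> R).
Hypothesis mX : forall t, measurable_fun [set: Omega] (X t).
Hypothesis law : forall t B, measurable B -> P (X t @^-1` B) = Q B.
Hypothesis mm : measurable_fun [set: Omega] (fun w => m (X 0%N w) (X 1%N w)).
Hypothesis mpos : {ae P, forall w, 0 < m (X 0%N w) (X 1%N w)}.
Hypothesis hM : Mop_bounded P Q X m.
Local Notation ipQ := (@ipL R d2 S Q).
Local Notation nrm := (snorm ipQ).
Local Notation TH := (MopH hM).
Let hip := semi_ip_L2 Q.
Context (C rho e0 : R) (phi phis : L2T Q).
Hypothesis te : top_eigenvalue ipQ TH C rho e0 phi phis.
Context (b : forall k : nat, 'I_k -> S -> R).
Arguments b : clear implicits.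
Hypothesis hb : forall k i, L2 Q (b k i).
Hypothesis hind : forall k, lin_indep Q (b k).
Arguments hb : clear implicits.
Arguments hind : clear implicits.
Context (k : nat -> nat).
Hypothesis hk : k n @[n --> \oo] --> \oo.
Context (Mh Gh : forall n, Omega -> 'M[R]_(k n)).
Local Notation G n := (Gmat P X (b (k n))).
Local Notation s n := (inv_sqrtm (G n)).
Local Notation Mo n := (orthonormalized (G n) (Mmat P X m (b (k n)))).
Local Notation Gho n w := (orthonormalized (G n) (Gh n w)).
Local Notation Mho n w := (orthonormalized (G n) (Mh n w)).
Hypothesis hG1 : little_op P (fun n w => mx_opnorm (Gho n w - 1%:M)) (fun=> 1).

Definition sieve_basis n := ortho_basis (hb (k n)) (s n).
Arguments sieve_basis : clear implicits.
Definition sieve_proj (f : L2T Q) n : L2T Q :=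
  lincomb (sieve_basis n) (coords ipQ (sieve_basis n) f).

Lemma sieve_dim_gt0 : \forall n \near \oo, (0 < k n)%N.
Proof. by have := hk (nbhs_infty_gt 0%N). Qed.

(** That the chosen square root is genuine follows from consistency: with the default 0 the error
    would be at least 1 on all of [Omega], hence with probability 1, which is impossible for large
    n. *)
Lemma inv_sqrtm_near : \forall n \near \oo,
  [/\ (0 < k n)%N, (s n)^T = s n & s n *m s n = invmx (gram (hb (k n)))].
Proof.
have [A [mA hA PA]] := hG1 (ltr01 : 0 < 1 :> R).
have PA' : fine (P (A n)) @[n --> \oo] --> (0 : R) by apply: fine_cvg.
have /cvgrPdist_lt /(_ _ ltr01) hP := PA'.
apply: filterS2 hP sieve_dim_gt0 => n Pn kn.
have [[[sT _] ss]|s0] := inv_sqrtmP (G n).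
  by split => //; rewrite ss (Gmat_gram mX law (hb (k n))).
have AT : A n = setT.
  apply/seteqP; split => // w _; apply: hA => /=; rewrite mulr1.
  apply: le_trans (ler_norm _); rewrite /orthonormalized s0 !mul0mx.
  by case: (k n) kn => // j _; exact: mx_opnorm_N1.
by move: Pn; rewrite AT probability_setT /= sub0r normrN normr1 ltxx.
Qed.

Lemma sieve_proj_dist (f : L2T Q) : 
  ((Num.sqrt n%:R)%:E * L2norm Q (orth_proj Q (b (k n)) (L2fun f) \- L2fun f)%R)%E @[n --> \oo]
    --> 0%E ->
  Num.sqrt n%:R * nrm (sieve_proj f n - f) @[n --> \oo] --> 0.
Proof.
move=> hc.
have hc' : (Num.sqrt n%:R * nrm (sieve_proj f n - f))%:E @[n --> \oo] --> 0%:E.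
  apply: cvg_trans hc; apply: near_eq_cvg; apply: filterS inv_sqrtm_near => n [_ sT ss].
  by rewrite (orth_proj_dist (hind (k n)) sT ss) EFinM (snorm_distC hip).
exact: (fine_cvg hc').
Qed.

Hypothesis hM1 : little_op P (fun n w => mx_opnorm (Mho n w - Mo n)) (fun=> 1).
Hypothesis hop : op_norm Q (fun psi => orth_proj Q (b (k n)) (Mop P X m psi) \- Mop P X m psi)
  @[n --> \oo] --> 0%E.
Hypothesis hphi : ((Num.sqrt n%:R)%:E *
  L2norm Q (orth_proj Q (b (k n)) (L2fun phi) \- L2fun phi)%R)%E @[n --> \oo] --> 0%E.
Hypothesis hphis : ((Num.sqrt n%:R)%:E *
  L2norm Q (orth_proj Q (b (k n)) (L2fun phis) \- L2fun phis)%R)%E @[n --> \oo] --> 0%E.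
Hypothesis hG4 : little_op P (fun n w => mx_opnorm (Gho n w - 1%:M)) (fun n => n%:R `^ (- 4^-1)).
Hypothesis hM4 : little_op P (fun n w => mx_opnorm (Mho n w - Mo n)) (fun n => n%:R `^ (- 4^-1)).
Context (rhohat : nat -> Omega -> R).
Hypothesis hrho : forall n w r, largest_gen_eigenvalue (Mh n w) (Gh n w) r -> rhohat n w = r.

Let a n := nrm (phi - sieve_proj phi n).
Let as_ n := nrm (phis - sieve_proj phis n).
Let eta n w := mx_opnorm (Gho n w - 1%:M) + mx_opnorm (Mho n w - Mo n).
Let q n : R := (n%:R `^ (- 4^-1))^-1.

Let opnorm_ge0 n (A : 'M[R]_(k n)) : (0 < k n)%N -> 0 <= mx_opnorm A.
Proof. by move: A; case: (k n) => // j A _; exact: mx_opnorm_ge0. Qed.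

Let sqrt_ge1 n : (0 < n)%N -> 1 <= Num.sqrt n%:R :> R.
Proof. by move=> n0; rewrite -[leLHS]sqrtr1 ler_wsqrtr // ler1n. Qed.

Let rate_a (f : L2T Q) : Num.sqrt n%:R * nrm (sieve_proj f n - f) @[n --> \oo] --> 0 ->
  q n * nrm (f - sieve_proj f n) @[n --> \oo] --> 0 /\
  nrm (f - sieve_proj f n) @[n --> \oo] --> 0.
Proof.
move=> hc; split; apply: (@squeeze_cvgr _ _ _ _ (fun=> 0) _ _ _ _ (cvg_cst 0) hc);
    exists 1%N => // n /= n0; rewrite (snorm_distC hip).
  have [q0 qE] := sqrt_powR R n0; have q1 : 0 <= q n by rewrite invr_ge0 ltW.
  rewrite mulr_ge0 ?snorm_ge0 //= ler_wpM2r ?snorm_ge0 //.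
  have := sqrt_ge1 n0; rewrite qE -/(q n) => h.
  have [h1|h1] := leP 1 (q n); first by rewrite expr2 ler_peMl.
  by nra.
by rewrite snorm_ge0 /= ler_peMl ?snorm_ge0 // sqrt_ge1.
Qed.

(** On the event where [eta] is below the threshold, the deterministic expansion applies and sqrt n
    times its remainder is a constant times the square of n^{1/4} (eta + a + as_), each term of
    which is o_p(1). *)
Lemma rhohat_linearization : op P (fun n w => Num.sqrt n%:R * (rhohat n w - rho) -
  Num.sqrt n%:R * dotc (coords ipQ (sieve_basis n) phis)
    ((Mho n w - rho *: Gho n w) *m coords ipQ (sieve_basis n) phi)).
Proof.
have [x0 x00 [D D0 hexp]] := largest_gen_eigenvalue_expansion te.
have [qa0 a0] := rate_a (sieve_proj_dist hphi).
have [qas0 as0] := rate_a (sieve_proj_dist hphis).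
have q4 : \forall n \near \oo, (0 : R) < n%:R `^ (- 4^-1).
  by exists 1%N => // n n0; have [] := sqrt_powR R n0.
have oeta : op P eta by apply: opD; exact: little_op1.
have oqeta : op P (fun n w => eta n w * q n).
  apply: op_eq (opD (little_op_op q4 hG4) (little_op_op q4 hM4)) _ => n w.
  by rewrite -mulrDl.
have oth : op P (fun n w => eta n w * q n + (q n * a n + q n * as_ n)).
  exact: opD oqeta (opD (@op_cst _ _ _ P _ qa0) (@op_cst _ _ _ P _ qas0)).
have osq : op P (fun n w => D * (eta n w * q n + (q n * a n + q n * as_ n)) ^+ 2).
  by apply: opZ; exact: op_mul.
apply: op_dom osq _.
have near : \forall n \near \oo, [/\ (0 < n)%N, a n <= x0, as_ n <= x0,
    [/\ (0 < k n)%N, (s n)^T = s n & s n *m s n = invmx (gram (hb (k n)))] &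
    (op_norm Q (fun psi => (orth_proj Q (b (k n)) (Mop P X m psi) \- Mop P X m psi)%R) <= x0%:E)%E].
  have h1 : \forall n \near \oo, (0 < n)%N by exists 1%N.
  have /cvgrPdist_le /(_ _ x00) h2 := a0.
  have /cvgrPdist_le /(_ _ x00) h3 := as0.
  have h4 : \forall n \near \oo, (op_norm Q (fun psi =>
      (orth_proj Q (b (k n)) (Mop P X m psi) \- Mop P X m psi)%R) < x0%:E)%E.
    have h5 : nbhs (0 : \bar R)%E [set y | (y < x0%:E)%E].
      apply: open_nbhs_nbhs; split; first exact: open_ereal_lt_ereal.
      by rewrite /= lte_fin.
    exact: hop _ h5.
  apply: filterS3 (filterI h1 h2) (filterI h3 h4) inv_sqrtm_near => n [p1 p2] [p3 p4] p5.
  split=> //; last exact: ltW.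
    by apply: le_trans p2; rewrite sub0r normrN; exact: ler_norm.
  by apply: le_trans p3; rewrite sub0r normrN; exact: ler_norm.
apply: (@small_near_sub _ _ _ _ _ (fun n => [set w | x0 <= `|eta n w|])); last exact: oeta.
apply: filterS near => n [n0 an asn [kn sT ss] hopn] w /= hbad.
rewrite leNgt; apply/negP => heta; apply: hbad.
have e1 := opnorm_ge0 (Gho n w - 1%:M) kn; have e2 := opnorm_ge0 (Mho n w - Mo n) kn.
have eta0 : 0 <= eta n w by rewrite addr_ge0.
have oe := ortho_basisP (hind (k n)) sT ss.
have x0' : 0 <= x0 by exact: ltW.
(* The operator projection error matters only through its smallness, so [x0] itself serves as
   [eps]. *)
have [|||||||l hl hw] := hexp _ (sieve_basis n) oe (Mho n w) (Gho n w) x0 (eta n w).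
- exact: (proj_op_norm (te_lin te) sT (hind (k n)) ss x0' hopn).
- move=> v; rewrite -(Mmat_compression mX law mm mpos (te_lin te) (hb (k n)) sT).
  apply: le_trans (mx_opnorm_le _ _) _; rewrite ler_wpM2r ?enorm_ge0 //.
  by rewrite /eta lerDr.
- move=> v; apply: le_trans (mx_opnorm_le _ _) _; rewrite ler_wpM2r ?enorm_ge0 //.
  by rewrite /eta lerDl.
- by rewrite eta0 /= ltW //; move: heta; rewrite ger0_norm.
- by rewrite x0' lexx.
- exact: an.
- exact: asn.
have su := s_unit (hind (k n)) ss.
rewrite (hrho (largest_gen_eigenvalue_congr su hl)) -mulrBr normrM ger0_norm ?sqrtr_ge0 //.
rewrite [leRHS]ger0_norm; last by rewrite mulr_ge0 // sqr_ge0.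
apply: le_trans (ler_wpM2l (sqrtr_ge0 _) hw) _.
have [_ ->] := sqrt_powR R n0; rewrite -/(q n).
have alg (y e x z c : R) : y ^+ 2 * (c * (e + x + z) ^+ 2) = c * (e * y + (y * x + y * z)) ^+ 2.
  by ring.
by rewrite (alg (q n) (eta n w) (a n) (as_ n) D).
Qed.

End linearization.

(** * Moment bounds for the derivative envelope *)

Section moments.
Context (R : realType) (d1 d2 : measure_display) (Omega : measurableType d1)
  (S : measurableType d2) (P : probability Omega R) (Q : probability S R)
  (X : nat -> Omega -> S).
Hypothesis mX : forall t, measurable_fun [set: Omega] (X t).
Hypothesis law : forall t B, measurable B -> P (X t @^-1` B) = Q B.
Context (p : nat) (m : S -> S -> 'rV[R]_p -> R) (a0 : 'rV[R]_p) (XX : set S).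
Hypothesis hXX : forall t w, XX (X t w).
Context (mbar : S -> S -> R) (s : R) (r : R) (L : S * S -> R) (dD : 'I_p -> S * S -> R)
  (osc : nat -> S * S -> R).
Let mb (z : S * S) := mbar z.1 z.2.
Hypothesis hll : local_linearization (fun z => m z.1 z.2) (XX `*` XX) a0 mb r L dD osc.
Local Notation at0 := (fun w => (X 0%N w, X 1%N w)).
Hypothesis grad_le : forall x y, XX x -> XX y -> enorm (gradient (m x y) a0) <= mbar x y.
Hypothesis s2 : 2 <= s.
Hypothesis hmb : finite_mean P (fun w => mbar (X 0%N w) (X 1%N w) `^ s).

Let mpair : measurable_fun [set: Omega] at0. Proof. by apply: measurable_fun_pair. Qed.
Let s0 : 0 < s. Proof. by move: s2; lra. Qed.
Let XX2 w : (XX `*` XX) (at0 w). Proof. by split; exact: hXX. Qed.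
Let mb0 w : 0 <= mb (at0 w).
Proof. by apply: le_trans (grad_le (hXX 0%N w) (hXX 1%N w)); exact: enorm_ge0. Qed.
Let mL : measurable_fun [set: Omega] (fun w => L (at0 w)).
Proof. exact: (measurableT_comp (ll_mL hll) mpair). Qed.
Let L0 w : 0 <= L (at0 w). Proof. exact: ll_L0 hll _. Qed.

Let mb_powR w (k : nat) : (k <= 2)%N -> mb (at0 w) ^+ k <= 1 + mb (at0 w) `^ s.
Proof.
move=> k2; have [h|h] := leP (mb (at0 w)) 1.
  by apply: (@le_trans _ _ 1); [exact: exprn_ile1|rewrite lerDl powR_ge0].
apply: (@le_trans _ _ (mb (at0 w) `^ s)); last by rewrite lerDr.
rewrite -powR_mulrn //; apply: ler_powR; first exact: ltW.
apply: le_trans s2.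
by rewrite ler_nat.
Qed.

Lemma lipschitz_fm : finite_mean P (fun w => L (at0 w)).
Proof.
apply: (fm_le mL _ (fmZ p%:R (fmD (fm_cst P 1) hmb))) => w.
rewrite ger0_norm //; apply: le_trans (ll_Lmb hll (XX2 w)) _.
by rewrite ler_wpM2l //; have := mb_powR w (isT : (1 <= 2)%N); rewrite expr1.
Qed.

Lemma lipschitz_sqr_fm : finite_mean P (fun w => L (at0 w) ^+ 2).
Proof.
apply: (fm_le _ _ (fmZ (p%:R ^+ 2) (fmD (fm_cst P 1) hmb))) => [|w]; first exact: measurable_funX.
rewrite ger0_norm ?sqr_ge0 //; apply: (@le_trans _ _ ((p%:R * mb (at0 w)) ^+ 2)).
  rewrite ler_sqr ?nnegrE; [exact: (ll_Lmb hll (XX2 w))|exact: L0|by rewrite mulr_ge0 ?(mb0 w)].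
by rewrite exprMn ler_wpM2l ?sqr_ge0 // (mb_powR w (isT : (2 <= 2)%N)).
Qed.

(** As s >= 2 makes L square-integrable, the elementary bound L |f| <= L^2 + f^2 suffices. *)
Lemma lipschitz_L2_fm (f : S -> R) t : L2 Q f ->
  finite_mean P (fun w => L (at0 w) * `|f (X t w)|).
Proof.
move=> hf.
have mf : measurable_fun [set: Omega] (fun w => f (X t w)).
  exact: (measurableT_comp (L2_measurable hf) (mX t)).
have hf2 : finite_mean P (fun w => f (X t w) ^+ 2).
  apply/(law_fm (mX t) (@law t) (f := fun x => f x ^+ 2)); last exact: L2_sqr.
  exact: (measurable_funX _ (L2_measurable hf)).
apply: (fm_le _ _ (fmD lipschitz_sqr_fm hf2)) => [|w].
  by apply: measurable_funM => //; exact: measurableT_comp.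
rewrite ger0_norm ?mulr_ge0 // -(real_normK (num_real (f (X t w)))).
by have := sqr_ge0 (L (at0 w) - `|f (X t w)|); have := L0 w; have := normr_ge0 (f (X t w)); nra.
Qed.

Context (f g : S -> R).
Hypothesis mf : measurable_fun [set: S] f.
Hypothesis mg : measurable_fun [set: S] g.
Hypothesis fpos : {ae Q, forall x, 0 < f x}.
Hypothesis gpos : {ae Q, forall x, 0 < g x}.
Hypothesis hfg : finite_mean P (fun w => (g (X 1%N w) * f (X 0%N w)) `^ (s / (s - 1))).

Let y w := `|f (X 0%N w) * g (X 1%N w)|.
Let mfg : measurable_fun [set: Omega] (fun w => f (X 0%N w) * g (X 1%N w)).
Proof.
by apply: measurable_funM; [exact: (measurableT_comp mf (mX 0%N))|exact: (measurableT_comp mg (mX 1%N))].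
Qed.

(** The given moment concerns the signed product; positivity almost everywhere identifies it with
    its absolute value. *)
Let y_fm : finite_mean P (fun w => y w `^ (s / (s - 1))).
Proof.
apply: (ae_fm _ _ hfg).
  by apply: (measurableT_comp (measurable_powR _)); exact: measurableT_comp.
have h0 := law_ae (mX 0%N) (@law 0%N) fpos; have h1 := law_ae (mX 1%N) (@law 1%N) gpos.
apply: filterS2 h0 h1 => w f0 g0; rewrite /y ger0_norm ?mulr_ge0 ?(ltW f0) ?(ltW g0) //.
by rewrite mulrC.
Qed.

(** Measurability of the envelope is recovered from that of its s-th power by taking the s-th root
    of a nonnegative number. *)
Let mmb : measurable_fun [set: Omega] (fun w => mb (at0 w)).
Proof.
rewrite (_ : (fun w => _) = fun w => (mbar (X 0%N w) (X 1%N w) `^ s) `^ s^-1).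
  apply: (measurableT_comp (measurable_powR _)); exact: fm_measurable hmb.
by apply/funext => w; rewrite -powRrM divff ?gt_eqF // powRr1 //; exact: mb0.
Qed.

(** Young's inequality with the conjugate exponents s / (s - 1) and s. *)
Lemma product_mbar_fm (c : R) : 0 <= c -> finite_mean P (fun w => y w * (c * mb (at0 w))).
Proof.
move=> c0; apply: (fm_le _ _ (fmZ c (fmD y_fm hmb))) => [|w].
  apply: measurable_funM; first exact: measurableT_comp.
  by apply: measurable_funM => //; exact: measurable_cst.
have y0 : 0 <= y w by exact: normr_ge0.
rewrite ger0_norm; last by rewrite !mulr_ge0.
rewrite mulrCA ler_wpM2l //.
have q0 : 0 < s / (s - 1) by rewrite divr_gt0 //; have := s2; lra.
have pq : (s / (s - 1))^-1 + s^-1 = 1.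
  by field; rewrite !gt_eqF //; have := s2; lra.
apply: le_trans (conjugate_powR y0 (mb0 w) q0 s0 pq) _.
have s1 : 1 <= s by have := s2; lra.
have q1 : 1 <= s / (s - 1) by rewrite ler_pdivlMr; have := s2; lra.
by apply: lerD; rewrite ler_pdivrMr // ler_peMr ?powR_ge0.
Qed.

Lemma product_gradient_fm j :
  finite_mean P (fun w => f (X 0%N w) * g (X 1%N w) * dD j (at0 w)).
Proof.
apply: (fm_le _ _ (product_mbar_fm ler01)) => [|w].
  by apply: measurable_funM => //; exact: (measurableT_comp (ll_mD hll j) mpair).
rewrite normrM ler_wpM2l // mul1r (ll_D hll (XX2 w)).
by apply: le_trans (abs_le_enorm _ _ _) _; exact: grad_le (hXX 0%N w) (hXX 1%N w).
Qed.

End moments.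

(** * Expansion of the sample eigenvalue *)

Section sample_eigenvalue.
Context (R : realType) (d1 d2 : measure_display) (Omega : measurableType d1)
  (S : measurableType d2) (P : probability Omega R) (Q : probability S R)
  (X : nat -> Omega -> S).
Hypothesis mX : forall t, measurable_fun [set: Omega] (X t).
Hypothesis law : forall t B, measurable B -> P (X t @^-1` B) = Q B.
Hypothesis hstat : strictly_stationary P X.
Hypothesis herg : ergodic P X.
Context (p : nat) (m : S -> S -> 'rV[R]_p -> R) (a0 : 'rV[R]_p) (XX : set S).
Hypothesis hXX : forall t w, XX (X t w).
Hypothesis mm : forall a, measurable2 (fun x y => m x y a).
Context (N : set 'rV[R]_p) (mbar : S -> S -> R) (s : R).
Hypothesis hN : open_nbhs a0 N.
Hypothesis cdm : forall x y, XX x -> XX y -> continuously_differentiable_on (m x y) N.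
Hypothesis s2 : 2 <= s.
Hypothesis hmb : finite_mean P (fun w => mbar (X 0%N w) (X 1%N w) `^ s).
Hypothesis grad_le : forall x y, XX x -> XX y ->
  forall a, N a -> enorm (gradient (m x y) a) <= mbar x y.
Context (phi phis : S -> R).
Hypothesis hphi : L2 Q phi.
Hypothesis hphis : L2 Q phis.
Hypothesis phi_pos : {ae Q, forall x, 0 < phi x}.
Hypothesis phis_pos : {ae Q, forall x, 0 < phis x}.
Hypothesis hprod : finite_mean P (fun w => (phi (X 1%N w) * phis (X 0%N w)) `^ (s / (s - 1))).
Context (ah : nat -> Omega -> 'rV[R]_p).
Hypothesis hah : forall j, Op P (fun n w => Num.sqrt n%:R * (ah n w - a0) 0 j).
Local Notation ipQ := (@ipL R d2 S Q).
Local Notation nrm := (snorm ipQ).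
Local Notation U := (toL2 hphis).
Local Notation V := (toL2 hphi).

Let h (j : 'I_p) := Ex P (fun w => phis (X 0%N w) * phi (X 1%N w) *
  gradient (m (X 0%N w) (X 1%N w)) a0 0 j).

Lemma score_expansion_L2 (u v : nat -> L2T Q) :
  Num.sqrt n%:R * nrm (u n - U) @[n --> \oo] --> 0 ->
  Num.sqrt n%:R * nrm (v n - V) @[n --> \oo] --> 0 ->
  op P (fun n w => Num.sqrt n%:R * avg X (fun x y => L2fun (u n) x * L2fun (v n) y *
      (m x y (ah n w) - m x y a0)) n w - \sum_j h j * (Num.sqrt n%:R * (ah n w - a0) 0 j)).
Proof.
move=> cu cv.
have a0N : N a0 by exact: nbhs_singleton (open_nbhs_nbhs hN).
have [|||r [L [dD [osc hll]]]] := @local_linearizationP R p _ (S * S)%type (fun z => m z.1 z.2)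
    (XX `*` XX) a0 N (fun z => mbar z.1 z.2) _ hN.
- by move=> a; exact: mm.
- by move=> z [z1 z2]; exact: cdm.
- by move=> z [z1 z2] c Nc; exact: grad_le.
have grad0 x y : XX x -> XX y -> enorm (gradient (m x y) a0) <= mbar x y.
  by move=> hx hy; exact: grad_le.
have hL := lipschitz_fm mX hXX hll grad0 s2 hmb.
have hLf := lipschitz_L2_fm mX law hXX hll grad0 s2 hmb 0 hphis.
have hLg := lipschitz_L2_fm mX law hXX hll grad0 s2 hmb 1 hphi.
have mphi := L2_measurable hphi; have mphis := L2_measurable hphis.
have hfgm : finite_mean P (fun w => `|phis (X 0%N w) * phi (X 1%N w)| *
    (2 * p%:R * (fun z => mbar z.1 z.2) (X 0%N w, X 1%N w))).
  apply: (product_mbar_fm mX law hXX grad0 s2 hmb mphis mphi phis_pos phi_pos hprod).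
  by rewrite mulr_ge0.
have hfgD := product_gradient_fm mX law hXX hll grad0 s2 hmb mphis mphi phis_pos phi_pos hprod.
have [fu cu'] := scaled_sqr_cvg mX law 0 cu; have [fv cv'] := scaled_sqr_cvg mX law 1 cv.
have mL2 (f : L2T Q) : measurable_fun [set: S] (L2fun f) by exact: (L2_measurable (L2fun_L2 f)).
have main := score_expansion mX hstat herg hXX hll hah mphis mphi
  (fun n => mL2 (u n - U)) (fun n => mL2 (v n - V)) hL hLf hLg fu fv cu' cv' hfgm hfgD.
apply: op_eq main _ => n w; congr (_ * _ - _).
  rewrite /avg; congr (_ * _); apply: eq_bigr => t _.
  by rewrite /at_pair !L2funB !toL2K !(addrC _ (_ - _)) !subrK.
apply: eq_bigr => j _; congr (_ * _); congr Ex; apply/funext => w'.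
by rewrite (ll_D hll) //; split; exact: hXX.
Qed.

Local Notation m0 := (fun x y => m x y a0).
Hypothesis mpos : {ae P, forall w, 0 < m0 (X 0%N w) (X 1%N w)}.
Hypothesis hM : Mop_bounded P Q X m0.
Context (C rho e0 : R).
Hypothesis te : top_eigenvalue ipQ (MopH hM) C rho e0 V U.
Context (b : forall k : nat, 'I_k -> S -> R).
Arguments b : clear implicits.
Hypothesis hb : forall k i, L2 Q (b k i).
Hypothesis hind : forall k, lin_indep Q (b k).
Context (k : nat -> nat).
Hypothesis hk : k n @[n --> \oo] --> \oo.
Local Notation Gh n w := (Ghat (b (k n)) (fun t => X t w) n).
Local Notation Mh n w := (Mhat (fun x y => m x y (ah n w)) (b (k n)) (fun t => X t w) n).
Local Notation G n := (Gmat P X (b (k n))).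
Local Notation Mo n := (orthonormalized (G n) (Mmat P X m0 (b (k n)))).
Local Notation Gho n w := (orthonormalized (G n) (Gh n w)).
Local Notation Mho n w := (orthonormalized (G n) (Mh n w)).
Hypothesis hG1 : little_op P (fun n w => mx_opnorm (Gho n w - 1%:M)) (fun=> 1).
Hypothesis hM1 : little_op P (fun n w => mx_opnorm (Mho n w - Mo n)) (fun=> 1).
Hypothesis hop : op_norm Q (fun psi => orth_proj Q (b (k n)) (Mop P X m0 psi) \- Mop P X m0 psi)
  @[n --> \oo] --> 0%E.
Hypothesis hPphi : ((Num.sqrt n%:R)%:E *
  L2norm Q (orth_proj Q (b (k n)) phi \- phi)%R)%E @[n --> \oo] --> 0%E.
Hypothesis hPphis : ((Num.sqrt n%:R)%:E *
  L2norm Q (orth_proj Q (b (k n)) phis \- phis)%R)%E @[n --> \oo] --> 0%E.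
Hypothesis hG4 : little_op P (fun n w => mx_opnorm (Gho n w - 1%:M)) (fun n => n%:R `^ (- 4^-1)).
Hypothesis hM4 : little_op P (fun n w => mx_opnorm (Mho n w - Mo n)) (fun n => n%:R `^ (- 4^-1)).
Context (rhohat : nat -> Omega -> R).
Hypothesis hrho : forall n w r, largest_gen_eigenvalue (Mh n w) (Gh n w) r -> rhohat n w = r.

(** The main term is a bilinear average at the projected eigenfunctions and the estimated parameter.
    Terms [o2] and [o3] restore the eigenfunctions at the true parameter; [o4] handles the parameter
    increment, still weighted by the projections. *)
Lemma sample_eigenvalue_expansion : op P (fun n w => Num.sqrt n%:R * (rhohat n w - rho) -
  ((Num.sqrt n%:R)^-1 * \sum_(t < n) psi_rho m0 rho phi phis (X t w) (X t.+1 w) +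
   \sum_j h j * (Num.sqrt n%:R * (ah n w - a0) 0 j))).
Proof.
have hPV : ((Num.sqrt n%:R)%:E *
    L2norm Q (orth_proj Q (b (k n)) (L2fun V) \- L2fun V)%R)%E @[n --> \oo] --> 0%E.
  by rewrite toL2K.
have hPU : ((Num.sqrt n%:R)%:E *
    L2norm Q (orth_proj Q (b (k n)) (L2fun U) \- L2fun U)%R)%E @[n --> \oo] --> 0%E.
  by rewrite toL2K.
pose u := sieve_proj P X hb k U; pose v := sieve_proj P X hb k V.
have cu : Num.sqrt n%:R * nrm (u n - U) @[n --> \oo] --> 0.
  exact: (sieve_proj_dist mX law hb hind hk hG1 hPU).
have cv : Num.sqrt n%:R * nrm (v n - V) @[n --> \oo] --> 0.
  exact: (sieve_proj_dist mX law hb hind hk hG1 hPV).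
have mm0 : measurable_fun [set: Omega] (fun w => m0 (X 0%N w) (X 1%N w)).
  exact: (at_pair_measurable mX 0 (mm a0)).
have o1 := rhohat_linearization mX law mm0 mpos te hb hind hk hG1 hM1 hop hPV hPU hG4 hM4 hrho.
have o2 := op_bilinear_pair mX law hstat (mm a0) mpos hM cu cv.
have o3 := op_bilinear_marginal mX law hstat cu cv.
have o4 := score_expansion_L2 cu cv.
apply: op_near_eq (opD o1 (opD (opB o2 (opZ rho o3)) o4)).
apply: filterS (inv_sqrtm_near mX law hb hk hG1) => n [_ sT _] w.
rewrite mulmxBl -scalemxAl.
have dotcBZ (x y z : 'cV[R]_(k n)) : dotc x (y - rho *: z) = dotc x y - rho * dotc x z.
  rewrite /dotc mulr_sumr -sumrB; apply: eq_bigr => i _.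
  by rewrite [X in _ * X]mxE [X in _ + X]mxE [X in - X]mxE; ring.
rewrite dotcBZ (dotc_Mhat (@hb (k n)) sT) (dotc_Ghat (@hb (k n)) sT).
(* The identity also covers n = 0, where both sides vanish by the convention for the inverse of
   0. *)
have -> : (Num.sqrt n%:R)^-1 * \sum_(t < n) psi_rho m0 rho phi phis (X t w) (X t.+1 w) =
    Num.sqrt n%:R * (n%:R^-1 * \sum_(t < n) psi_rho m0 rho phi phis (X t w) (X t.+1 w)).
  rewrite mulrA; congr (_ * _); case: (n) => [|n']; first by rewrite sqrtr0 invr0 mul0r.
  have s0 : Num.sqrt n'.+1%:R != 0 :> R by rewrite gt_eqF // sqrtr_gt0 ltr0n.
  rewrite -[X in _ = _ * X^-1](sqr_sqrtr (ler0n R n'.+1)) expr2 invfM mulrA divff //.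
  by rewrite mul1r.
rewrite [RHS]addrCA; apply/eqP; rewrite -subr_eq0; apply/eqP.
set A := Num.sqrt n%:R; set B := \sum_j h j * _; set Z := A * (_ - rho).
rewrite -[lincomb _ (coords _ _ U)]/(u n) -[lincomb _ (coords _ _ V)]/(v n) /avg.
(* Summand by summand, the score is the projected form at the estimated parameter minus the three
   replacement terms. *)
rewrite (_ : \sum_(t < n) psi_rho m0 rho phi phis (X t w) (X t.+1 w) =
  \sum_(t < n) (L2fun (u n) (X t w) * m (X t w) (X t.+1 w) (ah n w) * L2fun (v n) (X t.+1 w)) -
  rho * \sum_(t < n) (L2fun (u n) (X t w) * L2fun (v n) (X t w)) -
  (\sum_(t < n) at_pair X (fun x y => L2fun (u n) x * m0 x y * L2fun (v n) y -
      L2fun U x * m0 x y * L2fun V y) t w -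
   rho * \sum_(t < n) at_pair X (fun x _ => L2fun (u n) x * L2fun (v n) x - L2fun U x * L2fun V x) t w +
   \sum_(t < n) at_pair X (fun x y => L2fun (u n) x * L2fun (v n) y *
      (m x y (ah n w) - m x y a0)) t w)); last first.
  rewrite !mulr_sumr -!sumrB -!big_split -sumrB; apply: eq_bigr => t _.
  by rewrite /at_pair /psi_rho !toL2K /=; ring.
ring.
Qed.

End sample_eigenvalue.

(** * Verification of the spectral hypotheses *)

Lemma lincomb_coords (R : realType) (H : lmodType R) (ip : H -> H -> R) k (e : 'I_k -> H) f :
  lincomb e (coords ip e f) = \sum_i ip f (e i) *: e i.
Proof. by apply: eq_bigr => i _; rewrite mxE. Qed.

Section operator_instance.
Context (R : realType) (d1 d2 : measure_display) (Omega : measurableType d1)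
  (S : measurableType d2) (P : probability Omega R) (Q : probability S R)
  (X : nat -> Omega -> S) (m : S -> S -> R).
Hypothesis mX : forall t, measurable_fun [set: Omega] (X t).
Hypothesis law : forall t B, measurable B -> P (X t @^-1` B) = Q B.
Hypothesis mm : measurable_fun [set: Omega] (fun w => m (X 0%N w) (X 1%N w)).
Hypothesis mpos : {ae P, forall w, 0 < m (X 0%N w) (X 1%N w)}.
Hypothesis hM : Mop_bounded P Q X m.
Local Notation ipQ := (@ipL R d2 S Q).
Local Notation T := (Mop P X m).
Context (rho : R) (phi phis : S -> R).
Hypothesis hphi : L2 Q phi.
Hypothesis hphis : L2 Q phis.
Hypothesis phi1 : L2norm Q phi = 1%E.
Hypothesis phiphis : inner Q phi phis = 1.
Hypothesis rho0 : 0 < rho.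
Hypothesis hphieig : {ae Q, forall x, T phi x = rho * phi x}.
Hypothesis hphisadj : {ae Q, forall x, Mop_adj P X m phis x = rho * phis x}.
Hypothesis hsimple : simple_eigenvalue Q T (Complex rho 0).
Hypothesis hisol : isolated_eigenvalue Q T (Complex rho 0).
Hypothesis hlarge : largest_eigenvalue Q T rho.
Context (b : forall k : nat, 'I_k -> S -> R).
Arguments b : clear implicits.
Hypothesis hb : forall k i, L2 Q (b k i).
Hypothesis hind : forall k, lin_indep Q (b k).
Context (k : nat -> nat).
Hypothesis hk : k n @[n --> \oo] --> \oo.
Context (Gh : forall n, Omega -> 'M[R]_(k n)).
Hypothesis hG1 : little_op P (fun n w =>
  mx_opnorm (orthonormalized (Gmat P X (b (k n))) (Gh n w) - 1%:M)) (fun=> 1).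
Hypothesis hop : op_norm Q (fun psi => orth_proj Q (b (k n)) (T psi) \- T psi)
  @[n --> \oo] --> 0%E.

(** For each tolerance one large n is enough: the projected operator is close in norm, and the
    orthonormalized sieve is a genuine orthonormal family. *)
Lemma finite_rank_approx_Mop : finite_rank_approx ipQ (MopH hM).
Proof.
move=> eps e0; have [C C0 hC] := MopH_bounded_linear mX law hM.
have h4 : \forall n \near \oo, (op_norm Q (fun psi =>
    (orth_proj Q (b (k n)) (Mop P X m psi) \- Mop P X m psi)%R) < eps%:E)%E.
  have h5 : nbhs (0 : \bar R)%E [set y | (y < eps%:E)%E].
    by apply: open_nbhs_nbhs; split; [exact: open_ereal_lt_ereal|rewrite /= lte_fin].
  exact: hop _ h5.
have [n [h1 [_ sT ss]]] := filter_ex (filterI h4 (inv_sqrtm_near mX law hb hk hG1)).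
exists (k n), (ortho_basis (@hb (k n)) (inv_sqrtm (Gmat P X (b (k n))))); split.
  exact: (ortho_basisP (@hind (k n)) sT ss).
move=> f; rewrite -lincomb_coords.
exact: (proj_op_norm hC sT (@hind (k n)) ss (ltW e0) (ltW h1) f).
Qed.

Lemma top_eigenvalue_Mop : exists C e0,
  top_eigenvalue ipQ (MopH hM) C rho e0 (toL2 hphi) (toL2 hphis).
Proof.
have [C C0 hC] := MopH_bounded_linear mX law hM.
have [_ [e ep hiso]] := hisol.
have eig : snorm ipQ (MopH hM (toL2 hphi) - rho *: toL2 hphi) = 0.
  by apply: snorm_ae_eq; apply: filterS hphieig => x hx; rewrite L2funZ toL2K.
have norm1 : snorm ipQ (toL2 hphi) = 1.
  by apply: EFin_inj; rewrite snorm_L2 toL2K.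
(* The minimum with rho / 2 keeps the range of eigenvalues positive; halving [e'] again turns a weak
   inequality into the strict one that isolation requires. *)
pose e' := Num.min e (rho / 2).
have e'0 : 0 < e' by rewrite lt_min ep divr_gt0.
have e'r : e' < rho by rewrite gt_min; apply/orP; right; have := rho0; lra.
exists C, (e' / 2); split => //.
- exact: semi_ip_L2.
- exact: complete_L2.
- exact: finite_rank_approx_Mop.
- exact: (Mop_adjoint mX law mm mpos hC hphis hphisadj).
- by rewrite divr_gt0.
- by have := e'r; have := rho0; lra.
- move=> l f; apply: (no_other_top_eigenvalue mX law e'0 e'r hlarge) => z hz hlt.
  by apply: hiso hz _; apply: lt_le_trans hlt _; rewrite ge_min lexx.
- by move=> f; exact: (simple_real mX law hsimple norm1 eig).
Qed.

End operator_instance.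

(** * Normal limit *)

Section normal_limit.
Context (R : realType) (d1 : measure_display) (Omega : measurableType d1)
  (P : probability Omega R).

Lemma measurable_row_of_tuple q (a : 'rV[R]_q) :
  measurable_fun [set: Rvec R q] (fun z => (a *m (row_of_tuple z)^T) 0 0).
Proof.
rewrite (_ : (fun z => _) = fun z => \sum_j a 0 j * tnth z j).
  apply: measurable_sum => j; apply: measurable_funM; first exact: measurable_cst.
  exact: measurable_tnth.
by apply/funext => z; rewrite mxE; apply: eq_bigr => j _; rewrite !mxE.
Qed.

Lemma continuous_dot q (a : 'rV[R]_q) : continuous (fun y : 'rV[R]_q => (a *m y^T) 0 0 : R).
Proof.
have E : (fun y : 'rV[R]_q => (a *m y^T) 0 0) = (fun y : 'rV[R]_q => \sum_j a 0 j * y 0 j).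
  by apply/funext => z; rewrite mxE; apply: eq_bigr => j _; rewrite !mxE.
have main (h : 'rV[R]_q) : \sum_j a 0 j * x 0 j @[x --> h] --> \sum_j a 0 j * h 0 j.
  apply: cvg_big => [|j _]; first exact: add_continuous.
  by apply: cvgM; [exact: cvg_cst|exact: coord_continuous].
rewrite E; exact: main.
Qed.

(** Continuous mapping under a linear functional, then Slutsky's lemma. The law of the functional
    under [mu] is normal by the very definition of [is_normal_vec], and a change of variables moves
    the limit to the line. *)
Lemma cvg_normal_linear q (V : 'M[R]_q) (a : 'rV[R]_q) (Y : nat -> Omega -> 'rV[R]_q)
    (W : nat -> Omega -> R) :
  (forall n j, measurable_fun [set: Omega] (fun w => Y n w 0 j)) ->
  (forall n, measurable_fun [set: Omega] (W n)) ->
  cvg_normal_vec P Y V -> op P (fun n w => W n w - \sum_j a 0 j * Y n w 0 j) ->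
  cvg_normal P W ((a *m V *m a^T) 0 0).
Proof.
move=> mY mW [mu [_ hmu] hY] hWY.
have [_ hlaw] := hmu a.
have hlin := cvg_in_dist_comp (@continuous_dot q a) hY.
have mZ := measurable_row_of_tuple a.
have aE n w : (a *m (Y n w)^T) 0 0 = \sum_j a 0 j * Y n w 0 j.
  by rewrite mxE; apply: eq_bigr => j _; rewrite mxE.
have mWY n : measurable_fun [set: Omega] (fun w => (a *m (Y n w)^T) 0 0).
  under eq_fun do rewrite aE.
  by apply: measurable_sum => j; apply: measurable_funM => //; exact: measurable_cst.
have hU : cvg_in_dist P mu W (fun z => (a *m (row_of_tuple z)^T) 0 0).
  apply: (slutsky mW mWY mZ hlin); apply: op_eq hWY _ => n w; by rewrite aE.
move=> f cf [c hc]; have := hU f cf (ex_intro _ c hc).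
have mf : measurable_fun [set: measurableTypeR R] f by exact: continuous_measurable_fun.
rewrite -[X in _ --> X -> _]/(Ex mu (fun z => f ((a *m (row_of_tuple z)^T) 0 0))).
rewrite -(law_Ex (nu := normal_law ((a *m V *m a^T) 0 0)) mZ hlaw mf) //.
exact: bounded_fm mf hc.
Qed.

Lemma cvg_normal_coord_Op q (V : 'M[R]_q) (Y : nat -> Omega -> 'rV[R]_q) j :
  (forall n, measurable_fun [set: Omega] (fun w => Y n w 0 j)) ->
  cvg_normal_vec P Y V -> Op P (fun n w => Y n w 0 j).
Proof.
move=> mY [mu _ hY].
have hc : continuous (fun y : 'rV[R]_q => y 0 j : R) by exact: coord_continuous.
apply: (cvg_in_dist_Op mY _ (cvg_in_dist_comp hc hY)).
by rewrite /row_of_tuple; under eq_fun do rewrite mxE; exact: measurable_tnth.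
Qed.

End normal_limit.

Theorem theorem3p4 (R : realType) (d dalpha : nat)
  (* the process *)
  (dO : measure_display) (Omega : measurableType dO) (P : probability Omega R)
  (XX : set (Rvec R d)) (X : nat -> {RV P >-> Rvec R d})
  (hXX : forall t w, XX (X t w))
  (hmarkov : markov_chain P (fun t => X t : Omega -> Rvec R d))
  (hstat : strictly_stationary P (fun t => X t : Omega -> Rvec R d))
  (herg : ergodic P (fun t => X t : Omega -> Rvec R d))
  (* the family m *)
  (m : Rvec R d -> Rvec R d -> 'rV[R]_dalpha -> R) (alpha0 : 'rV[R]_dalpha)
  (hmmeas : forall alpha,
     measurable_fun [set: Rvec R d * Rvec R d] (fun z => m z.1 z.2 alpha))
  (hmpos : {ae P, forall w, 0 < m (X 0%N w) (X 1%N w) alpha0})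
  (* the sieve *)
  (b : forall k : nat, 'I_k -> Rvec R d -> R)
  (hbL2 : forall k i, L2 (distribution P (X 0%N)) (b k i))
  (hbindep : forall k, lin_indep (distribution P (X 0%N)) (b k))
  (k : nat -> nat) (hk : k n @[n --> \oo] --> \oo)
  (* the estimators *)
  (alphahat : nat -> Omega -> 'rV[R]_dalpha)
  (halphahat : forall n j, measurable_fun [set: Omega] (fun w => alphahat n w 0 j))
  (rhohat : nat -> {RV P >-> R})
  (* the eigenvalue, the eigenfunctions and the other objects in (A5) *)
  (rho : R) (phi phis : Rvec R d -> R)
  (psi_alpha : nat -> Omega -> 'rV[R]_dalpha)
  (hpsi_alpha : forall t j, measurable_fun [set: Omega] (fun w => psi_alpha t w 0 j))
  (V2a : 'M[R]_(1 + dalpha))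
  (N : set 'rV[R]_dalpha) (mbar : Rvec R d -> Rvec R d -> R) (s : R) :
  let x := fun w t => X t w in
  let Q : probability (Rvec R d) R := distribution P (X 0%N) in
  let m0 := fun x0 x1 => m x0 x1 alpha0 in
  let M := Mop P (fun t => X t) m0 in
  let Mstar := Mop_adj P (fun t => X t) m0 in
  let Pi := fun n => orth_proj Q (b (k n)) in
  let G := fun n => Gmat P (fun t => X t) (b (k n)) in
  let MM := fun n => Mmat P (fun t => X t) m0 (b (k n)) in
  let Gh := fun n w => Ghat (b (k n)) (x w) n in
  let Mh := fun n w =>
    Mhat (fun x0 x1 => m x0 x1 (alphahat n w)) (b (k n)) (x w) n in
  let Mo := fun n => orthonormalized (G n) (MM n) in
  let Gho := fun n w => orthonormalized (G n) (Gh n w) in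
  let Mho := fun n w => orthonormalized (G n) (Mh n w) in
  let dm := fun x0 x1 => gradient (m x0 x1) in
  let psir := fun t w => psi_rho m0 rho phi phis (X t w) (X t.+1 w) in
  (* rhohat is the largest real generalized eigenvalue, when there is one *)
  (forall n w r, largest_gen_eigenvalue (Mh n w) (Gh n w) r -> rhohat n w = r) ->
  (* normalization *)
  L2norm Q phi = 1%E -> inner Q phi phis = 1 ->
  (* (A1) *)
  Mop_bounded P Q (fun t => X t) m0 ->
  0 < rho ->
  unique_positive_eigenfunction Q M rho phi ->
  unique_positive_eigenfunction Q Mstar rho phis ->
  simple_eigenvalue Q M (Complex rho 0) ->
  isolated_eigenvalue Q M (Complex rho 0) ->
  largest_eigenvalue Q M rho ->
  (forall psi, L2 Q psi ->
     {ae Q, forall y, (rho ^- tau * iter tau M psi y) @[tau --> \oo] -->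
                      inner Q psi phis * phi y}) ->
  (* (A2) *)
  op_norm Q (fun psi => Pi n (M psi) \- M psi) @[n --> \oo] --> 0%E ->
  (* (A3) *)
  little_op P (fun n w => mx_opnorm (Gho n w - 1%:M)) (fun=> 1) ->
  little_op P (fun n w => mx_opnorm (Mho n w - Mo n)) (fun=> 1) ->
  (* (A4)(a) *)
  ((Num.sqrt n%:R)%:E * L2norm Q (Pi n phi \- phi)%R)%E @[n --> \oo] --> 0%E ->
  ((Num.sqrt n%:R)%:E * L2norm Q (Pi n phis \- phis)%R)%E @[n --> \oo] --> 0%E ->
  (* (A4)(b) *)
  little_op P (fun n w => mx_opnorm (Gho n w - 1%:M)) (fun n => n%:R `^ (- 4^-1)) ->
  little_op P (fun n w => mx_opnorm (Mho n w - Mo n)) (fun n => n%:R `^ (- 4^-1)) ->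
  (* (A4)(c) *)
  finite_mean P
    (fun w => (phis (X 0%N w) * m0 (X 0%N w) (X 1%N w) * phi (X 1%N w)) ^+ 2) ->
  (* (A5)(a) *)
  little_op P
    (fun n w => enorm (Num.sqrt n%:R *: (alphahat n w - alpha0)
       - (Num.sqrt n%:R)^-1 *: \sum_(t < n) psi_alpha t w)) (fun=> 1) ->
  (* (A5)(b) *)
  cvg_normal_vec P
    (fun n w => (Num.sqrt n%:R)^-1 *:
       \sum_(t < n) row_mx (psir t w)%:M (psi_alpha t w)) V2a ->
  (* (A5)(c) *)
  open_nbhs alpha0 N ->
  (forall x0 x1, XX x0 -> XX x1 -> continuously_differentiable_on (m x0 x1) N) ->
  2 <= s ->
  finite_mean P (fun w => mbar (X 0%N w) (X 1%N w) `^ s) ->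
  (forall x0 x1, XX x0 -> XX x1 ->
     forall alpha, N alpha -> enorm (dm x0 x1 alpha) <= mbar x0 x1) ->
  (* (A5)(d) *)
  finite_mean P (fun w => (phi (X 1%N w) * phis (X 0%N w)) `^ (s / (s - 1))) ->
  let h2a : 'rV[R]_(1 + dalpha) := row_mx 1%:M
    (\row_j Ex P (fun w =>
       phis (X 0%N w) * phi (X 1%N w) * dm (X 0%N w) (X 1%N w) alpha0 0 j)) in
  let Vrho := (h2a *m V2a *m h2a^T) 0 0 in
  cvg_normal P (fun n w => Num.sqrt n%:R * (rhohat n w - rho)) Vrho.
Proof.
move=> x Q m0 M Mstar Pi G MM Gh Mh Mo Gho Mho dm psir hrho phi1 phiphis hM rho0.
move=> [hphi phi_pos phi_eig _] [hphis phis_pos phis_eig _] hsimple hisol hlarge _ hop hG1 hM1.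
move=> hPphi hPphis hG4 hM4 _ hA5a hA5b hN cdm s2 hmb grad_le hprod h2a Vrho.
pose X' t : Omega -> Rvec R d := X t.
have mX t : measurable_fun [set: Omega] (X' t) by exact: measurable_funPT.
have law t B : measurable B -> P (X' t @^-1` B) = Q B.
  by move=> mB; rewrite (stationary_marginal hstat t mB).
have mm a : measurable2 (fun x y => m x y a) by exact: hmmeas.
have mm0 : measurable_fun [set: Omega] (fun w => m0 (X' 0%N w) (X' 1%N w)).
  exact: (at_pair_measurable mX 0 (mm alpha0)).
have [C [e0 te]] := top_eigenvalue_Mop mX law mm0 hmpos hM hphi hphis phi1 phiphis rho0
  phi_eig phis_eig hsimple hisol hlarge hbL2 hbindep hk hG1 hop.
pose Y n w : 'rV[R]_(1 + dalpha) :=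
  (Num.sqrt n%:R)^-1 *: \sum_(t < n) row_mx (psir t w)%:M (psi_alpha t w).
have Y0 n w : Y n w 0 (lshift dalpha 0) = (Num.sqrt n%:R)^-1 * \sum_(t < n) psir t w.
  rewrite /Y mxE summxE; congr (_ * _); apply: eq_bigr => t _.
  by rewrite row_mxEl mxE eqxx mulr1n.
have Yr n w j : Y n w 0 (rshift 1 j) = (Num.sqrt n%:R)^-1 * \sum_(t < n) psi_alpha t w 0 j.
  by rewrite /Y mxE summxE; congr (_ * _); apply: eq_bigr => t _; rewrite row_mxEr.
have mpsir t : measurable_fun [set: Omega] (psir t).
  have mp u : measurable_fun [set: Omega] (fun w => phi (X' u w)).
    exact: (measurableT_comp (L2_measurable hphi) (mX u)).
  have mps u : measurable_fun [set: Omega] (fun w => phis (X' u w)).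
    exact: (measurableT_comp (L2_measurable hphis) (mX u)).
  have mmt := at_pair_measurable mX t (mm alpha0).
  exact: (measurable_funB (measurable_funM (measurable_funM (mps t) mmt) (mp t.+1))
    (measurable_funM (measurable_funM (measurable_cst rho) (mps t)) (mp t))).
have mY n j : measurable_fun [set: Omega] (fun w => Y n w 0 j).
  case: (splitP j) => i ji.
    rewrite (_ : j = lshift dalpha 0); last by apply: val_inj; rewrite /= ji (ord1 i).
    under eq_fun do rewrite Y0; apply: measurable_funM => //.
    by apply: measurable_sum.
  rewrite (_ : j = rshift 1 i); last by apply: val_inj; rewrite /= ji.
  under eq_fun do rewrite Yr; apply: measurable_funM => //.
  by apply: measurable_sum => t; exact: hpsi_alpha.
have o5 j : op P (fun n w => Num.sqrt n%:R * (alphahat n w - alpha0) 0 j - Y n w 0 (rshift 1 j)).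
  apply: op_le (little_op1 hA5a) _ => n w; rewrite [leRHS]ger0_norm ?enorm_ge0 // Yr.
  apply: le_trans (abs_le_enorm _ 0 j); rewrite le_eqVlt; apply/orP; left; apply/eqP.
  by congr (`|_|); rewrite [RHS]mxE [X in _ = X + _]mxE [X in _ = _ + X]mxE [X in _ = _ - X]mxE summxE.
(* The scaled estimation error is O_p(1) because its influence average is a coordinate of a vector
   that converges in law. *)
have hah j : Op P (fun n w => Num.sqrt n%:R * (alphahat n w - alpha0) 0 j).
  have hY := cvg_normal_coord_Op (fun n => mY n (rshift 1 j)) hA5b.
  apply: Op_le (OpD (op_Op (o5 j)) hY) _ => n w.
  by rewrite subrK.
have o6 := sample_eigenvalue_expansion mX law hstat herg hXX mm hN cdm s2 hmb grad_le
  phi_pos phis_pos hprod hah hmpos te hbL2 hbindep hk hG1 hM1 hop hPphi hPphis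
  hG4 hM4 hrho.
apply: (cvg_normal_linear mY _ hA5b) => [n|].
  by apply: measurable_funM => //; apply: measurable_funB.
(* Replacing the scaled estimation error by its influence average turns the expansion into the
   linear functional [h2a] of [Y]. *)
have o7 : op P (fun n w => \sum_j h2a 0 (rshift 1 j) *
    (Num.sqrt n%:R * (alphahat n w - alpha0) 0 j - Y n w 0 (rshift 1 j))).
  by apply: op_sum => j; exact: opZ.
apply: op_eq (opD o6 o7) _ => n w.
rewrite big_split_ord big_ord1 Y0 /=.
under [X in _ = _ + X]eq_bigr do rewrite mulrBr.
rewrite [X in _ = _ + X]sumrB.
under [X in _ = _ - (_ + X) + _]eq_bigr => j _.
  rewrite [X in X * _](_ : _ = h2a 0 (rshift 1 j)); last by rewrite /h2a row_mxEr mxE.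
  over.
have -> : h2a 0 (lshift dalpha 0) = 1 by rewrite /h2a row_mxEl mxE.
by rewrite mul1r; ring.
Qed.
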